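(* Let $S=\{z\in\mathbb{C}:|z|=1\}$, $B=(S\times\{1\})\cup(\{1\}\times S)$, $b_0=(1,1)\in B$, and let $f:B\to B$ be the continuous map given by $$f(z,1)=\begin{cases}(z^4,1),&0\le\arg z\le\frac{\pi}{2}\\(1,z^4),&\frac{\pi}{2}\le\arg z\le\pi\\(z^{-4},1),&\pi\le\arg z\le\frac{3\pi}{2}\\(1,z^{-4}),&\frac{3\pi}{2}\le\arg z\le2\pi\end{cases}\qquad f(1,t)=\begin{cases}(t^{-4},1),&0\le\arg t\le\frac{\pi}{2}\\(1,t^{-4}),&\frac{\pi}{2}\le\arg t\le\pi\\(t^{4},1),&\pi\le\arg t\le\frac{3\pi}{2}\\(1,t^{4}),&\frac{3\pi}{2}\le\arg t\le2\pi\end{cases}$$ for $z,t\in S$. Let the group $Z_2=\{e,g\}$ act on $B$ by $g(z,1)=(1,z^{-1})$, $g(1,t)=(t^{-1},1)$; the map $f$ is equivariant for this action. Let $P=\varprojlim\{B,f\}$ be the limit of the inverse sequence $B\xleftarrow{f}B\xleftarrow{f}B\xleftarrow{f}\cdots$ with the induced (coordinatewise) $Z_2$-action. Then $P$ is a connected, compact, metrizable $Z_2$-space which is not equivariantly movable (not $Z_2$-movable), the action is free at all points except at the only fixed point $(b_0,b_0,\dots)$, and the orbit space $P|_{Z_2}$ has trivial shape: $sh(P|_{Z_2})=0$.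
   Context: $P|_{Z_2}$ is the set of $Z_2$-orbits of $P$ with the quotient topology. $sh(X)=0$ means that $X$ has the shape of a one-point space. The action is free at a point $x$ if the stabilizer of $x$ is trivial. Conventions (used with $G=Z_2$): all topological groups $G$ are compact (Hausdorff) and all topological spaces are $p$-paracompact, i.e. paracompact $p$-spaces in the sense of Arhangel'skii (equivalently, Hausdorff spaces admitting a perfect map onto a metrizable space). A $G$-space is a space with a continuous action $G\times X\to X$; a $G$-map is a continuous equivariant map; a $G$-homotopy is an equivariant homotopy $X\times I\to Y$ ($G$ acting trivially on $I=[0,1]$), and $G$-homotopy classes of $G$-maps are composed via representatives. $P_G$ is the class of $p$-paracompact $G$-spaces. A $G$-space $Y$ is a $G$-$ANR(P_G)$ if $Y\in P_G$ and whenever $Y$ is a closed invariant subset of a $G$-space $Z\in P_G$, there exist an invariant neighborhood $U$ of $Y$ in $Z$ and a $G$-map $r:U\to Y$ with $r|_Y=1_Y$. Below, ''$G$-$ANR$'' means $G$-$ANR(P_G)$. An inverse $G$-system $\underline{X}=\{X_\alpha,p_{\alpha\alpha'},A\}$ consists of $G$-spaces $X_\alpha$ indexed by a directed set $A$ and $G$-homotopy classes $p_{\alpha\alpha'}:X_{\alpha'}\to X_\alpha$ for $\alpha\le\alpha'$, with $p_{\alpha\alpha}=\mathrm{id}$ and $p_{\alpha\alpha'}p_{\alpha'\alpha''}=p_{\alpha\alpha''}$. It is $G$-movable (equivariantly movable) if for every $\alpha\in A$ there is $\alpha'\ge\alpha$ such that for all $\alpha''\ge\alpha$ there is a $G$-homotopy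 class $r^{\alpha'\alpha''}:X_{\alpha'}\to X_{\alpha''}$ with $p_{\alpha\alpha''}\circ r^{\alpha'\alpha''}=p_{\alpha\alpha'}$. An inverse $G$-$ANR$-system (one whose terms are $G$-$ANR$'s) is associated with $X$ (in the sense of Morita; equivalently, it is a $G$-$ANR$-expansion of $X$) if there are $G$-homotopy classes $p_\alpha:X\to X_\alpha$ with $p_\alpha=p_{\alpha\alpha'}p_{\alpha'}$ for $\alpha\le\alpha'$ such that for every $G$-$ANR$ $K$: (i) each $G$-homotopy class $h:X\to K$ has the form $h=f p_\alpha$ for some $\alpha$ and some $G$-homotopy class $f:X_\alpha\to K$; (ii) if $f,f':X_\alpha\to K$ are $G$-homotopy classes with $fp_\alpha=f'p_\alpha$, then $fp_{\alpha\alpha'}=f'p_{\alpha\alpha'}$ for some $\alpha'\ge\alpha$. A $G$-space $X$ is $G$-movable (equivariantly movable) if there is a $G$-movable inverse $G$-$ANR$-system associated with $X$. *)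

(* Defs.v *)
From HB Require Import structures.
From mathcomp Require Import all_boot all_order all_algebra.
From mathcomp Require Import all_classical all_reals all_analysis.
From mathcomp Require Import complex.
From mathcomp Require Import ring lra.

Set Implicit Arguments.
Unset Strict Implicit.
Unset Printing Implicit Defensive.

Import Order.TTheory GRing.Theory Num.Theory.
Import numFieldNormedType.Exports.

Local Open Scope classical_set_scope.
Local Open Scope ring_scope.

HB.mixin Record isCompactGroup G & Topological G & Group G := {
  mulg_continuous : continuous (fun p : G * G => (p.1 * p.2)%g);
  invg_continuous : continuous (fun g : G => (g^-1)%g);
  compactGroup_compact : compact [set: G];
  compactGroup_hausdorff : hausdorff_space G
}.

#[short(type="compactGroupType")]
HB.structure Definition CompactGroup :=
  { G of Topological G & Group G & isCompactGroup G }.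

Record gSpace (G : compactGroupType) := GSpace {
  gcarrier :> topologicalType;
  gact : G -> gcarrier -> gcarrier;
  gact1 : forall x, gact 1%g x = x;
  gactM : forall g h x, gact (g * h)%g x = gact g (gact h x);
  gact_continuous : continuous (fun p : G * gcarrier => gact p.1 p.2)
}.

Record gMap (G : compactGroupType) (X Y : gSpace G) := GMap {
  gfun :> X -> Y;
  gfun_continuous : continuous gfun;
  gfun_equivariant : forall g x, gfun (gact g x) = gact g (gfun x)
}.

Section gmaps.
Context {G : compactGroupType}.

Definition gid (X : gSpace G) : gMap X X.
Proof. by exists id => // x; exact: cvg_id. Defined.

Definition gcomp (X Y Z : gSpace G) (f : gMap Y Z) (h : gMap X Y) : gMap X Z.
Proof.
exists (f \o h) => [x|g x /=]; last by rewrite !gfun_equivariant.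
by apply: continuous_comp; exact: gfun_continuous.
Defined.

End gmaps.

Notation "f \og h" := (gcomp f h) (at level 50, left associativity).

Definition unit_interval (R : realType) : set R := `[0, 1].
Arguments unit_interval : clear implicits.

(* [f] and [f'] represent the same G-homotopy class. *)
Definition ghomotopic (R : realType) (G : compactGroupType) (X Y : gSpace G)
    (f f' : gMap X Y) : Prop :=
  exists H : (X * unit_interval R)%type -> Y,
    [/\ continuous H,
        forall g x t, H (gact g x, t) = gact g (H (x, t)),
        forall x t, set_val t = 0 -> H (x, t) = f x
      & forall x t, set_val t = 1 -> H (x, t) = f' x].

Definition locally_finite (T : topologicalType) (F : set (set T)) : Prop :=
  forall x : T, exists2 U, nbhs x U &
    finite_set [set A | F A /\ A `&` U !=set0].

Definition open_cover (T : topologicalType) (F : set (set T)) : Prop :=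
  F `<=` open /\ \bigcup_(A in F) A = setT.

Definition paracompact (T : topologicalType) : Prop :=
  hausdorff_space T /\
  forall C : set (set T), open_cover C ->
    exists V : set (set T),
      [/\ open_cover V,
          forall A, V A -> exists2 B, C B & A `<=` B
        & locally_finite V].

Definition embedding (X Y : topologicalType) (e : X -> Y) : Prop :=
  injective e /\
  forall U : set X, open U <-> exists2 V : set Y, open V & U = e @^-1` V.

Definition hausdorff_compactification (X K : topologicalType) (e : X -> K)
    : Prop :=
  [/\ compact [set: K], hausdorff_space K, embedding e & dense (range e)].

Definition star (T : Type) (x : T) (F : set (set T)) : set T :=
  \bigcup_(A in [set A | F A /\ A x]) A.

(* A feathering (plumage) of the subset [X] in [K]. *)
Definition feathering (K : topologicalType) (X : set K)
    (F : nat -> set (set K)) : Prop :=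
  (forall n, F n `<=` open /\ X `<=` \bigcup_(A in F n) A) /\
  forall x, X x -> \bigcap_n star x (F n) `<=` X.

(* A p-space in the sense of Arhangel'skii: a space which has a feathering in
   some, equivalently in every, Hausdorff compactification. *)
Definition p_space (X : topologicalType) : Prop :=
  exists (K : topologicalType) (e : X -> K) (F : nat -> set (set K)),
    hausdorff_compactification e /\ feathering (range e) F.

Definition p_paracompact (X : topologicalType) : Prop :=
  paracompact X /\ p_space X.

(* The inclusion of a closed invariant subset is given, up to homeomorphism,
   by an equivariant embedding [i] with closed image; the retraction [r] of the
   invariant neighborhood [U] is a map on the subspace [U], so that [Y] and [U]
   may be empty. *)
Definition is_gANR (G : compactGroupType) (Y : gSpace G) : Prop :=
  p_paracompact Y /\
  forall (Z : gSpace G) (i : gMap Y Z),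
    p_paracompact Z -> embedding i -> closed (range i) ->
    exists (U : set Z) (r : U -> Y),
      [/\ range i `<=` interior U,
          forall g x, U x -> U (gact g x),
          continuous r,
          forall g (u v : U),
            set_val v = gact g (set_val u) -> r v = gact g (r u)
        & forall (y : Y) (u : U), set_val u = i y -> r u = y].

(* G-homotopy classes are handled through representatives, and the equalities
   between them are G-homotopies. *)
Record inverse_system (R : realType) (G : compactGroupType) :=
  InverseSystem {
  sys_index : Type;
  sys_le : sys_index -> sys_index -> Prop;
  sys_inhabited : inhabited sys_index;
  sys_refl : forall a, sys_le a a;
  sys_trans : forall b a c, sys_le a b -> sys_le b c -> sys_le a c;
  sys_directed : forall a b, exists c, sys_le a c /\ sys_le b c;
  sys_obj :> sys_index -> gSpace G;
  sys_map : forall a a', sys_le a a' -> gMap (sys_obj a') (sys_obj a);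
  sys_map_id : forall a (h : sys_le a a),
    ghomotopic R (sys_map h) (gid (sys_obj a));
  sys_map_comp : forall a a' a''
      (h : sys_le a a') (h' : sys_le a' a'') (h'' : sys_le a a''),
    ghomotopic R (sys_map h \og sys_map h') (sys_map h'')
}.

Section inverse_systems.
Context {R : realType} {G : compactGroupType}.
Implicit Types (S T : inverse_system R G) (X : gSpace G).

Definition gANR_system S : Prop := forall a, is_gANR (S a).

Definition associated X S : Prop :=
  exists p : forall a, gMap X (S a),
    (forall a a' (h : sys_le a a'),
       ghomotopic R (p a) (sys_map h \og p a')) /\
    forall K : gSpace G, is_gANR K ->
      (forall h : gMap X K, exists a (f : gMap (S a) K),
         ghomotopic R h (f \og p a)) /\
      (forall a (f f' : gMap (S a) K),
         ghomotopic R (f \og p a) (f' \og p a) ->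
         exists a' (h : sys_le a a'),
           ghomotopic R (f \og sys_map h) (f' \og sys_map h)).

Definition movable_system S : Prop :=
  forall a, exists a' (h : sys_le a a'),
    forall a'' (h' : sys_le a a''), exists r : gMap (S a') (S a''),
      ghomotopic R (sys_map h' \og r) (sys_map h).

Record system_morphism S T := SystemMorphism {
  mor_index : sys_index T -> sys_index S;
  mor_map : forall b, gMap (S (mor_index b)) (T b);
  mor_coherent : forall b b' (h : sys_le b b'),
    exists a (k : sys_le (mor_index b) a) (k' : sys_le (mor_index b') a),
      ghomotopic R (mor_map b \og sys_map k)
                   (sys_map h \og mor_map b' \og sys_map k')
}.

(* [u] followed by [v] is equivalent to the identity morphism of [S], i.e. they
   are equal in the pro-category. *)
Definition retracts S T (u : system_morphism S T) (v : system_morphism T S)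
    : Prop :=
  forall a, exists a' (h : sys_le (mor_index u (mor_index v a)) a')
                   (k : sys_le a a'),
    ghomotopic R (mor_map v a \og mor_map u (mor_index v a) \og sys_map h)
                 (sys_map k).

Definition pro_isomorphic S T : Prop :=
  exists (u : system_morphism S T) (v : system_morphism T S),
    retracts u v /\ retracts v u.

End inverse_systems.

Definition gmovable (R : realType) (G : compactGroupType) (X : gSpace G)
    : Prop :=
  exists S : inverse_system R G,
    [/\ gANR_system S, associated X S & movable_system S].

Fact discrete_fun_continuous (G : topologicalType) (X Y : topologicalType)
    (f : G * X -> Y) :
  (forall g : G, nbhs g [set g]) -> (forall g, continuous (fun x => f (g, x))) ->
  continuous f.
Proof.
move=> dG cf [g x] U /(cf g x) /= Ux; exists ([set g], (fun x => f (g, x)) @^-1` U) => //.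
by move=> [_ y] [/= -> ].
Qed.

Definition point_space : Type := unit.

HB.instance Definition _ := Choice.on point_space.
HB.instance Definition _ :=
  Topological.copy point_space (discrete_topology unit).

Definition trivial_group : Type := point_space.

HB.instance Definition _ := Topological.on trivial_group.

HB.instance Definition _ := @isGroup.Build trivial_group tt (fun=> tt)
  (fun _ _ => tt) (fun _ _ _ => erefl) (fun x => let: tt := x in erefl)
  (fun x => let: tt := x in erefl) (fun=> erefl) (fun=> erefl).

Fact trivial_group_mul_continuous :
  continuous (fun p : trivial_group * trivial_group => (p.1 * p.2)%g).
Proof.
apply: discrete_fun_continuous => [g|g x U /nbhs_singleton Ux].
  exact: (@discrete_set1 (discrete_topology unit)).
by apply: filterS (fun y _ => Ux) (@filterT _ (nbhs x) _).
Qed.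

Fact trivial_group_inv_continuous :
  continuous (fun g : trivial_group => (g^-1)%g).
Proof.
by move=> x U /nbhs_singleton Ux; apply: filterS (fun y _ => Ux) (@filterT _ (nbhs x) _).
Qed.

Fact trivial_group_compact : compact [set: trivial_group].
Proof.
rewrite (_ : setT = [set tt : trivial_group]); first exact: compact_set1.
by apply/seteqP; split => // -[].
Qed.

Fact trivial_group_hausdorff : hausdorff_space trivial_group.
Proof. by move=> [] []. Qed.

HB.instance Definition _ := isCompactGroup.Build trivial_group
  trivial_group_mul_continuous trivial_group_inv_continuous
  trivial_group_compact trivial_group_hausdorff.

Definition plain_space (X : topologicalType) : gSpace trivial_group.
Proof.
by exists X (fun _ x => x) => // -[g x]; exact: cvg_snd.
Defined.

(* Ordinary shape theory is the case of the trivial group: an ANR is then an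
   absolute neighborhood retract for p-paracompact spaces, and two spaces have
   the same shape when they have associated ANR-systems which are isomorphic in
   the pro-category (the choice of the systems does not matter). *)
Definition same_shape (R : realType) (X Y : topologicalType) : Prop :=
  exists S T : inverse_system R trivial_group,
    [/\ gANR_system S, associated (plain_space X) S,
        gANR_system T, associated (plain_space Y) T & pro_isomorphic S T].

Definition trivial_shape (R : realType) (X : topologicalType) : Prop :=
  same_shape R X point_space.

Definition metrizable (R : realType) (X : topologicalType) : Prop :=
  exists (M : metricType R) (h : X -> M) (k : M -> X),
    [/\ continuous h, continuous k, cancel h k & cancel k h].

Section gspaces.
Context {G : compactGroupType}.
Implicit Types X : gSpace G.

Definition fixed_point X (x : X) : Prop := forall g, gact g x = x.

Definition free_at X (x : X) : Prop := forall g, gact g x = x -> g = 1%g.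

Definition same_orbit X (x y : X) : bool := `[< exists g, gact g x = y >].

Fact same_orbit_refl X : reflexive (@same_orbit X).
Proof. by move=> x; apply/asboolP; exists 1%g; rewrite gact1. Qed.

Fact same_orbit_sym X : symmetric (@same_orbit X).
Proof.
by move=> x y; apply/asboolP/asboolP => -[g <-]; exists (g^-1)%g;
  rewrite -gactM mulVg gact1.
Qed.

Fact same_orbit_trans X : transitive (@same_orbit X).
Proof.
move=> y x z /asboolP[g <-] /asboolP[h <-].
by apply/asboolP; exists (h * g)%g; rewrite gactM.
Qed.

Definition orbit_equiv X : equiv_rel X :=
  EquivRel (@same_orbit X) (@same_orbit_refl X) (@same_orbit_sym X)
    (@same_orbit_trans X).

Definition orbit_space X : topologicalType :=
  quotient_topology {eq_quot (orbit_equiv X)}%qT.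

Section inverse_limit.
Variables (X : nat -> gSpace G) (f : forall n, gMap (X n.+1) (X n)).

(* Points of the limit of the inverse sequence X 0 <- X 1 <- X 2 <- ..., a
   subspace of the product. *)
Definition threads : set (prod_topology (fun n => X n : topologicalType)) :=
  [set x | forall n, f n (x n.+1) = x n].

Definition thread_act (g : G) (x : threads) : threads.
Proof.
exists (fun n => gact g (set_val x n)); apply/mem_set => n.
by rewrite gfun_equivariant (set_valP x).
Defined.

Fact thread_act1 x : thread_act 1%g x = x.
Proof. by apply: val_inj; apply: functional_extensionality_dep => n /=; rewrite gact1. Qed.

Fact thread_actM g h x : thread_act (g * h)%g x = thread_act g (thread_act h x).
Proof. by apply: val_inj; apply: functional_extensionality_dep => n /=; rewrite gactM. Qed.

Fact thread_act_continuous :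
  continuous (fun p : G * threads => thread_act p.1 p.2).
Proof.
apply: continuous_comp_initial => p; apply/cvg_sup => n.
move: p; apply: (@continuous_comp_initial _ _ _ (fun x : forall n, X n => x n)).
move=> p; apply: (@continuous_comp _ _ _
  (fun p : G * threads => (p.1, set_val p.2 n)) (fun q => gact q.1 q.2)); last first.
  exact: gact_continuous.
apply: cvg_pair => /=; first exact: cvg_fst.
apply: (@continuous_comp _ _ _ (fun p : G * threads => set_val p.2) (proj n)).
  apply: (@continuous_comp _ _ _ snd set_val); first exact: cvg_snd.
  exact: initial_continuous.
exact: proj_continuous.
Qed.

Definition inverse_limit : gSpace G :=
  GSpace thread_act1 thread_actM thread_act_continuous.

End inverse_limit.

End gspaces.

(* The group of order 2; the generator [g] is [true]. *)
Definition Z2 : Type := bool.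

HB.instance Definition _ := Topological.on Z2.
HB.instance Definition _ := @isGroup.Build Z2 false id addb
  addbA addFb addbF addbb addbb.

Fact Z2_mul_continuous : continuous (fun p : Z2 * Z2 => (p.1 * p.2)%g).
Proof.
apply: discrete_fun_continuous => [|g x U /nbhs_singleton Ux]; first exact: (@discrete_set1 bool).
by apply: (filterS _ (@discrete_set1 bool x)) => _ ->.
Qed.

Fact Z2_inv_continuous : continuous (fun g : Z2 => (g^-1)%g).
Proof.
move=> x U /nbhs_singleton Ux.
by apply: (filterS _ (@discrete_set1 bool x)) => _ ->.
Qed.

Fact Z2_hausdorff : hausdorff_space Z2.
Proof.
move=> x y /(_ _ _ (@discrete_set1 bool x) (@discrete_set1 bool y)).
by move=> [_ [-> ->]].
Qed.

HB.instance Definition _ := isCompactGroup.Build Z2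
  Z2_mul_continuous Z2_inv_continuous bool_compact Z2_hausdorff.

(* The topology of the complex plane is that of its norm. *)
HB.instance Definition _ (R : realType) :=
  NormedModule.copy R[i] (R[i] : numClosedFieldType)^o.

Fact pair_continuous (X Y Z : topologicalType) (f : X -> Y) (g : X -> Z) :
  continuous f -> continuous g -> continuous (fun x => (f x, g x)).
Proof. by move=> cf cg x; apply: cvg_pair => /=; [exact: cf|exact: cg]. Qed.

Section bouquet.
Variable R : realType.
Local Notation C := R[i].

Definition circle : set C := [set z | `|z| = 1].

(* The argument in [0, 2 pi) of a point of the circle; a junk value off the
   circle. *)
Definition arg (z : C) : R :=
  xget 0 [set t | 0 <= t < 2 * pi /\ z = (cos t +i* sin t)%C].

Definition bouquet : set (C * C) :=
  (circle `*` [set 1]) `|` ([set 1] `*` circle).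

(* Only meaningful on [bouquet]. The first matching case is taken; the cases of
   the piecewise definition agree where they overlap (see [bouquet_map_l] and
   [bouquet_map_r]), and at (1, 1) both formulas give (1, 1). The value
   [2 pi] of the argument is 0 here. *)
Definition bouquet_map (w : C * C) : C * C :=
  let: (z, t) := w in
  if t == 1 then
    if arg z <= pi / 2 then (z ^+ 4, 1)
    else if arg z <= pi then (1, z ^+ 4)
    else if arg z <= 3 * pi / 2 then (z ^- 4, 1)
    else (1, z ^- 4)
  else
    if arg t <= pi / 2 then (t ^- 4, 1)
    else if arg t <= pi then (1, t ^- 4)
    else if arg t <= 3 * pi / 2 then (t ^+ 4, 1)
    else (1, t ^+ 4).

Definition bouquet_swap (w : C * C) : C * C :=
  let: (z, t) := w in if t == 1 then (1, z^-1) else (t^-1, 1).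

Lemma circleE (z : C) : circle z -> (complex.Re z) ^+ 2 + (complex.Im z) ^+ 2 = 1.
Proof.
case: z => a b; rewrite /circle /= => -[/(congr1 (fun x => x ^+ 2))].
by rewrite sqr_sqrtr ?addr_ge0 ?sqr_ge0// expr1n.
Qed.

Lemma circle_arg z : circle z ->
  0 <= arg z < 2 * pi /\ z = (cos (arg z) +i* sin (arg z))%C.
Proof.
move=> /circleE z1; apply: (@xgetPex _ 0
  [set t | 0 <= t < 2 * pi /\ z = (cos t +i* sin t)%C]).
case: z z1 => a b /= ab1; have pi0 := @pi_gt0 R.
have a1 : -1 <= a <= 1 by nra.
have ca : cos (acos a) = a by apply: acosK; rewrite in_itv.
have sa : sin (acos a) = `|b|.
  by rewrite sin_acos// (_ : 1 - a ^+ 2 = b ^+ 2) ?sqrtr_sqr//; lra.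
have a0 := acos_ge0 a1; have api := acos_lepi a1.
have [b0|b0] := leP 0 b.
  exists (acos a); split; first by apply/andP; lra.
  by rewrite ca sa ger0_norm.
exists (2 * pi - acos a); split.
  suff : 0 < acos a by move=> ?; apply/andP; lra.
  rewrite acos_gt0//; apply/andP; nra.
have -> : 2 * pi - acos a = - (acos a) + pi *+ 2 by rewrite mulr2n; lra.
by rewrite cosD2pi sinD2pi cosN sinN ca sa ltr0_norm// opprK.
Qed.

Lemma arg_le1 z : circle z ->
  (arg z <= pi / 2) = (0 <= complex.Re z) && (0 <= complex.Im z).
Proof.
move=> /circle_arg[+ E]; move: (arg z) E => t -> /=; have pi0 := @pi_gt0 R.
move=> /andP[t0 t2]; apply/idP/idP => [tp|].
  by rewrite cos_ge0_pihalf ?sin_ge0_pi//; apply/andP; lra.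
apply: contraLR; rewrite -ltNge => tp; apply/negP => /andP[c0 s0].
have [tpi|tpi] := leP t pi.
  have : 0 < sin (t - pi / 2) by apply: sin_gt0_pi; apply/andP; lra.
  by rewrite sinBpihalf; lra.
have : 0 < sin (t - pi) by apply: sin_gt0_pi; apply/andP; lra.
by have := sinDpi (t - pi); rewrite subrK; lra.
Qed.

Lemma arg_le2 z : circle z -> (arg z <= pi) = (0 <= complex.Im z).
Proof.
move=> /circle_arg[+ E]; move: (arg z) E => t -> /=; have pi0 := @pi_gt0 R.
move=> /andP[t0 t2]; apply/idP/idP => [tp|].
  by rewrite sin_ge0_pi//; apply/andP; lra.
apply: contraLR; rewrite -!ltNge => tp.
have : 0 < sin (t - pi) by apply: sin_gt0_pi; apply/andP; lra.
by have := sinDpi (t - pi); rewrite subrK; lra.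
Qed.

Lemma arg_le3 z : circle z ->
  (arg z <= 3 * pi / 2) = (0 <= complex.Im z) || (complex.Re z <= 0).
Proof.
move=> cz; rewrite -(arg_le2 cz).
move/circle_arg: cz => [+ E]; move: (arg z) E => t -> /=; have pi0 := @pi_gt0 R.
move=> /andP[t0 t2]; have [tp|tp] /= := leP t pi; first by lra.
apply/idP/idP => [t3|].
  have : 0 <= cos (t - pi) by apply: cos_ge0_pihalf; apply/andP; lra.
  by have := cosDpi (t - pi); rewrite subrK; lra.
apply: contraLR; rewrite -!ltNge => t3.
have : 0 < cos (t - pi *+ 2) by apply: cos_gt0_pihalf; rewrite (mulr2n pi); apply/andP; lra.
by rewrite -cosD2pi subrK.
Qed.

Lemma circle_pow4 z : circle z -> complex.Re z * complex.Im z = 0 -> z ^+ 4 = 1.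
Proof.
move=> /circleE; case: z => a b /= + ab0.
have -> : ((a +i* b)%C ^+ 4 : C) = (((a ^+ 2 - b ^+ 2) ^+ 2 - 4 * (a * b) ^+ 2) +i* (4 * (a * b) * (a ^+ 2 - b ^+ 2)))%C.
  by rewrite !exprS !expr0 !mulr1; simpc; apply/eqP; rewrite eq_complex /=; apply/andP; split; apply/eqP; ring.
rewrite ab0 => h; apply/eqP; rewrite eq_complex /= !(mulr0, mul0r) eqxx andbT expr0n/= mulr0 subr0.
apply/eqP; transitivity ((a ^+ 2 + b ^+ 2) ^+ 2 - 4 * (a * b) ^+ 2); first by ring.
by rewrite h ab0; ring.
Qed.

Lemma circle1 : circle 1. Proof. exact: normr1. Qed.

Lemma circleX n z : circle z -> circle (z ^+ n).
Proof. by rewrite /circle/= normrX => ->; rewrite expr1n. Qed.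

Lemma circleV z : circle z -> circle z^-1.
Proof. by rewrite /circle/= normfV => ->; rewrite invr1. Qed.

Lemma circle_conj z : circle z -> z^-1 = (z^*)%C.
Proof. by move=> z1; rewrite invc_norm z1 expr1n invr1 mul1r. Qed.

Lemma bouquet_l z : circle z -> bouquet (z, 1 : C).
Proof. by left. Qed.

Lemma bouquet_r z : circle z -> bouquet (1, z).
Proof. by right. Qed.

Lemma bouquet_map_bouquet w : bouquet w -> bouquet (bouquet_map w).
Proof.
case: w => z t [[/= cz ->]|[/= -> ct]]; rewrite /bouquet_map.
  rewrite eqxx; do 3 ?[case: ifP => _];
    by [apply/bouquet_l/circleX | apply/bouquet_r/circleX
       |apply/bouquet_l/circleV/circleX | apply/bouquet_r/circleV/circleX].
case: ifP => _; do 3 ?[case: ifP => _];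
    by [apply/bouquet_l/circleX | apply/bouquet_r/circleX
       |apply/bouquet_l/circleV/circleX | apply/bouquet_r/circleV/circleX
       |apply/bouquet_l/circleX/circle1 | apply/bouquet_r/circleX/circle1
       |apply/bouquet_l/circleV/circleX/circle1
       | apply/bouquet_r/circleV/circleX/circle1].
Qed.

Lemma bouquet_swap_bouquet w : bouquet w -> bouquet (bouquet_swap w).
Proof.
case: w => z t [[/= cz ->]|[/= -> ct]]; rewrite /bouquet_swap.
  by rewrite eqxx; exact/bouquet_r/circleV.
by case: ifP => _; [apply/bouquet_r/circleV/circle1 | exact/bouquet_l/circleV].
Qed.

Lemma bouquet_swap_l z : bouquet_swap (z, 1 : C) = (1, z^-1).
Proof. by rewrite /bouquet_swap eqxx. Qed.

Lemma bouquet_swap_r t : bouquet_swap (1 : C, t) = (t^-1, 1).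
Proof. by rewrite /bouquet_swap; case: eqP => // ->; rewrite invr1. Qed.

Lemma bouquet_swapE w : bouquet w -> bouquet_swap w = (w.2^-1, w.1^-1).
Proof.
case: w => z t [[cz t1]|[z1 ct]];
  [rewrite (t1 : t = 1)|rewrite (z1 : z = 1)].
  by rewrite bouquet_swap_l invr1.
by rewrite bouquet_swap_r invr1.
Qed.

Lemma bouquet_swapK w : bouquet w -> bouquet_swap (bouquet_swap w) = w.
Proof.
move=> bw; rewrite bouquet_swapE; last exact: bouquet_swap_bouquet.
by rewrite bouquet_swapE//= !invrK; case: (w).
Qed.

Lemma arg_quadrants (T : Type) (v1 v2 v3 v4 : T) z : circle z ->
  (z ^+ 4 = 1 -> [/\ v1 = v2, v2 = v3 & v3 = v4]) ->
  let v := if arg z <= pi / 2 then v1 else if arg z <= pi then v2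
           else if arg z <= 3 * pi / 2 then v3 else v4 in
  [/\ 0 <= complex.Re z -> 0 <= complex.Im z -> v = v1,
      complex.Re z <= 0 -> 0 <= complex.Im z -> v = v2,
      complex.Re z <= 0 -> complex.Im z <= 0 -> v = v3
    & 0 <= complex.Re z -> complex.Im z <= 0 -> v = v4].
Proof.
move=> cz h; rewrite arg_le1// arg_le2// arg_le3//.
have {}h : complex.Re z * complex.Im z = 0 -> [/\ v1 = v2, v2 = v3 & v3 = v4].
  by move=> /(circle_pow4 cz).
have := circleE cz; move: (complex.Re z) (complex.Im z) h => x y h xy1.
by split => xs ys; case: (leP 0 x) => x0; case: (leP 0 y) => y0;
  case: (leP x 0) => x1 //=; first [by exfalso; lra
    | by have [|? ? ?] := h; [nra | congruence]].
Qed.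

(* The four closed arcs of the circle, in terms of real and imaginary parts. *)
Lemma bouquet_map_l z : circle z ->
  [/\ 0 <= complex.Re z -> 0 <= complex.Im z -> bouquet_map (z, 1 : C) = (z ^+ 4, 1),
      complex.Re z <= 0 -> 0 <= complex.Im z -> bouquet_map (z, 1 : C) = (1, z ^+ 4),
      complex.Re z <= 0 -> complex.Im z <= 0 -> bouquet_map (z, 1 : C) = (z ^- 4, 1)
    & 0 <= complex.Re z -> complex.Im z <= 0 -> bouquet_map (z, 1 : C) = (1, z ^- 4)].
Proof.
move=> cz; rewrite /bouquet_map eqxx.
by apply: arg_quadrants => // ->; rewrite invr1.
Qed.

Lemma bouquet_map_r t : circle t ->
  [/\ 0 <= complex.Re t -> 0 <= complex.Im t -> bouquet_map (1 : C, t) = (t ^- 4, 1),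
      complex.Re t <= 0 -> 0 <= complex.Im t -> bouquet_map (1 : C, t) = (1, t ^- 4),
      complex.Re t <= 0 -> complex.Im t <= 0 -> bouquet_map (1 : C, t) = (t ^+ 4, 1)
    & 0 <= complex.Re t -> complex.Im t <= 0 -> bouquet_map (1 : C, t) = (1, t ^+ 4)].
Proof.
move=> ct; rewrite /bouquet_map; have [->|_] := eqVneq t 1; last first.
  by apply: arg_quadrants => // ->; rewrite invr1.
by rewrite !expr1n invr1; case: ifP => _ //; case: ifP => _ //; case: ifP.
Qed.

Lemma bouquet_map_swap w : bouquet w ->
  bouquet_map (bouquet_swap w) = bouquet_swap (bouquet_map w).
Proof.
case: w => z t [[cz t1]|[z1 ct]];
  [rewrite (t1 : t = 1)|rewrite (z1 : z = 1)].
  have [r1 r2 r3 r4] := bouquet_map_r (circleV cz).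
  have [l1 l2 l3 l4] := bouquet_map_l cz.
  have [rz iz] : complex.Re z^-1 = complex.Re z /\ complex.Im z^-1 = - complex.Im z.
    by rewrite (circle_conj cz); case: (z).
  move: r1 r2 r3 r4; rewrite rz iz oppr_ge0 oppr_le0 => r1 r2 r3 r4.
  rewrite bouquet_swap_l.
  have [x0|/ltW x0] := leP 0 (complex.Re z);
    have [y0|/ltW y0] := leP 0 (complex.Im z).
  - by rewrite l1// r4// bouquet_swap_l exprVn.
  - by rewrite l4// r1// bouquet_swap_r exprVn invrK.
  - by rewrite l2// r3// bouquet_swap_r exprVn.
  - by rewrite l3// r2// bouquet_swap_l exprVn invrK.
have [l1 l2 l3 l4] := bouquet_map_l (circleV ct).
have [r1 r2 r3 r4] := bouquet_map_r ct.
have [rt it] : complex.Re t^-1 = complex.Re t /\ complex.Im t^-1 = - complex.Im t.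
  by rewrite (circle_conj ct); case: (t).
move: l1 l2 l3 l4; rewrite rt it oppr_ge0 oppr_le0 => l1 l2 l3 l4.
rewrite bouquet_swap_r.
have [x0|/ltW x0] := leP 0 (complex.Re t);
  have [y0|/ltW y0] := leP 0 (complex.Im t).
- by rewrite r1// l4// bouquet_swap_l exprVn invrK.
- by rewrite r4// l1// bouquet_swap_r exprVn.
- by rewrite r2// l3// bouquet_swap_r exprVn invrK.
- by rewrite r3// l2// bouquet_swap_l exprVn.
Qed.

Lemma Re_continuous : continuous (@complex.Re R : C -> R).
Proof.
move=> z; apply/(@cvgrPdist_lt _ _ _ (nbhs (z : C)) _) => e e0; apply/nbhs_ballP.
exists e%:C%C => [|y /=]; first by rewrite /= ltcR.
rewrite -ball_normE /= => zy; rewrite -ltcR; apply: le_lt_trans zy.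
by apply: le_trans (normc_ge_Re _); case: (z) (y) => a b [c d].
Qed.

Lemma Im_continuous : continuous (@complex.Im R : C -> R).
Proof.
move=> z; apply/(@cvgrPdist_lt _ _ _ (nbhs (z : C)) _) => e e0; apply/nbhs_ballP.
exists e%:C%C => [|y /=]; first by rewrite /= ltcR.
rewrite -ball_normE /= => zy; rewrite -ltcR; apply: le_lt_trans zy.
case: (z) (y) => a b [c d]; simpc; rewrite -sqrtr_sqr ler_wsqrtr //=.
by rewrite lerDr sqr_ge0.
Qed.

Let B : topologicalType := set_type bouquet.

Let v1 (w : B) : C := (set_val w).1.
Let v2 (w : B) : C := (set_val w).2.

Let v1_continuous : continuous v1.
Proof.
move=> w; apply: (@continuous_comp _ _ _ set_val fst); last exact: cvg_fst.
exact: initial_continuous.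
Qed.

Let v2_continuous : continuous v2.
Proof.
move=> w; apply: (@continuous_comp _ _ _ set_val snd); last exact: cvg_snd.
exact: initial_continuous.
Qed.

Let v1_circle w : circle (v1 w).
Proof. by case: (set_valP w) => [[]|[+ _]] //; rewrite /v1 => ->; exact: circle1. Qed.

Let v2_circle w : circle (v2 w).
Proof. by case: (set_valP w) => [[_ +]|[]] //; rewrite /v2 => ->; exact: circle1. Qed.

Let circleV_continuous (v : B -> C) : (forall w, circle (v w)) ->
  continuous v -> continuous (fun w => (v w)^-1).
Proof.
move=> cir cv w; apply: (@continuous_comp _ _ _ v GRing.inv); first exact: cv.
by apply: inv_continuous; rewrite -normr_eq0 (cir w) oner_eq0.
Qed.

Lemma bouquet_swap_continuous :
  continuous (fun w : B => bouquet_swap (set_val w)).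
Proof.
have E : (fun w : B => bouquet_swap (set_val w)) = (fun w => ((v2 w)^-1, (v1 w)^-1)).
  by apply/funext => w; exact: bouquet_swapE (set_valP w).
rewrite E; apply: pair_continuous; exact: circleV_continuous.
Qed.

Let half (b : bool) : set R := if b then [set x | 0 <= x] else [set x | x <= 0].

Let closed_half b : closed (half b).
Proof. by case: b; [exact: closed_ge|exact: closed_le]. Qed.

Let quadrant (b1 b2 : bool) (v v' : B -> C) : set B :=
  v' @^-1` [set 1] `&` ((complex.Re (R := R) \o v) @^-1` half b1 `&`
                        (complex.Im (R := R) \o v) @^-1` half b2).

Let closed_quadrant b1 b2 v v' : continuous v -> continuous v' ->
  closed (quadrant b1 b2 v v').
Proof.
move=> cv cv'; apply: closedI; last apply: closedI.
- apply: preimage_closed => [x _|]; first exact: cv'.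
  exact: (accessible_closed_set1 (hausdorff_accessible (@norm_hausdorff _ C))).
- apply: preimage_closed => [x _|]; last exact: closed_half.
  by apply: continuous_comp; [exact: cv|exact: Re_continuous].
- apply: preimage_closed => [x _|]; last exact: closed_half.
  by apply: continuous_comp; [exact: cv|exact: Im_continuous].
Qed.

Lemma bouquet_map_continuous :
  continuous (fun w : B => bouquet_map (set_val w)).
Proof.
pose f := fun w : B => bouquet_map (set_val w).
have wq b1 b2 v v' h : continuous h -> (forall w, quadrant b1 b2 v v' w -> h w = f w) -> {within quadrant b1 b2 v v', continuous f}.
  move=> ch hf; apply: (@subspace_eq_continuous _ _ _ h).
    by move=> w /set_mem; exact: hf.
  exact: continuous_subspaceT.
have cX n (v : B -> C) : continuous v -> continuous (fun w : B => v w ^+ n : C).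
  move=> cv; elim: n => [|n IHn] w.
    by apply: (@cst_continuous _ _ (1 : C)).
  under eq_fun do rewrite exprS.
  by apply: (@continuousM C B v (fun w => v w ^+ n) w); [exact: cv|exact: IHn].
have cV n (v : B -> C) : (forall w, circle (v w)) -> continuous v -> continuous (fun w : B => v w ^- n : C).
  by move=> cir cv; apply: circleV_continuous => [w|]; [exact: circleX|exact: cX].
have cl (v : B -> C) : continuous v -> continuous (fun w : B => (v w, 1 : C)).
  by move=> cv; exact: (pair_continuous cv (@cst_continuous B C 1)).
have cr (v : B -> C) : continuous v -> continuous (fun w : B => (1 : C, v w)).
  by move=> cv; exact: (pair_continuous (@cst_continuous B C 1) cv).
have E1 w : v2 w = 1 -> f w = bouquet_map (v1 w, 1).
  by move=> <-; rewrite /f -surjective_pairing.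
have E2 w : v1 w = 1 -> f w = bouquet_map (1, v2 w).
  by move=> <-; rewrite /f -surjective_pairing.
have H : {within
   (((quadrant true true v1 v2 `|` quadrant false true v1 v2) `|`
   (quadrant false false v1 v2 `|` quadrant true false v1 v2)) `|`
   ((quadrant true true v2 v1 `|` quadrant false true v2 v1) `|`
   (quadrant false false v2 v1 `|` quadrant true false v2 v1))), continuous f}.
  do ?apply: withinU_continuous; do ?apply: closedU; do ?exact: closed_quadrant.
  - apply: (wq _ _ _ _ (fun w => (v1 w ^+ 4, 1))); first exact/cl/cX.
    by move=> w [/E1 -> [? ?]]; have [->] := bouquet_map_l (v1_circle w).
  - apply: (wq _ _ _ _ (fun w => (1, v1 w ^+ 4))); first exact/cr/cX.
    by move=> w [/E1 -> [? ?]]; have [_ ->] := bouquet_map_l (v1_circle w).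
  - apply: (wq _ _ _ _ (fun w => (v1 w ^- 4, 1))); first exact/cl/cV.
    by move=> w [/E1 -> [? ?]]; have [_ _ ->] := bouquet_map_l (v1_circle w).
  - apply: (wq _ _ _ _ (fun w => (1, v1 w ^- 4))); first exact/cr/cV.
    by move=> w [/E1 -> [? ?]]; have [_ _ _ ->] := bouquet_map_l (v1_circle w).
  - apply: (wq _ _ _ _ (fun w => (v2 w ^- 4, 1))); first exact/cl/cV.
    by move=> w [/E2 -> [? ?]]; have [->] := bouquet_map_r (v2_circle w).
  - apply: (wq _ _ _ _ (fun w => (1, v2 w ^- 4))); first exact/cr/cV.
    by move=> w [/E2 -> [? ?]]; have [_ ->] := bouquet_map_r (v2_circle w).
  - apply: (wq _ _ _ _ (fun w => (v2 w ^+ 4, 1))); first exact/cl/cX.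
    by move=> w [/E2 -> [? ?]]; have [_ _ ->] := bouquet_map_r (v2_circle w).
  - apply: (wq _ _ _ _ (fun w => (1, v2 w ^+ 4))); first exact/cr/cX.
    by move=> w [/E2 -> [? ?]]; have [_ _ _ ->] := bouquet_map_r (v2_circle w).
rewrite -[X in continuous X]/f; apply/continuous_subspace_setT.
move: H; congr {within _, continuous f}; apply/seteqP; split => // w _.
have half_cover x : half true x \/ half false x.
  by case: (leP 0 x) => [|/ltW]; [left|right].
have quad_cover v v' : v' w = 1 ->
  ((quadrant true true v v' `|` quadrant false true v v') `|`
   (quadrant false false v v' `|` quadrant true false v v')) w.
  move=> v'w; rewrite /quadrant.
  have [hr|hr] := half_cover (complex.Re (v w));
    have [hi|hi] := half_cover (complex.Im (v w)).
  - by left; left.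
  - by right; right.
  - by left; right.
  - by right; left.
by have [[_ w1]|[w1 _]] := set_valP w; [left|right]; exact: quad_cover.
Qed.

End bouquet.

Section bouquet_limit.
Variable R : realType.
Local Notation B := (set_type (@bouquet R)).

(* The action of the generator: (z, 1) |-> (1, z^-1), (1, t) |-> (t^-1, 1). *)
Definition bouquet_gen (w : B) : B :=
  SigSub (mem_set (bouquet_swap_bouquet (set_valP w))).

Definition bouquet_fun (w : B) : B :=
  SigSub (mem_set (bouquet_map_bouquet (set_valP w))).

Definition bouquet_act (g : Z2) (w : B) : B := if g then bouquet_gen w else w.

Fact bouquet_act1 w : bouquet_act 1%g w = w. Proof. by []. Qed.

Fact bouquet_actM g h w :
  bouquet_act (g * h)%g w = bouquet_act g (bouquet_act h w).
Proof.
case: g h => -[] //; apply: val_inj.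
exact: esym (bouquet_swapK (set_valP w)).
Qed.

Fact bouquet_act_continuous :
  continuous (fun p : Z2 * B => bouquet_act p.1 p.2).
Proof.
apply: discrete_fun_continuous => [g|[|]]; first exact: (@discrete_set1 bool).
  by apply: continuous_comp_initial; exact: bouquet_swap_continuous.
by move=> w; exact: cvg_id.
Qed.

Definition bouquet_space : gSpace Z2 :=
  GSpace bouquet_act1 bouquet_actM bouquet_act_continuous.

Fact bouquet_fun_continuous : continuous bouquet_fun.
Proof. by apply: continuous_comp_initial; exact: bouquet_map_continuous. Qed.

Fact bouquet_fun_equivariant (g : Z2) (w : bouquet_space) :
  bouquet_fun (gact g w) = gact g (bouquet_fun w : bouquet_space).
Proof.
case: g => //; apply: val_inj; exact: bouquet_map_swap (set_valP w).
Qed.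

Definition bouquet_gmap : gMap bouquet_space bouquet_space :=
  @GMap Z2 bouquet_space bouquet_space bouquet_fun
    bouquet_fun_continuous bouquet_fun_equivariant.

Definition bouquet_base : bouquet_space :=
  SigSub (mem_set (bouquet_l (@circle1 R))).

Fact bouquet_gmap_base : bouquet_gmap bouquet_base = bouquet_base.
Proof.
apply: val_inj => /=; rewrite /bouquet_map eqxx !expr1n invr1.
by do 3 case: ifP => _ //.
Qed.

Definition bouquet_limit : gSpace Z2 :=
  @inverse_limit Z2 (fun=> bouquet_space) (fun=> bouquet_gmap).

Definition bouquet_limit_base : bouquet_limit.
Proof.
exists (fun=> bouquet_base); apply/mem_set => n; exact: bouquet_gmap_base.
Defined.

End bouquet_limit.

(* Main.v *)
Require Import Defs.
From HB Require Import structures.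
From mathcomp Require Import all_boot all_order all_algebra.
From mathcomp Require Import all_classical all_reals all_analysis.
From mathcomp Require Import complex.
From mathcomp Require Import ring lra.

(* A map of a compact inverse limit into an ANR K extends over a neighborhood in the
   telescope of the sequence, so up to homotopy it factors through a projection to some
   term; the extension comes from attaching the compact telescope to K inside a cube over a
   compactification of K and retracting onto K near K.

   On the fundamental group, free on a and b, the bonding map f sends (a, b) to
   (a b a^-1 b^-1, a^-1 b^-1 a b). If the limit P were movable, some map v : B -> B with
   v pi_n homotopic to pi_0 would factor up to homotopy through every iterate f^k. By
   compactness the homotopy on P gives, at some finite level M, a conjugacy between the
   images of a under v f^(M-n) and under f^M. In SL_2(Z), with a and b
   the elementary matrices [1 2; 0 1] and [1 0; 2 1], the image of a under f^M would then be
   congruent to 1 modulo 2^(k+1) for all k, hence equal to 1; but modulo 5 the iterated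
   commutators are periodic and never 1. Fundamental groups are replaced by the holonomy of
   an explicit cocycle along fine chains of points.

   The orbit space of B is a circle, on which f induces a map that runs back and forth along
   arcs and hence is null-homotopic; so every map of the orbit space of P to an ANR is
   null-homotopic. *)

Set Implicit Arguments.
Unset Strict Implicit.
Unset Printing Implicit Defensive.

Import Order.TTheory GRing.Theory Num.Theory.
Import numFieldNormedType.Exports.

Local Open Scope classical_set_scope.
Local Open Scope ring_scope.

(** * Paracompactness, normality, embeddings and extension of functions *)

Section general_topology.

(** The terms of an associated system are only known to be neighborhood retracts for [Z2]-spaces, so
    the factorization through a finite level has to be equivariant, although the final contradiction
    forgets the action. The same theorem serves the orbit space: a homomorphism [phi] from [Z2] onto
    the group of the target is carried along, the identity in one case and the trivial one in the
    other. The target is merely p-paracompact, not metrizable, and its action need not extend to a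
    compactification; most of the extension argument checks that the enlarged space is still
    p-paracompact.

    Homotopies are free, so a loop is seen only up to conjugacy, and the conclusions are memberships
    in normal subgroups. The congruence subgroups of level 2^k shrink to 1, which kills whatever
    factors through all iterates; another prime shows that the iterated commutators survive.
    Commutators also explain the orbit space: the generator of [Z2] sends a to b^-1, so in the
    quotient b becomes a^-1 and every commutator dies. *)

Lemma inj_hausdorff (X Y : topologicalType) (f : X -> Y) :
  continuous f -> injective f -> hausdorff_space Y -> hausdorff_space X.
Proof.
move=> cf fI hY x y xy; apply/fI/hY => A B /cf Ax /cf By.
by have [z [Az Bz]] := xy _ _ Ax By; exists (f z).
Qed.

(** Near-covering compactness is applied to the filter generated by the finite subfamilies of [F]
    ordered by inclusion: eventually such a subfamily contains any given member. *)
Lemma compact_finite_subcover (T : topologicalType) (K : set T)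
    (F : set (set T)) :
  compact K -> F `<=` open -> K `<=` \bigcup_(A in F) A ->
  exists D : set (set T),
    [/\ finite_set D, D `<=` F & K `<=` \bigcup_(A in D) A].
Proof.
move=> /compact_near_coveringP cK Fo KF.
pose B (D : set (set T)) := finite_set D /\ D `<=` F.
pose G := filter_from B (fun D => [set D' : set (set T) | D `<=` D' /\ B D']).
have FG : Filter G.
  apply: filter_from_filter; first by exists set0; split.
  move=> D D' [fD DF] [fD' D'F]; exists (D `|` D').
    by split; [rewrite finite_setU|move=> A [/DF|/D'F]].
  by move=> E [DE BE]; split; split=> //; apply: subset_trans DE => A; [left|right].
have := cK _ G (fun D x => (\bigcup_(A in D) A) x) FG.
case=> [x /KF[A FA Ax]|D BD /(_ D)].
  exists (A, [set D' | [set A] `<=` D' /\ B D']) => /=; last first.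
    by move=> [y D] [/= Ay [AD _]]; exists A => //; exact: AD.
  split; first by apply: open_nbhs_nbhs; split=> //; exact: Fo.
  by exists [set A] => //; split=> // _ ->.
by move=> h; exists D; case: (BD) => fD DF; split=> //; apply: h; split.
Qed.

Lemma paracompact_closure_sep (T : topologicalType) (A B : set T) :
  paracompact T -> closed A ->
  (forall a, A a -> exists V, [/\ open V, V a & closure V `&` B = set0]) ->
  exists U, [/\ open U, A `<=` U & closure U `&` B = set0].
Proof.
move=> [_ pT] cA sep.
pose C := [set ~` A] `|` [set V | open V /\ closure V `&` B = set0].
have /pT[V [[oV cV] VC lfV]] : open_cover C.
  split=> [W [->|[]//]|]; first exact: closed_openC.
  apply/seteqP; split=> // x _; have [/sep[W [oW Wx WB]]|nAx] := pselect (A x).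
    by exists W => //; right.
  by exists (~` A) => //; left.
exists (\bigcup_(W in [set W | V W /\ W `&` A !=set0]) W); split.
- by apply: bigcup_open => W [/oV].
- move=> a Aa; have : (\bigcup_(W in V) W) a by rewrite cV.
  by case=> W VW Wa; exists W => //; split=> //; exists a.
- rewrite -subset0 => x [clx Bx].
  have [N Nx fN] := lfV x.
  pose F := [set W | V W /\ W `&` N !=set0].
  have nW W : V W -> W `&` A !=set0 -> nbhs x (~` W).
    move=> VW [a [Wa Aa]]; have [W' [W'E|[oW' W'B]] WW'] := VC _ VW.
      by move: (WW' _ Wa); rewrite W'E.
    have : nbhs x (~` closure W').
      apply: open_nbhs_nbhs; split; first exact/closed_openC/closed_closure.
      by move=> cx; have : (closure W' `&` B) x by []; rewrite W'B.
    by apply: filterS => y ny Wy; apply: ny; apply: subset_closure; exact: WW'.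
  have : nbhs x (N `&` \bigcap_(W in F `&` [set W | W `&` A !=set0]) ~` W).
    apply: filterI => //.
    have /finite_fsetP[D DE] : finite_set (F `&` [set W | W `&` A !=set0]).
      by apply: sub_finite_set fN => W [].
    rewrite DE; apply: filter_bigI => W WD.
    have : (F `&` [set W | W `&` A !=set0]) W by rewrite DE.
    by move=> [[VW _] WA]; exact: nW.
  by move=> /clx[y [[W [VW WA] Wy] [Ny]]] /(_ W); apply=> //; split=> //; split=> //; exists y.
Qed.

(** The separation lemma is used twice: first for closed sets against points, starting from
    Hausdorffness, then for closed sets against closed sets, starting from the regularity just
    obtained. *)
Lemma paracompact_normal (T : topologicalType) :
  paracompact T -> normal_space T.
Proof.
move=> pT.
have reg (A : set T) x : closed A -> ~ A x ->
    exists U, [/\ open U, A `<=` U & ~ closure U x].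
  move=> cA nAx; have [a Aa|U [oU AU Ux]] := @paracompact_closure_sep T A [set x] pT cA.
    have /hausdorff_accessible _ := pT.1.
    have ax : a != x by apply/eqP => ax; apply: nAx; rewrite -ax.
    have := pT.1; rewrite open_hausdorff => /(_ _ _ ax)[[V W] /= [/set_mem Va /set_mem Wx]].
    move=> [oV oW /eqP/seteqP[VW _]]; exists V; split=> //.
    rewrite -subset0 => y [cVy yx]; rewrite yx in cVy.
    by have [z ?] := cVy _ (open_nbhs_nbhs (conj oW Wx)); exact: (VW z).
  by exists U; split=> // clx; have : (closure U `&` [set x]) x by []; rewrite Ux.
move=> A cA N /set_nbhsP[N' [oN' AN' N'N]].
have [a Aa|U [oU AU UB]] := @paracompact_closure_sep T A (~` N') pT cA.
  have [U [oU NU nUa]] : exists U, [/\ open U, ~` N' `<=` U & ~ closure U a].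
    by apply: reg; [exact: open_closedC|move=> /(_ (AN' _ Aa))].
  exists (~` closure U); split=> //; first exact/closed_openC/closed_closure.
  rewrite -subset0 => y [cly nNy].
  have := cly _ (open_nbhs_nbhs (conj oU (NU _ nNy))).
  by case=> z [nz Uz]; apply: nz; exact: subset_closure.
exists U; first by apply/set_nbhsP; exists U; split.
apply: subset_trans N'N => x clx; apply: contrapT => nN.
by have : (closure U `&` ~` N') x by []; rewrite UB.
Qed.

Lemma compact_paracompact (T : topologicalType) :
  hausdorff_space T -> compact [set: T] -> paracompact T.
Proof.
move=> hT cT; split=> // C [oC cC].
have [|D [fD DC TD]] := compact_finite_subcover cT oC; first by rewrite cC.
exists D; split=> [|A /DC ? |x]; first by split=> [A /DC /oC//|]; exact/seteqP.
- by exists A.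
- by exists setT; [exact: filterT|apply: sub_finite_set fD => A []].
Qed.

Lemma id_embedding (T : topologicalType) : embedding (@id T).
Proof. by split=> // U; split=> [oU|[V oV ->]//]; exists U. Qed.

Lemma compact_p_paracompact (T : topologicalType) :
  hausdorff_space T -> compact [set: T] -> p_paracompact T.
Proof.
move=> hT cT; split; first exact: compact_paracompact.
exists T, id, (fun=> [set setT]); split.
  split=> //; first exact: id_embedding.
  by move=> U U0 _; have [x Ux] := U0; exists x; split => //; exists x.
split=> [n|x _ y _]; last by exists y.
by split=> [_ ->|x _]; [exact: openT|exists setT].
Qed.

Lemma embedding_continuous (X Y : topologicalType) (e : X -> Y) :
  embedding e -> continuous e.
Proof. by move=> [_ eo]; apply/continuousP => V oV; apply/eo; exists V. Qed.

Lemma compact_inj_embedding (X Y : topologicalType) (e : X -> Y) :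
  compact [set: X] -> hausdorff_space Y -> continuous e -> injective e ->
  embedding e /\ closed (range e).
Proof.
move=> cX hY ce eI.
have cl F : closed F -> closed (e @` F).
  move=> cF; apply: compact_closed => //.
  apply: continuous_compact; first exact: continuous_subspaceT.
  exact: subclosed_compact cF cX _.
split; last exact: cl closedT.
split=> // U; split=> [oU|[V oV ->]]; last by apply: open_comp => // x _; exact: ce.
exists (~` (e @` (~` U))); first exact/closed_openC/cl/open_closedC.
apply/seteqP; split=> x /=; first by move=> Ux [y nUy /eI yx]; apply: nUy; rewrite yx.
by move=> h; apply: contrapT => nUx; apply: h; exists x.
Qed.

Lemma tietze_embedding (R : realType) (X Y : topologicalType) (e : X -> Y)
    (phi : X -> R) (M : R) :
  normal_space Y -> embedding e -> closed (range e) -> continuous phi ->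
  (forall x, `|phi x| <= M) ->
  exists F : Y -> R, continuous F /\ forall x, F (e x) = phi x.
Proof.
move=> nY [eI eo] cle cphi phiM.
have [x0|nX] := pselect (inhabited X); last first.
  exists (fun=> 0); split=> [y|x]; first exact: cst_continuous.
  by case: nX.
have [{}x0] := x0.
pose f (y : Y) : R := phi (xget x0 [set x | e x = y]).
have fe x : f (e x) = phi x.
  by rewrite /f; case: xgetP => [z _ /= /eI ->//|/(_ x) /=]; case.
have cf : {within range e, continuous f}.
  apply/subspace_sigL_continuousP/continuousP => W oW.
  have /eo[V oV VE] : open (phi @^-1` W) by apply: open_comp => // x _; exact: cphi.
  exists V => //; apply/seteqP; split=> -[y yP] /=; have := set_mem yP.
    by move=> [x _ ex]; rewrite /sigL /= set_valE /= -ex fe => Vx; rewrite -[_ (phi x)]/((phi @^-1` W) x) VE.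
  by move=> [x _ ex]; rewrite /sigL /= set_valE /= -ex fe; rewrite -[W (phi x)]/((phi @^-1` W) x) VE.
(* The bound is enlarged because the extension theorem asks for a positive one. *)
have [||g [fg cg _]] := @continuous_bounded_extension Y R nY _ cle f (`|M| + 1) _ cf.
- by rewrite ltr_wpDl.
- by move=> _ [x _ <-]; rewrite fe (le_trans (phiM x))// (le_trans (ler_norm M))// lerDl.
by exists g; split=> // x; rewrite -fg ?fe//; apply/mem_set; exists x.
Qed.

End general_topology.

(** * Products, subspaces and sublevels of functions on compact spaces *)

Section products_and_subspaces.

Lemma prod_proj_continuous (I : Type) (T : I -> topologicalType) (i : I) :
  continuous (fun x : prod_topology T => x i).
Proof.
move=> x; have := @cvg_id _ (nbhs (x : prod_topology T)).
move=> /cvg_sup/(_ i) h; apply: (cvg_trans _ (@initial_continuous _ _ (fun x : forall i, T i => x i) x)).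
exact: cvg_app.
Qed.

Lemma prod_continuous (I : Type) (T : I -> topologicalType)
    (Y : topologicalType) (f : Y -> prod_topology T) :
  (forall i, continuous (fun y => f y i)) -> continuous f.
Proof.
move=> cf y; apply/cvg_sup => i; move: y.
apply: (@continuous_comp_initial _ _ _ (fun x : forall i, T i => x i)).
exact: cf.
Qed.

Lemma set_val_continuous (X : topologicalType) (A : set X) :
  continuous (set_val : A -> X).
Proof. exact: initial_continuous. Qed.

Lemma continuous_set_type (X Y : topologicalType) (A : set X) (f : Y -> A) :
  continuous (fun y => set_val (f y)) -> continuous f.
Proof. by move=> cf; exact: continuous_comp_initial. Qed.

Lemma set_val_inj (X : Type) (A : set X) : injective (set_val : A -> X).
Proof. exact: val_inj. Qed.

Lemma set_type_hausdorff (X : topologicalType) (A : set X) :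
  hausdorff_space X -> hausdorff_space (A : Type).
Proof. by apply: inj_hausdorff; [exact: set_val_continuous|exact: set_val_inj]. Qed.

Lemma set_type_compact (X : topologicalType) (A : set X) :
  compact A -> compact [set: A].
Proof.
move=> /compact_near_coveringP cA; apply/compact_near_coveringP => I F P FF h.
have := cA I F (fun i x => forall a : A, set_val a = x -> P i a) FF.
set near := (X in (_ -> X) -> _); move=> hA.
suff : near by apply: filterS => i h' a _; apply: h' (erefl _); exact: set_valP.
apply: hA => x Ax.
pose a : A := SigSub (mem_set Ax).
have [[U V] /= [[W [[W' oW' W'W] Wa WU]] FV] UV] := h a Logic.I.
exists (W', V) => /=.
  split=> //; apply: open_nbhs_nbhs; split=> //.
  by move: Wa; rewrite -W'W.
move=> [y i] /= [W'y Vi] b by_; apply: (UV (b, i)); split=> //=.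
by apply: WU; rewrite -W'W /= by_.
Qed.

Lemma set_type_open (X : topologicalType) (A : set X) (U : set A) :
  open U <-> exists2 V, open V & U = set_val @^-1` V.
Proof.
split=> [[V oV VU]|[V oV ->]]; first by exists V.
by apply: open_comp => // x _; exact: set_val_continuous.
Qed.

Lemma prod_topology_hausdorff (I : Type) (T : I -> topologicalType) :
  (forall i, hausdorff_space (T i)) -> hausdorff_space (prod_topology T).
Proof.
move=> hT x y xy; apply: functional_extensionality_dep => i; apply: hT => A B.
move=> /(@prod_proj_continuous I T i x) Ax /(@prod_proj_continuous I T i y) By.
by have [z [Az Bz]] := xy _ _ Ax By; exists (z i).
Qed.

Lemma pair_hausdorff (X Y : topologicalType) :
  hausdorff_space X -> hausdorff_space Y -> hausdorff_space (X * Y)%type.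
Proof.
move=> hX hY [x y] [x' y'] xy; congr pair.
  apply: hX => A B Ax Bx; have [||z [Az Bz]] := xy (fst @^-1` A) (fst @^-1` B).
  - exact: (@cvg_fst _ _ (nbhs x) (nbhs y)).
  - exact: (@cvg_fst _ _ (nbhs x') (nbhs y')).
  - by exists z.1.
apply: hY => A B Ax Bx; have [||z [Az Bz]] := xy (snd @^-1` A) (snd @^-1` B).
- exact: (@cvg_snd _ _ (nbhs x) (nbhs y)).
- exact: (@cvg_snd _ _ (nbhs x') (nbhs y')).
- by exists z.2.
Qed.

Lemma realType_hausdorff (R : realType) : hausdorff_space R.
Proof. exact: (@norm_hausdorff R R). Qed.

(** By compactness [u] is bounded away from 0 outside [U]; the filter of positive reals tending to 0
    makes this a near-covering statement. *)
Lemma compact_sublevel (R : realType) (X : topologicalType) (u : X -> R)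
    (U : set X) :
  compact [set: X] -> continuous u -> (forall x, 0 <= u x) -> open U ->
  (forall x, u x = 0 -> U x) ->
  exists2 e : R, 0 < e & forall x, u x < e -> U x.
Proof.
move=> /compact_near_coveringP cX cu u0 oU h.
have [x _|e /= e0 he] := cX R (0^'+)%R (fun e x => u x < e -> U x) _.
  have [ux|ux] := eqVneq (u x) 0.
    exists (U, setT) => /=; last by move=> [y e] [].
    by split; [apply: open_nbhs_nbhs; split=> //; exact: h|exact: filterT].
  have ux0 : 0 < u x / 2 by rewrite divr_gt0// lt_neqAle eq_sym ux u0.
  exists ([set y | u x / 2 < u y], [set e | e < u x / 2]) => /=.
    split; last by near=> e; near: e; exact: nbhs_right_lt.
    have : \forall y \near u x, u x / 2 < y.
      by apply: lt_nbhsr; rewrite ltr_pdivrMr// ltr_pMr ?ltr1n// lt_neqAle eq_sym ux u0.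
    by move/cu.
  by move=> [y e] /= [uy eu]; rewrite ltNge (le_trans (ltW eu) (ltW uy)).
have : \forall e \near (0^'+)%R, 0 < e /\ [set: X] `<=` (fun x => u x < e -> U x).
  near=> e'; split; last by near: e'; exists e.
  by near: e'; exact: nbhs_right_gt.
by move=> /filter_ex[e' [e'0 h']]; exists e' => // x; exact: h'.
Unshelve. all: by end_near. Qed.

End products_and_subspaces.

Lemma compact_separating (R : realType) (T : topologicalType) (a b : T) :
  compact [set: T] -> hausdorff_space T -> a <> b ->
  exists j : T -> R,
    [/\ continuous j, forall x, `|j x| <= 1 & j a <> j b].
Proof.
move=> cT hT ab.
have := normal_uniform_separator (compact_normal hT cT)
  (accessible_closed_set1 (hausdorff_accessible hT) (x := a))
  (accessible_closed_set1 (hausdorff_accessible hT) (x := b)).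
case/(_ _)/(@uniform_separatorP _ R) => [|j [cj j01 ja jb]].
  by rewrite -subset0 => x [/= -> /ab].
exists j; split=> // [x|jab].
  have : range j (j x) by exists x.
  by move=> /j01 /=; rewrite in_itv /= => /andP[j0 j1]; rewrite ger0_norm.
have : (j @` [set a]) (j a) by exists a.
have : (j @` [set b]) (j b) by exists b.
by rewrite -jab => /jb -> /ja /esym/eqP; rewrite eq_sym oner_eq0.
Qed.

(** * Equivariant embedding into a linear space over a compactification *)

Section cube.
Context {R : realType} {G : compactGroupType} {K : gSpace G}.
Context {L : topologicalType} {e : K -> L}.
Hypotheses (cL : compact [set: L]) (hL : hausdorff_space L) (ee : embedding e).

(** The action of [G] on [K] need not extend to the compactification [L]. A point of [K] is
    therefore replaced by its whole orbit in L^G, and L^G by its coordinates under all [j] in [J].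
    On the resulting linear space [G] acts by translating the index, and maps into it can be
    extended coordinate by coordinate and averaged. *)
Let J := {j : L -> R | continuous j /\ forall x, `|j x| <= 1}.
Let E := prod_topology (fun _ : J * G => R : topologicalType).
Let LG := prod_topology (fun _ : G => L).

Definition cube : topologicalType := E.

Definition cube_act (g : G) (v : cube) : cube := fun p => v (p.1, (p.2 * g)%g).

Lemma cube_act1 v : cube_act 1%g v = v.
Proof. by apply/funext => -[j h]; rewrite /cube_act mulg1. Qed.

Lemma cube_actM g h v : cube_act (g * h)%g v = cube_act g (cube_act h v).
Proof. by apply/funext => -[j k]; rewrite /cube_act /= mulgA. Qed.

Lemma cube_act_continuous g : continuous (cube_act g).
Proof. by apply: prod_continuous => -[j h]; exact: prod_proj_continuous. Qed.

Lemma cube_hausdorff : hausdorff_space cube.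
Proof. by apply: prod_topology_hausdorff => _; exact: realType_hausdorff. Qed.

Definition cube_of (k : LG) : cube := fun p => sval p.1 (k p.2).

Definition gorbit (k : K) : LG := fun g => e (gact g k).

Definition cube_emb (k : K) : cube := cube_of (gorbit k).

Lemma gorbit_continuous : continuous gorbit.
Proof.
apply: prod_continuous => g k; apply: (@continuous_comp _ _ _ (gact g) e).
  apply: (@continuous_comp _ _ _ (fun k => (g, k)) (fun p => gact p.1 p.2)).
    by apply: cvg_pair; [exact: cvg_cst|exact: cvg_id].
  exact: gact_continuous.
exact: embedding_continuous.
Qed.

Lemma cube_of_continuous : continuous cube_of.
Proof.
apply: prod_continuous => -[[j [cj j1]] g] k.
by apply: (@continuous_comp _ _ _ (fun k : LG => k g) j); [exact: prod_proj_continuous|exact: cj].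
Qed.

Lemma cube_of_inj : injective cube_of.
Proof.
move=> k k' kk'; apply/funext => g; apply: contrapT.
move=> /(@compact_separating R _ _ _ cL hL)[j [cj j1]]; apply.
by have := congr1 (fun v : cube => v (exist _ j (conj cj j1), g)) kk'.
Qed.

Lemma LG_compact : compact [set: LG].
Proof.
rewrite (_ : setT = [set f | forall g : G, [set: L] (f g)]); last exact/seteqP.
by apply: (@tychonoff G (fun=> L) (fun=> setT)) => g; exact: cL.
Qed.

Lemma cube_of_closed (F : set LG) : closed F -> closed (cube_of @` F).
Proof.
move=> cF; apply: compact_closed; first exact: cube_hausdorff.
apply: continuous_compact; first exact/continuous_subspaceT/cube_of_continuous.
exact: subclosed_compact cF LG_compact _.
Qed.

Lemma cube_emb_continuous : continuous cube_emb.
Proof.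
move=> k; apply: (@continuous_comp _ _ _ gorbit cube_of).
  exact: gorbit_continuous.
exact: cube_of_continuous.
Qed.

Lemma cube_emb_equivariant g k : cube_emb (gact g k) = cube_act g (cube_emb k).
Proof.
by apply/funext => -[j h]; rewrite /cube_emb /cube_of /cube_act /gorbit /= gactM.
Qed.

(** Since [cube_of] is injective and closed, for open [V] this is an open set with trace [V] on the
    compact image of L^G; it transports neighborhoods from L^G to the cube. *)
Definition cube_open (V : set LG) : set cube := ~` (cube_of @` (~` V)).

Lemma open_cube_open V : open V -> open (cube_open V).
Proof. by move=> oV; exact/closed_openC/cube_of_closed/open_closedC. Qed.

Lemma cube_openE V k : cube_open V (cube_of k) <-> V k.
Proof.
split=> [h|Vk [k' nVk' /cube_of_inj kk']]; last by apply: nVk'; rewrite kk'.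
by apply: contrapT => nVk; apply: h; exists k.
Qed.

Lemma open_coord (g : G) (V : set L) : open V -> open [set k : LG | V (k g)].
Proof.
by move=> oV; apply: open_comp => // k _; exact: (@prod_proj_continuous G (fun=> L) g).
Qed.

(** The coordinates at the unit of [G] recover [e], which already embeds [K]. *)
Lemma cube_emb_embedding : embedding cube_emb.
Proof.
split=> [k k' /cube_of_inj/(congr1 (fun f : LG => f 1%g))|U].
  by rewrite /gorbit !gact1 => /ee.1.
split=> [oU|[V oV ->]].
  have /ee.2 [V oV UV] := oU.
  exists (cube_open [set k | V (k 1%g)]); first exact/open_cube_open/open_coord.
  by apply/seteqP; split=> k /=; rewrite /cube_emb cube_openE /gorbit /= gact1 UV.
by apply: open_comp => // k _; exact: cube_emb_continuous.
Qed.

(* The graph of the action is closed in the part of the compactification lying over [K]. *)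
Lemma cube_emb_closure (k : LG) (k1 : K) :
  closure (range cube_emb) (cube_of k) -> k 1%g = e k1 ->
  cube_of k = cube_emb k1.
Proof.
move=> clk kk1; congr cube_of; apply/funext => g; apply: contrapT => /eqP kg.
have := hL; rewrite open_hausdorff => /(_ _ _ kg)[[U V] /= [/set_mem Uk /set_mem Vk]].
move=> [oU oV /eqP/seteqP[UV _]].
have /ee.2[W oW WV] : open [set k : K | V (gorbit k g)].
  rewrite (_ : [set _ | _] = gorbit @^-1` [set k | V (k g)])//.
  by apply: open_comp => [x _|]; [exact: gorbit_continuous|exact: open_coord].
pose N := cube_open ([set k | W (k 1%g)] `&` [set k | U (k g)]).
have oN : open N by apply/open_cube_open/openI; exact: open_coord.
have Nk : N (cube_of k).
  apply/cube_openE; split=> //=; rewrite kk1.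
  by rewrite -[W (e k1)]/((e @^-1` W) k1) -WV.
have [_ [[k' _ <-] Nk']] := clk _ (open_nbhs_nbhs (conj oN Nk)).
have [/= Wk' Uk'] := (cube_openE _ _).1 Nk'.
have : [set k : K | V (gorbit k g)] k' by rewrite WV /= -[e k'](congr1 e (gact1 k')).
by move=> /= Vk'; exact: (UV (gorbit k' g)).
Qed.

End cube.
Arguments gorbit {G K L} e k i.

Lemma gact_cont (H : compactGroupType) (Y : gSpace H) (g : H) :
  continuous (gact g : Y -> Y).
Proof.
move=> y; apply: (@continuous_comp _ _ _ (fun k => (g, k)) (fun p => gact p.1 p.2)).
  by apply: cvg_pair; [exact: cvg_cst|exact: cvg_id].
exact: gact_continuous.
Qed.

(** * Extension of equivariant maps into absolute neighborhood retracts *)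

Section neighborhood_extension.
Context {R : realType} {G : compactGroupType} (phi : Z2 -> G).
Hypothesis dG : forall g : G, nbhs g [set g].
Hypothesis phiM : forall a b, phi (a * b)%g = (phi a * phi b)%g.
Hypothesis phi_surj : forall g, exists a, phi a = g.
Variables (K : gSpace G) (C X : gSpace Z2) (i : gMap X C) (u : C -> R)
  (h : X -> K).
Hypotheses (cC : compact [set: C]) (hC : hausdorff_space C)
  (cX : compact [set: X]) (iI : injective i)
  (cu : continuous u) (u_ge0 : forall c, 0 <= u c)
  (u_inv : forall g c, u (gact g c) = u c)
  (u_eq0 : forall c, u c = 0 <-> exists x, i x = c)
  (ch : continuous h) (h_eq : forall a x, h (gact a x) = gact (phi a) (h x)).
Hypothesis aK : is_gANR K.

Section compactification.
Variables (L : topologicalType) (e : K -> L) (F : nat -> set (set L)).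
Hypotheses (cL : compact [set: L]) (hL : hausdorff_space L) (ee : embedding e)
  (feF : feathering (range e) F).

Local Notation E := (@cube R G L).
Local Notation emb := (@cube_emb R G K L e).

Let t : Z2 := true.

Let phi_tt : (phi t * phi t)%g = 1%g.
Proof.
have p1 : phi 1%g = 1%g.
  have := phiM 1%g 1%g; rewrite mulg1 => /(congr1 (fun x => (phi 1 )^-1 * x)%g).
  by rewrite mulVg mulKg => <-.
by rewrite -phiM -[RHS]p1.
Qed.

(** Tietze's theorem extends each coordinate of [emb (h x)]. Averaging over the two elements of [Z2]
    restores equivariance, and leaves the values on [X] unchanged because [h] is already
    equivariant. *)
Lemma equivariant_cube_extension : exists H : C -> E,
  [/\ continuous H, forall a c, H (gact a c) = cube_act (phi a) (H c)
    & forall x, H (i x) = emb (h x)].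
Proof.
have [ei cli] := compact_inj_embedding cX hC (@gfun_continuous _ _ _ i) iI.
have ext (p : {j : L -> R | continuous j /\ forall x, `|j x| <= 1} * G) :
    exists f : C -> R, continuous f /\ forall x, f (i x) = emb (h x) p.
  apply: (@tietze_embedding R X C i (fun x => emb (h x) p) 1) => //.
  - exact: compact_normal.
  - move=> x; apply: (@continuous_comp _ _ _ h (fun k => emb k p)); first exact: ch.
    apply: (@continuous_comp _ _ _ emb (fun v => v p)).
      exact: cube_emb_continuous.
    exact: prod_proj_continuous.
  - by case: p => -[j [cj j1]] g x; exact: j1.
have [f fP] := choice ext.
pose H (c : C) : E := fun p => (f p c + f (p.1, p.2 * phi t)%g (gact t c)) / 2.
exists H; split.
- apply: prod_continuous => p c.
  apply: cvgM; last exact: cvg_cst.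
  apply: cvgD; first exact: (fP p).1.
  apply: (@continuous_comp _ _ _ (gact t) (f _)); first exact: gact_cont.
  exact: (fP _).1.
- case=> c; apply/funext => -[j g]; last first.
    have -> : phi false = 1%g by rewrite -phi_tt -phiM.
    by rewrite (gact1 c) cube_act1.
  rewrite /cube_act /H /= -gactM -mulgA phi_tt mulg1 addrC.
  by rewrite -[(t * true)%g]/(1%g : Z2) gact1.
- move=> x; apply/funext => -[j g]; rewrite /H -gfun_equivariant !(fP _).2 h_eq.
  rewrite cube_emb_equivariant /cube_act /= -mulgA phi_tt mulg1.
  by rewrite mulrDl -splitr.
Qed.

Variable H : C -> E.
Hypotheses (cH : continuous H)
  (H_eq : forall a c, H (gact a c) = cube_act (phi a) (H c))
  (Hi : forall x, H (i x) = emb (h x)).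

(* [K] with the compact space [C] attached along the map [h]. *)
Definition attach_set : set (E * R)%type :=
  [set (emb k, 0) | k in [set: K]] `|` [set (H c, u c) | c in [set: C]].

Lemma attach_K k : attach_set (emb k, 0). Proof. by left; exists k. Qed.
Lemma attach_C c : attach_set (H c, u c). Proof. by right; exists c. Qed.

Definition in_K (k : K) : attach_set := SigSub (mem_set (attach_K k)).
Definition in_C (c : C) : attach_set := SigSub (mem_set (attach_C c)).

Lemma attachP (z : attach_set) : (exists k, z = in_K k) \/ (exists c, z = in_C c).
Proof.
by case: (set_valP z) => -[y _ yz]; [left|right]; exists y; exact: val_inj.
Qed.

Lemma attach_act_proof g (z : attach_set) :
  attach_set (cube_act g (set_val z).1, (set_val z).2).
Proof.
case: (attachP z) => -[y ->] /=.
  by rewrite -cube_emb_equivariant; exact: attach_K.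
have [a <-] := phi_surj g; rewrite -H_eq -(u_inv a); exact: attach_C.
Qed.

Definition attach_act g (z : attach_set) : attach_set :=
  SigSub (mem_set (attach_act_proof g z)).

Lemma attach_act1 z : attach_act 1%g z = z.
Proof. by apply: val_inj => /=; rewrite cube_act1 -surjective_pairing. Qed.

Lemma attach_actM g g' z : attach_act (g * g')%g z = attach_act g (attach_act g' z).
Proof. by apply: val_inj; rewrite /= cube_actM. Qed.

Lemma set_val1_continuous : continuous (fun z : attach_set => (set_val z).1).
Proof.
move=> z; apply: (@continuous_comp _ _ _ set_val fst); last exact: cvg_fst.
exact: set_val_continuous.
Qed.

Lemma set_val2_continuous : continuous (fun z : attach_set => (set_val z).2).
Proof.
move=> z; apply: (@continuous_comp _ _ _ set_val snd); last exact: cvg_snd.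
exact: set_val_continuous.
Qed.

Lemma attach_act_continuous :
  continuous (fun p : G * attach_set => attach_act p.1 p.2).
Proof.
apply: discrete_fun_continuous => [//|g]; apply: continuous_set_type.
apply: pair_continuous => /=; last exact: set_val2_continuous.
move=> z; apply: (@continuous_comp _ _ _ (fun z : attach_set => (set_val z).1) (cube_act g)).
  exact: set_val1_continuous.
exact: cube_act_continuous.
Qed.

Definition attach_space : gSpace G :=
  GSpace attach_act1 attach_actM attach_act_continuous.

Lemma in_K_continuous : continuous (in_K : K -> attach_space).
Proof.
apply: continuous_set_type; apply: pair_continuous => /=; last exact: cst_continuous.
exact: cube_emb_continuous.
Qed.

Lemma in_C_continuous : continuous (in_C : C -> attach_space).
Proof. by apply: continuous_set_type; exact: pair_continuous. Qed.

Lemma in_K_equivariant g k :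
  in_K (gact g k) = gact g (in_K k : attach_space).
Proof. by apply: val_inj; rewrite /= cube_emb_equivariant. Qed.

Definition in_K_gmap : gMap K attach_space :=
  GMap in_K_continuous in_K_equivariant.

Lemma in_Ci x : in_C (i x) = in_K (h x).
Proof. by apply: val_inj; rewrite /= Hi; congr pair; apply/u_eq0; exists x. Qed.

Lemma in_K_embedding : embedding in_K_gmap.
Proof.
have [embI embo] := @cube_emb_embedding R G K L e cL hL ee.
split=> [k k' /(congr1 (fun z : attach_set => (set_val z).1))/embI//|U].
split=> [oU|[V oV ->]]; last by apply: open_comp => // k _; exact: in_K_continuous.
have /embo[V oV ->] := oU.
exists [set z : attach_space | V (set_val z).1] => //.
by apply: open_comp => // z _; exact: set_val1_continuous.
Qed.

Lemma range_in_K : range in_K_gmap = [set z : attach_space | (set_val z).2 = 0].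
Proof.
apply/seteqP; split=> [_ [k _ <-]//|z]; case: (attachP z) => -[y ->] //=.
  by move=> _; exists y.
by move=> /u_eq0[x <-]; exists (h x); rewrite // in_Ci.
Qed.

Lemma closed_range_in_K : closed (range in_K_gmap).
Proof.
rewrite range_in_K; apply: (@preimage_closed _ _ (fun z : attach_space => (set_val z).2) [set 0]).
  by move=> z _; exact: set_val2_continuous.
exact: (accessible_closed_set1 (hausdorff_accessible (@realType_hausdorff R))).
Qed.

Lemma attach_hausdorff : hausdorff_space attach_space.
Proof.
apply: set_type_hausdorff; apply: pair_hausdorff; last exact: realType_hausdorff.
exact: cube_hausdorff.
Qed.

Lemma range_in_C_compact : compact (range (in_C : C -> attach_space)).
Proof.
by apply: continuous_compact => //; exact/continuous_subspaceT/in_C_continuous.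
Qed.

(** The image of [C] is compact, so finitely many members of the cover handle it. Its complement is
    an open part of [K], where a locally finite refinement taken in [K] is used after removing that
    image. *)
Lemma attach_paracompact : paracompact attach_space.
Proof.
split=> [|O [oO cO]]; first exact: attach_hausdorff.
pose Ch := range (in_C : C -> attach_space).
have clCh : closed Ch by apply: compact_closed range_in_C_compact; exact: attach_hausdorff.
have [|D [fD DO CD]] := compact_finite_subcover range_in_C_compact oO.
  by move=> z _; rewrite cO.
have [_ pK] := aK.1.1.
pose OK := [set in_K_gmap @^-1` W | W in O].
have [|V [[oV cV] VO lfV]] := pK OK.
  split=> [_ [W /oO oW <-]|].
    by apply: open_comp => // k _; exact: in_K_continuous.
  apply/seteqP; split=> // k _.
  have [W OW Wk] : (\bigcup_(A in O) A) (in_K_gmap k) by rewrite cO.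
  by exists (in_K_gmap @^-1` W) => //; exists W.
pose lift (A : set K) : set attach_space := (in_K_gmap @` A) `\` Ch.
have nCh (z : attach_space) : ~ Ch z -> exists k, z = in_K k.
  by case: (attachP z) => // -[c ->] []; exists c.
exists (D `|` (lift @` V)); split.
- split=> [A [/DO/oO//|[B /oV oB <-]]|].
    have /(in_K_embedding.2 B)[W oW BW] := oB.
    rewrite (_ : lift B = W `\` Ch); first exact/openI/closed_openC.
    apply/seteqP; split=> z [zW nz]; split=> //.
      by case: zW => k; rewrite BW => Wk <-.
    by have [k zk] := nCh _ nz; move: zW; rewrite zk => Wk; exists k => //; rewrite BW.
  apply/seteqP; split=> // z _.
  have [Cz|/[dup]/nCh[k zk] nz] := pselect (Ch z).
    by have [A DA Az] := CD _ Cz; exists A => //; left.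
  have [A VA Ak] : (\bigcup_(A in V) A) k by rewrite cV.
  by exists (lift A); [right; exists A|split=> //; exists k].
- move=> A [/DO OA|[B VB <-]]; first by exists A.
  have [_ [W OW <-] BW] := VO _ VB; exists W => // z [[k /BW Wk <-] _]; exact: Wk.
- move=> z; have [[k _ kz]|nz] := pselect (range in_K_gmap z).
    have [N Nk fN] := lfV k.
    move: Nk; rewrite nbhsE => -[N' [oN' N'k N'N]].
    have /(in_K_embedding.2 N')[W oW N'W] := oN'.
    exists W.
      by apply: open_nbhs_nbhs; split=> //; rewrite -kz; move: N'k; rewrite N'W.
    apply: (@sub_finite_set _ _ (D `|` (lift @` [set A | V A /\ A `&` N !=set0]))).
      move=> A [[DA|[B VB <-]] AW]; [by left|right; exists B => //; split=> //].
      case: AW => _ [[[k' Bk' <-] _] Wk']; exists k'; split=> //; apply: N'N.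
      by rewrite N'W.
    by rewrite finite_setU; split=> //; exact: finite_image.
  exists (~` range in_K_gmap).
    by apply: open_nbhs_nbhs; split=> //; exact/closed_openC/closed_range_in_K.
  apply: (sub_finite_set _ fD) => A [[//|[B VB <-]]].
  by case=> _ [[[k Bk <-] _]] []; exists k.
Qed.

Let cl_attach : set (E * R)%type := closure attach_set.

Let attach_closureP w : cl_attach w ->
  (exists c, w = (H c, u c)) \/
  exists2 k : prod_topology (fun _ : G => L),
    w = (cube_of k, 0) & closure (range emb) (cube_of k).
Proof.
rewrite /cl_attach /attach_set closureU => -[|clw].
  move=> clw; right.
  pose S : set (E * R)%type := [set (cube_of k, 0) | k in [set: prod_topology (fun _ : G => L)]].
  have clS : closed S.
    apply: compact_closed.
      by apply: pair_hausdorff; [exact: cube_hausdorff|exact: realType_hausdorff].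
    apply: continuous_compact; last exact: LG_compact.
    apply: continuous_subspaceT; apply: pair_continuous; last exact: cst_continuous.
    exact: cube_of_continuous.
  have [k _ kw] : S w.
    apply: clS; apply: closure_subset clw => _ [k _ <-].
    by exists (gorbit e k).
  exists k => //; rewrite (_ : cube_of k = w.1); last by rewrite -kw.
  move=> N Nw; have [] := clw (fst @^-1` N).
    by exists (N, setT) => [|x []//]; split=> //; exact: filterT.
  by move=> _ [[k' _ <-] /= Nk']; exists (emb k'); split => //; exists k'.
left; have [|c _ <-] := _ : [set (H c, u c) | c in [set: C]] w; last by exists c.
have clS : closed [set (H c, u c) | c in [set: C]].
  apply: compact_closed.
    by apply: pair_hausdorff; [exact: cube_hausdorff|exact: realType_hausdorff].
  apply: continuous_compact => //.
  by apply: continuous_subspaceT; exact: pair_continuous.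
exact: clS.
Qed.

Let Khat := set_type cl_attach.

Let attach_compactify (z : attach_space) : Khat :=
  SigSub (mem_set (subset_closure (set_valP z))).

Let range_attach_compactify (w : Khat) :
  range attach_compactify w <-> attach_set (set_val w).
Proof.
split=> [[z _ <-]|aw]; first exact: (set_valP z).
by exists (SigSub (mem_set aw)) => //; exact: val_inj.
Qed.

(** The compactification is the closure of the attached space in [E * R]. Only points of [C] have
    positive height, so [pos] is harmless; the sets [O n A] copy the feathering of [K] at heights
    below 1/(n+1). In the intersection of the stars of a point of [K], a point of height 0 has its
    coordinate at the unit in the range of [e], by [feF], and [cube_emb_closure] then puts it in
    [K]. *)
Lemma attach_p_space : p_space attach_space.
Proof.
pose O n (A : set L) : set Khat := [set w |
  ~ [set (cube_of k, 0) | k in [set k | ~ A (k 1%g)]] (set_val w) /\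
  (set_val w).2 < n.+1%:R^-1].
pose pos : set Khat := [set w | 0 < (set_val w).2].
have cval2 : continuous (fun w : Khat => (set_val w).2).
  move=> w; apply: (@continuous_comp _ _ _ set_val snd); last exact: cvg_snd.
  exact: set_val_continuous.
exists Khat, attach_compactify, (fun n => pos |` (O n @` F n)); split.
  split.
  - apply: set_type_compact.
    pose S := [set (@cube_of R G L k, 0 : R) | k in [set: prod_topology (fun _ : G => L)]] `|` [set (H c, u c) | c in [set: C]].
    apply: (@subclosed_compact _ _ S); first exact: closed_closure.
      apply: compactU.
        apply: continuous_compact; last exact: LG_compact.
        apply: continuous_subspaceT; apply: pair_continuous; last exact: cst_continuous.
        exact: cube_of_continuous.
      apply: continuous_compact => //.
      by apply: continuous_subspaceT; exact: pair_continuous.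
    by move=> w /attach_closureP[[c ->]|[k -> _]]; [right; exists c|left; exists k].
  - apply: set_type_hausdorff; apply: pair_hausdorff; last exact: realType_hausdorff.
    exact: cube_hausdorff.
  - split=> [z z' zz'|U]; first by apply: val_inj; exact: (congr1 set_val zz').
    split=> [/set_type_open[V oV ->]|[V oV ->]].
      by exists (set_val @^-1` V) => //; apply/set_type_open; exists V.
    have /set_type_open[W oW ->] := oV.
    by apply/set_type_open; exists W.
  - move=> U [w Uw] /set_type_open[V oV UV].
    move: Uw; rewrite UV => Vw.
    have [w' [aw' Vw']] := set_valP w _ (open_nbhs_nbhs (conj oV Vw)).
    by exists (attach_compactify (SigSub (mem_set aw'))); split=> //; exists (SigSub (mem_set aw')).
split=> [n|_ [z _ <-] w]; first split.
- move=> _ [->|[A FA <-]].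
    by apply: (@open_comp _ _ _ [set x : R | 0 < x]); [move=> w _; exact: cval2|exact: open_gt].
  apply: openI.
    apply: (@open_comp _ _ set_val (~` _)); first by move=> w _; exact: set_val_continuous.
    apply: closed_openC; apply: compact_closed.
      by apply: pair_hausdorff; [exact: cube_hausdorff|exact: realType_hausdorff].
    apply: (@continuous_compact _ _ (fun k : prod_topology (fun _ : G => L) =>
        (@cube_of R G L k, 0 : R))).
      apply: continuous_subspaceT; apply: pair_continuous; last exact: cst_continuous.
      exact: cube_of_continuous.
    apply: (@subclosed_compact _ _ setT) => //; last exact: LG_compact.
    apply: open_closedC; apply: open_coord; exact: (feF.1 n).1.
  by apply: (@open_comp _ _ _ [set x : R | x < n.+1%:R^-1]); [move=> w _; exact: cval2|exact: open_lt].
- move=> _ [z _ <-].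
  have [zK|zK] := pselect (range in_K_gmap z); last first.
    exists pos; first by left.
    rewrite /pos /= lt_neqAle; apply/andP; split.
      by apply/eqP => z0; apply: zK; rewrite range_in_K /=.
    by case: (attachP z) => -[y ->] /=.
  have [k _ kz] := zK.
  have [A FA Ak] := (feF.1 n).2 (e k) (ex_intro2 _ _ k Logic.I erefl).
  exists (O n A); first by right; exists A.
  rewrite /O /= -kz /= invr_gt0 ltr0n; split=> // -[k' nAk' [/(cube_of_inj cL hL) k'k]].
  by apply: nAk'; rewrite k'k /gorbit gact1.
- move=> stw; apply/range_attach_compactify.
  have clw : cl_attach (set_val w) := set_valP w.
  have [[c wc]|[k wk clk]] := attach_closureP clw; first by rewrite wc; exact: attach_C.
  have w0 : (set_val w).2 = 0 by rewrite wk.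
  have z0 : (set_val z).2 = 0.
    apply/eqP; apply: contrapT => /negP z0.
    have zp : 0 < (set_val z).2.
      by rewrite lt_neqAle eq_sym z0 /=; case: (attachP z) => -[y ->] /=.
    (* For this [n] the height of [z] is at least 1/(n+1), so no [O n A] contains [z]. *)
    pose n := Num.truncn (set_val z).2^-1.
    have [_ [[->|[A _ <-]] Oz] Ow] := stw n Logic.I.
      by move: Ow; rewrite /pos /= w0 ltxx.
    move: Oz => [_] /=; apply/negP; rewrite -leNgt.
    rewrite -[leRHS]invrK lef_pV2 ?posrE ?invr_gt0 ?ltr0n//.
    exact/ltW/truncnS_gt.
  have : [set z : attach_space | (set_val z).2 = 0] z by [].
  rewrite -range_in_K => -[k0 _ k0z].
  have [k1 _ k1k] : range e (k 1%g).
    apply: (feF.2 (e k0)); first by exists k0.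
    move=> n _.
    have [_ [[->|[A FA <-]] Oz] Ow] := stw n Logic.I.
      by move: Ow; rewrite /pos /= w0 ltxx.
    exists A.
      split=> //; apply: contrapT => nA; apply: Oz.1; exists (gorbit e k0).
        by rewrite /= /gorbit gact1.
      by rewrite -k0z.
    by apply: contrapT => nA; apply: Ow.1; exists k.
  by rewrite wk (cube_emb_closure cL hL ee clk (esym k1k)); exact: attach_K.
Qed.

Lemma attach_extension : exists (eps : R) (r : [set c | u c < eps] -> K),
  [/\ 0 < eps, continuous r,
      forall a (v w : [set c | u c < eps]),
        set_val w = gact a (set_val v) -> r w = gact (phi a) (r v)
    & forall x (v : [set c | u c < eps]), set_val v = i x -> r v = h x].
Proof.
have [_ /(_ attach_space in_K_gmap)] := aK.
case=> [||| U [r [KU invU cr r_eq rK]]].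
- by split; [exact: attach_paracompact|exact: attach_p_space].
- exact: in_K_embedding.
- exact: closed_range_in_K.
have [|c /u_eq0[x <-]|eps eps0 epsU] := @compact_sublevel R C u ((in_C : C -> attach_space) @^-1` U°) cC cu u_ge0.
- apply: open_comp; last exact: open_interior.
  by move=> c _; exact: in_C_continuous.
- by rewrite /= in_Ci; apply: KU; exists (h x).
have Uc (v : [set c | u c < eps]) : U (in_C (set_val v)).
  by apply: interior_subset; apply: epsU; exact: (set_valP v).
pose lft (v : [set c | u c < eps]) : U := SigSub (mem_set (Uc v)).
exists eps, (fun v => r (lft v)); split=> //.
- move=> v; apply: (@continuous_comp _ _ _ lft r); last exact: cr.
  move: v; apply: continuous_set_type => v /=.
  apply: (@continuous_comp _ _ _ set_val (in_C : C -> attach_space)); first exact: set_val_continuous.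
  exact: in_C_continuous.
- move=> a v w wv; apply: r_eq; apply: val_inj.
  by rewrite /= wv H_eq u_inv.
- by move=> x v vx; apply: rK; rewrite -[RHS]/(in_K (h x)) -in_Ci -vx.
Qed.

End compactification.

(** [u] plays the role of a distance to [X]: [C] is glued to [K] along [h] with [u] as height, an
    invariant neighborhood of [K] retracts onto [K], and compactness of [C] fits a whole sublevel of
    [u] into it. *)
Theorem neighborhood_extension : exists (eps : R) (r : [set c | u c < eps] -> K),
  [/\ 0 < eps, continuous r,
      forall a (v w : [set c | u c < eps]),
        set_val w = gact a (set_val v) -> r w = gact (phi a) (r v)
    & forall x (v : [set c | u c < eps]), set_val v = i x -> r v = h x].
Proof.
have [[_ [L [e [F [[cL hL ee _] feF]]]]] _] := aK.
have [H [cH H_eq Hi]] := equivariant_cube_extension ee.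
exact: (attach_extension cL hL ee feF cH H_eq Hi).
Qed.

End neighborhood_extension.

Section continuity_of_compositions.
Context {X Y Z W : topologicalType}.

Lemma comp_cont (f : X -> Y) (g : Y -> Z) :
  continuous f -> continuous g -> continuous (fun x => g (f x)).
Proof. by move=> cf cg x; apply: continuous_comp; [exact: cf|exact: cg]. Qed.

Lemma fst_cont : continuous (fun p : X * Y => p.1).
Proof. by move=> p; exact: cvg_fst. Qed.

Lemma snd_cont : continuous (fun p : X * Y => p.2).
Proof. by move=> p; exact: cvg_snd. Qed.

Lemma comp2_cont (H : X * Y -> W) (f : Z -> X) (g : Z -> Y) :
  continuous H -> continuous f -> continuous g ->
  continuous (fun z => H (f z, g z)).
Proof.
move=> cH cf cg z.
apply: (@continuous_comp _ _ _ (fun z => (f z, g z)) H); last exact: cH.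
exact: pair_continuous.
Qed.

End continuity_of_compositions.

(** * Homotopies *)

Section unit_interval_paths.
Context {R : realType}.
Local Notation I := (unit_interval R).

Definition clip (x : R) : R := Num.max 0 (Num.min x 1).

Arguments clip : simpl never.

Lemma clip_itv x : unit_interval R (clip x).
Proof.
by rewrite /unit_interval /= in_itv /= /clip le_max lexx ge_max ler01 ge_min lexx orbT.
Qed.

(** Clipping lets reparametrizations be written as real formulas, even where they leave the
    interval, with no membership proof. *)
Definition to_I (x : R) : I := SigSub (mem_set (clip_itv x)).

Lemma I_ge0 (t : I) : 0 <= set_val t.
Proof. by have := set_valP t; rewrite /unit_interval /= in_itv /= => /andP[]. Qed.

Lemma I_le1 (t : I) : set_val t <= 1.
Proof. by have := set_valP t; rewrite /unit_interval /= in_itv /= => /andP[]. Qed.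

Lemma clip_id x : 0 <= x -> x <= 1 -> clip x = x.
Proof. by move=> x0 x1; rewrite /clip min_l// max_r. Qed.

Lemma clip_le0 x : x <= 0 -> clip x = 0.
Proof. by move=> x0; rewrite /clip max_l// ge_min x0. Qed.

Lemma clip_ge1 x : 1 <= x -> clip x = 1.
Proof. by move=> x1; rewrite /clip min_r// max_r. Qed.

Lemma to_I_continuous : continuous to_I.
Proof.
apply: continuous_set_type; rewrite -[X in continuous X]/clip => x.
apply: (@continuous_max R R (fun=> 0) (fun x => Num.min x 1)); first exact: cvg_cst.
by apply: (@continuous_min R R id (fun=> 1)); [exact: cvg_id|exact: cvg_cst].
Qed.

Lemma I_cont (X : topologicalType) (k : R -> R) :
  continuous k -> continuous (fun p : X * I => k (set_val p.2)).
Proof.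
move=> ck; apply: (@comp_cont _ R _ (fun p : X * I => set_val p.2)); last exact: ck.
by apply: (@comp_cont _ I _ snd); [exact: snd_cont|exact: set_val_continuous].
Qed.

Lemma reparam_cont (X Y : topologicalType) (H : X * I -> Y) (k : R -> R) :
  continuous H -> continuous k ->
  continuous (fun p : X * I => H (p.1, to_I (k (set_val p.2)))).
Proof.
move=> cH ck.
apply: (@comp2_cont X I (X * I)%type Y H fst (fun p => to_I (k (set_val p.2)))) => //.
  exact: fst_cont.
by apply: (@comp_cont _ R _ (fun p : X * I => k (set_val p.2))); [exact: I_cont|exact: to_I_continuous].
Qed.

Lemma set_val_to_I x : set_val (to_I x) = clip x. Proof. by []. Qed.

Lemma to_IK (t : I) : to_I (set_val t) = t.
Proof. by apply: val_inj => /=; rewrite clip_id ?I_ge0 ?I_le1. Qed.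

Lemma I_compact : compact [set: I].
Proof. exact/set_type_compact/segment_compact. Qed.

Lemma I_hausdorff : hausdorff_space (I : Type).
Proof. exact/set_type_hausdorff/realType_hausdorff. Qed.

End unit_interval_paths.

(* A homotopy of [phi]-equivariant maps; for [phi] the identity this is
   [ghomotopic], and a constant [phi] gives homotopies of invariant maps. *)
Definition phomotopic (R : realType) (G G' : compactGroupType) (phi : G -> G')
    (X : gSpace G) (Y : gSpace G') (f f' : X -> Y) : Prop :=
  exists H : (X * unit_interval R)%type -> Y,
    [/\ continuous H,
        forall g x t, H (gact g x, t) = gact (phi g) (H (x, t)),
        forall x t, set_val t = 0 -> H (x, t) = f x
      & forall x t, set_val t = 1 -> H (x, t) = f' x].

Section homotopies.
Context {R : realType} {G G' : compactGroupType} (phi : G -> G').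
Local Notation I := (unit_interval R).

Lemma phomotopic_refl (X : gSpace G) (Y : gSpace G') (f f' : X -> Y) :
  continuous f -> (forall g x, f (gact g x) = gact (phi g) (f x)) -> f =1 f' ->
  phomotopic R phi f f'.
Proof.
move=> cf ef ff'; exists (fun p => f p.1); split=> [|g x t|x t _|x t _].
- exact: (comp_cont fst_cont cf).
- exact: ef.
- by [].
- exact: ff'.
Qed.

Lemma phomotopic_sym (X : gSpace G) (Y : gSpace G') (f f' : X -> Y) :
  phomotopic R phi f f' -> phomotopic R phi f' f.
Proof.
move=> [H [cH eH H0 H1]].
exists (fun p => H (p.1, to_I (1 - set_val p.2))); split.
- apply: (@reparam_cont R X Y H (fun t => 1 - t)) => // t.
  by apply: cvgB; [exact: cvg_cst|exact: cvg_id].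
- by move=> g x t /=; rewrite eH.
- by move=> x t t0; apply: H1; rewrite set_val_to_I t0 subr0 clip_ge1.
- by move=> x t t1; apply: H0; rewrite set_val_to_I t1 subrr clip_le0.
Qed.

Lemma phomotopic_trans (X : gSpace G) (Y : gSpace G') (f f' f'' : X -> Y) :
  phomotopic R phi f f' -> phomotopic R phi f' f'' -> phomotopic R phi f f''.
Proof.
move=> [H [cH eH H0 H1]] [K [cK eK K0 K1]].
pose H' (p : X * I) := H (p.1, to_I (2 * set_val p.2)).
pose K' (p : X * I) := K (p.1, to_I (2 * set_val p.2 - 1)).
have cp2 : continuous (fun p : X * I => 2 * set_val p.2 : R).
  apply: (@I_cont R X (fun t => 2 * t)) => t.
  by apply: cvgM; [exact: cvg_cst|exact: cvg_id].
have cH' : continuous H'.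
  apply: (@reparam_cont R X Y H (fun t => 2 * t)) => // t.
  by apply: cvgM; [exact: cvg_cst|exact: cvg_id].
have cK' : continuous K'.
  apply: (@reparam_cont R X Y K (fun t => 2 * t - 1)) => // t.
  apply: cvgB; last exact: cvg_cst.
  by apply: cvgM; [exact: cvg_cst|exact: cvg_id].
pose F (p : X * I) := if 2 * set_val p.2 <= 1 then H' p else K' p.
have FK p : 1 <= 2 * set_val p.2 -> F p = K' p.
  move=> p1; rewrite /F; case: ifPn => // p2.
  have E : 2 * set_val p.2 = 1 by apply/eqP; rewrite eq_le p2.
  have -> : H' p = f' p.1 by rewrite /H' E H1// set_val_to_I clip_ge1.
  by rewrite /K' E subrr K0// set_val_to_I clip_le0.
exists F; split.
- apply/continuous_subspace_setT.
  rewrite (_ : setT = [set p : X * I | 2 * set_val p.2 <= 1] `|` [set p | 1 <= 2 * set_val p.2]); last first.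
    by apply/seteqP; split=> // p _; case: (leP (2 * set_val p.2) 1); [left|move=> /ltW; right].
  apply: withinU_continuous.
  + by apply: (@preimage_closed _ _ (fun p : X * I => 2 * set_val p.2) [set x | x <= 1]); [move=> p _; exact: cp2|exact: closed_le].
  + by apply: (@preimage_closed _ _ (fun p : X * I => 2 * set_val p.2) [set x | 1 <= x]); [move=> p _; exact: cp2|exact: closed_ge].
  + apply: (@subspace_eq_continuous _ _ _ H'); last exact: continuous_subspaceT.
    by move=> p /set_mem /= p1; rewrite -[RHS]/(F p) /F p1.
  + apply: (@subspace_eq_continuous _ _ _ K'); last exact: continuous_subspaceT.
    by move=> p /set_mem /= p1; rewrite -[RHS]/(F p) FK.
- by move=> g x t; rewrite /F /H' /K' /=; case: ifP; rewrite ?eH ?eK.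
- by move=> x t t0; rewrite /F /= t0 mulr0 ler01 /H' H0// set_val_to_I /= t0 mulr0 clip_le0.
- move=> x t t1; rewrite FK /=; last by rewrite t1 mulr1 ler1n.
  by rewrite /K' K1// set_val_to_I /= t1 mulr1 clip_ge1//; lra.
Qed.

End homotopies.

Section homotopy_composition.
Context {R : realType} {G : compactGroupType}.
Implicit Types X Y Z : gSpace G.

Lemma ghomotopic_refl X Y (f f' : gMap X Y) : f =1 f' -> ghomotopic R f f'.
Proof.
move=> ff'; apply: (@phomotopic_refl R G G id) => //; first exact: gfun_continuous.
exact: gfun_equivariant.
Qed.

Lemma ghomotopic_sym X Y (f f' : gMap X Y) :
  ghomotopic R f f' -> ghomotopic R f' f.
Proof. exact: (@phomotopic_sym R G G id). Qed.

Lemma ghomotopic_trans X Y (f f' f'' : gMap X Y) :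
  ghomotopic R f f' -> ghomotopic R f' f'' -> ghomotopic R f f''.
Proof. exact: (@phomotopic_trans R G G id). Qed.

Lemma ghomotopic_compl X Y Z (k : gMap Y Z) (f f' : gMap X Y) :
  ghomotopic R f f' -> ghomotopic R (k \og f) (k \og f').
Proof.
move=> [H [cH eH H0 H1]]; exists (fun p => k (H p)); split=> [|g x t|x t t0|x t t1].
- exact: (comp_cont cH (@gfun_continuous _ _ _ k)).
- by rewrite eH gfun_equivariant.
- by rewrite H0.
- by rewrite H1.
Qed.

Lemma ghomotopic_compr X Y Z (k : gMap X Y) (f f' : gMap Y Z) :
  ghomotopic R f f' -> ghomotopic R (f \og k) (f' \og k).
Proof.
move=> [H [cH eH H0 H1]]; exists (fun p => H (k p.1, p.2)); split=> [|g x t|x t t0|x t t1].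
- exact: (comp2_cont cH (comp_cont fst_cont (@gfun_continuous _ _ _ k)) snd_cont).
- by rewrite /= gfun_equivariant eH.
- by rewrite H0.
- by rewrite H1.
Qed.

End homotopy_composition.

Lemma closed_equalizer (X Y : topologicalType) (f g : X -> Y) :
  hausdorff_space Y -> continuous f -> continuous g ->
  closed [set x | f x = g x].
Proof.
move=> hY cf cg x clx; apply: hY => A B Ax Bx.
have [y [/= fg [Ay By]]] : [set x | f x = g x] `&` (f @^-1` A `&` g @^-1` B) !=set0.
  by apply: clx; apply: filterI; [exact: cf|exact: cg].
by exists (f y); split=> //; rewrite fg.
Qed.

(** * Maps from the limit of an inverse sequence factor up to homotopy *)

Section inverse_sequence.
Context {R : realType} {X D : gSpace Z2}.
Local Notation I := (unit_interval R).
Variables (f : gMap X X) (j : gMap X D) (d0 : D) (lam : D * I -> D).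
Hypotheses (cX : compact [set: X]) (hX : hausdorff_space X)
  (cD : compact [set: D]) (hD : hausdorff_space D) (jI : injective j)
  (lam_cont : continuous lam)
  (lam_eq : forall a d s, lam (gact a d, s) = gact a (lam (d, s)))
  (lam1 : forall d s, set_val s = 1 -> lam (d, s) = d)
  (lam0 : forall d s, set_val s = 0 -> lam (d, s) = d0).

Local Notation P := (@inverse_limit Z2 (fun=> X) (fun=> f)).
Local Notation XN := (prod_topology (fun _ : nat => X : topologicalType)).
Local Notation DN := (prod_topology (fun _ : nat => D : topologicalType)).

Lemma limit_compact : compact [set: P].
Proof.
apply: set_type_compact; apply: (@subclosed_compact _ _ [set: XN]) => //; last first.
  rewrite (_ : setT = [set x : XN | forall n : nat, [set: X] (x n)]); last exact/seteqP.
  by apply: (@tychonoff nat (fun=> X : topologicalType) (fun=> setT)) => n.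
rewrite (_ : threads _ = \bigcap_(n in setT) [set x : XN | f (x n.+1) = x n]); last first.
  by apply/seteqP; split=> x h n; [move=> _; exact: h|exact: h].
apply: closed_bigI => n _; apply: closed_equalizer => //.
  apply: (@comp_cont _ _ _ (fun x : XN => x n.+1) f); first exact: prod_proj_continuous.
  exact: gfun_continuous.
exact: prod_proj_continuous.
Qed.

Lemma limit_proj_continuous n : continuous (fun p : P => set_val p n).
Proof.
apply: (@comp_cont _ XN X set_val (fun x => x n)); first exact: set_val_continuous.
exact: prod_proj_continuous.
Qed.

Lemma limit_projP (p : P) n : f (set_val p n.+1) = set_val p n.
Proof. exact: (set_valP p n). Qed.

Lemma iter_limit_proj (p : P) n m : (n <= m)%N ->
  iter (m - n) f (set_val p m) = set_val p n.
Proof.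
move=> /subnK; move: (m - n)%N => k <-.
by elim: k => // k IH; rewrite iterSr addSn limit_projP.
Qed.

Lemma iter_continuous n : continuous (iter n f).
Proof.
elim: n => [|n IHn] x; first exact: cvg_id.
by apply: (@comp_cont _ _ _ (iter n f) f) => //; exact: gfun_continuous.
Qed.

Lemma iter_equivariant n a x : iter n f (gact a x) = gact a (iter n f x).
Proof. by elim: n => //= n ->; rewrite gfun_equivariant. Qed.

(** The coordinates up to [n] are determined by [x]; the later ones are free in the contractible
    space [D]. Filled with [d0] they give a point depending on [x] alone, filled with a thread
    through [x] they give back a point of the limit. *)
Definition fill (n : nat) (x : X) (c : DN) : DN :=
  fun i => if (i <= n)%N then j (iter (n - i) f x) else c i.

Lemma fill_continuous (Y : topologicalType) n (x : Y -> X) (c : Y -> DN) :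
  continuous x -> continuous c -> continuous (fun y => fill n (x y) (c y)).
Proof.
move=> cx cc; apply: prod_continuous => i; rewrite /fill; case: (i <= n)%N.
  apply: (@comp_cont _ _ _ x (fun x => j (iter (n - i) f x))) => //.
  apply: (@comp_cont _ _ _ (iter (n - i) f) j); first exact: iter_continuous.
  exact: gfun_continuous.
by apply: (@comp_cont _ DN _ c (fun c => c i)) => //; exact: prod_proj_continuous.
Qed.

Definition partial_threads n : set DN := [set c | exists x c', c = fill n x c'].

Lemma DN_compact : compact [set: DN].
Proof.
rewrite (_ : setT = [set x : DN | forall n : nat, [set: D] (x n)]); last exact/seteqP.
by apply: (@tychonoff nat (fun=> D : topologicalType) (fun=> setT)) => n.
Qed.

Lemma DN_hausdorff : hausdorff_space DN.
Proof. exact: prod_topology_hausdorff. Qed.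

Lemma closed_partial_threads n : closed (partial_threads n).
Proof.
apply: compact_closed; first exact: DN_hausdorff.
rewrite (_ : partial_threads n = [set fill n p.1 p.2 | p in [set: X] `*` [set: DN]]).
  apply: continuous_compact; last exact: compact_setX cX DN_compact.
  by apply: continuous_subspaceT; apply: fill_continuous; [exact: fst_cont|exact: snd_cont].
by apply/seteqP; split=> [c [x [c' ->]]|_ [[x c] _ <-]]; [exists (x, c')|exists x, c].
Qed.

Lemma partial_threads_fill n m x c : (m <= n)%N -> partial_threads m (fill n x c).
Proof.
move=> mn; exists (iter (n - m) f x), (fill n x c); apply/funext => i.
rewrite /fill; case: (leqP i m) => // im; rewrite (leq_trans im mn).
by rewrite -iterD addnC addnBA// subnK.
Qed.

(* A "telescope" in which the limit is the zero level, and the level [t > 0] consists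
   of threads up to the index of order [1 / t]. *)
Definition telescope : set (DN * I)%type :=
  [set w | forall n, set_val w.2 < n.+1%:R^-1 -> partial_threads n w.1].

Lemma closed_telescope : closed telescope.
Proof.
rewrite (_ : telescope = \bigcap_(n in setT)
    ([set w | n.+1%:R^-1 <= set_val w.2] `|` [set w | partial_threads n w.1])).
  apply: closed_bigI => n _; apply: closedU.
    apply: (@preimage_closed _ _ (fun w : DN * I => set_val w.2) [set x | n.+1%:R^-1 <= x]).
      by move=> w _; exact: (@I_cont R DN id (fun t => @cvg_id _ (nbhs t))).
    exact: closed_ge.
  apply: (@preimage_closed _ _ (fun w : DN * I => w.1)); last exact: closed_partial_threads.
  by move=> w _; exact: fst_cont.
apply/seteqP; split=> w h n.
  by move=> _; case: (leP n.+1%:R^-1 (set_val w.2)) => [|/h]; [left|right].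
by case: (h n Logic.I) => //= ; rewrite leNgt => /negP.
Qed.

Definition DN_act (a : Z2) (c : DN) : DN := fun i => gact a (c i).

Lemma fill_act a n x c : DN_act a (fill n x c) = fill n (gact a x) (DN_act a c).
Proof.
apply/funext => i; rewrite /DN_act /fill; case: ifP => // _.
by rewrite iter_equivariant gfun_equivariant.
Qed.

Lemma telescope_act_proof a (w : telescope) :
  telescope (DN_act a (set_val w).1, (set_val w).2).
Proof.
move=> n /= /(set_valP w n)[x [c ->]]; rewrite fill_act.
by exists (gact a x), (DN_act a c).
Qed.

Definition telescope_act a (w : telescope) : telescope :=
  SigSub (mem_set (@telescope_act_proof a w)).

Lemma telescope_act1 w : telescope_act 1%g w = w.
Proof.
apply: val_inj => /=; rewrite [RHS]surjective_pairing; congr pair.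
by apply/funext => i; rewrite /DN_act gact1.
Qed.

Lemma telescope_actM a b w :
  telescope_act (a * b)%g w = telescope_act a (telescope_act b w).
Proof.
by apply: val_inj => /=; congr pair; apply/funext => i; rewrite /DN_act gactM.
Qed.

Lemma tel1_continuous : continuous (fun w : telescope => (set_val w).1).
Proof.
by apply: (@comp_cont _ _ _ set_val fst); [exact: set_val_continuous|exact: fst_cont].
Qed.

Lemma tel2_continuous : continuous (fun w : telescope => (set_val w).2).
Proof.
by apply: (@comp_cont _ _ _ set_val snd); [exact: set_val_continuous|exact: snd_cont].
Qed.

Lemma telescope_act_continuous :
  continuous (fun p : Z2 * telescope => telescope_act p.1 p.2).
Proof.
apply: discrete_fun_continuous => [g|g]; first exact: (@discrete_set1 bool).
apply: continuous_set_type; apply: pair_continuous; last exact: tel2_continuous.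
apply: prod_continuous => i.
apply: (@comp_cont _ D _ (fun w : telescope => (set_val w).1 i) (gact g)); last exact: gact_cont.
apply: (@comp_cont _ DN _ (fun w : telescope => (set_val w).1) (fun c => c i)).
  exact: tel1_continuous.
exact: prod_proj_continuous.
Qed.

Definition telescope_space : gSpace Z2 :=
  GSpace telescope_act1 telescope_actM telescope_act_continuous.

Definition level (w : telescope_space) : R := set_val (set_val w).2.

Lemma level_continuous : continuous level.
Proof.
by apply: (@comp_cont _ I _ (fun w : telescope => (set_val w).2)); [exact: tel2_continuous|exact: set_val_continuous].
Qed.

Let jn (p : P) : DN := fun n => j (set_val p n).

Lemma jn_continuous : continuous jn.
Proof.
apply: prod_continuous => n; apply: (@comp_cont _ X _ (fun p : P => set_val p n) j).
  exact: limit_proj_continuous.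
exact: gfun_continuous.
Qed.

Lemma fill_limit n (p : P) : fill n (set_val p n) (jn p) = jn p.
Proof. by apply/funext => i; rewrite /fill /jn; case: ifP => // /iter_limit_proj ->. Qed.

Lemma in_telescope_proof (p : P) (t : I) : telescope (jn p, t).
Proof. by move=> n _; exists (set_val p n), (jn p); rewrite fill_limit. Qed.

Definition in_telescope (p : P) (t : I) : telescope :=
  SigSub (mem_set (@in_telescope_proof p t)).

Lemma level_in_telescope p t : level (in_telescope p t) = set_val t.
Proof. by []. Qed.

Definition limit_in_telescope (p : P) : telescope := in_telescope p (to_I 0).

Lemma limit_in_telescope_continuous : continuous (limit_in_telescope : P -> telescope_space).
Proof.
apply: continuous_set_type; apply: pair_continuous; last exact: cst_continuous.
exact: jn_continuous.
Qed.

Lemma limit_in_telescope_equivariant a p :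
  limit_in_telescope (gact a p) = gact a (limit_in_telescope p : telescope_space).
Proof.
apply: val_inj => /=; congr pair; apply/funext => n.
by rewrite /jn /DN_act /= gfun_equivariant.
Qed.

Definition limit_in_telescope_gmap : gMap P telescope_space :=
  GMap limit_in_telescope_continuous limit_in_telescope_equivariant.

Lemma limit_in_telescope_inj : injective limit_in_telescope_gmap.
Proof.
move=> p q /(congr1 (fun w : telescope => (set_val w).1)) pq; apply: val_inj.
by apply/funext => n; apply: jI; exact: (congr1 (fun c : DN => c n) pq).
Qed.

(** At level 0 every initial segment is a partial thread, and injectivity of [j] brings the bonding
    relations back from [D] to [X]. *)
Lemma level_eq0 w : level w = 0 <-> exists p, limit_in_telescope_gmap p = w.
Proof.
split=> [w0|[p <-]]; last first.
  by rewrite /= /limit_in_telescope level_in_telescope set_val_to_I clip_le0.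
have wA n : partial_threads n (set_val w).1.
  by apply: (set_valP w n); rewrite /level in w0; rewrite w0 invr_gt0 ltr0n.
have wX n : exists x, (set_val w).1 n = j x.
  by have [x [c ->]] := wA n; exists x; rewrite /fill leqnn subnn.
have [x xP] := choice wX.
have xt n : f (x n.+1) = x n.
  have [y [c yc]] := wA n.+1; apply: jI; rewrite -xP yc /fill leqnSn subSnn /=.
  congr (j (f _)); apply: jI; rewrite -xP yc /fill leqnn subnn //.
exists (SigSub (mem_set (xt : threads (fun=> f) x))); apply: val_inj.
rewrite [RHS]surjective_pairing /=; congr pair.
  by apply/funext => n; rewrite /jn /= xP.
by apply: val_inj => /=; rewrite clip_le0//; exact: esym.
Qed.

Let lam_d0 a : gact a d0 = d0.
Proof.
rewrite -{1}(@lam0 d0 (to_I 0)); last by rewrite set_val_to_I clip_le0.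
by rewrite -lam_eq lam0// set_val_to_I clip_le0.
Qed.

(** [h] extends to the part of the telescope below some [eps]. The homotopy first lifts the limit,
    threads unchanged, to a level 1/(n+1) below [eps], and then shrinks the coordinates beyond [n]
    to [d0]; what remains depends on the [n]-th coordinate only. *)
Theorem limit_factorization (G : compactGroupType) (phi : Z2 -> G)
    (K : gSpace G) (h : P -> K) :
  (forall g : G, nbhs g [set g]) ->
  (forall a b, phi (a * b)%g = (phi a * phi b)%g) ->
  (forall g, exists a, phi a = g) ->
  is_gANR K -> continuous h ->
  (forall a p, h (gact a p) = gact (phi a) (h p)) ->
  exists n (psi : X -> K),
    [/\ continuous psi, forall a x, psi (gact a x) = gact (phi a) (psi x)
      & phomotopic R phi h (fun p => psi (set_val p n))].
Proof.
move=> dG phiM phi_surj aK ch h_eq.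
have [eps [r [eps0 cr r_eq rh]]] := @neighborhood_extension R G phi dG phiM phi_surj
  K telescope_space P limit_in_telescope_gmap level h
  (set_type_compact (subclosed_compact closed_telescope
     (compact_setX DN_compact I_compact) (fun _ _ => conj Logic.I Logic.I)))
  (set_type_hausdorff (pair_hausdorff DN_hausdorff I_hausdorff))
  limit_compact limit_in_telescope_inj level_continuous
  (fun w => I_ge0 _) (fun _ _ => erefl) level_eq0 ch h_eq aK.
pose n := Num.truncn eps^-1.
have n_eps : n.+1%:R^-1 < eps.
  by rewrite -[ltRHS]invrK ltf_pV2 ?posrE ?invr_gt0 ?ltr0n ?truncnS_gt.
pose e : I := to_I n.+1%:R^-1.
have eE : set_val e = n.+1%:R^-1.
  by rewrite set_val_to_I clip_id ?invr_ge0 ?ler0n// invf_le1 ?ltr0n ?ler1n.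
(* The strict inequality in [telescope] constrains a point of level 1/(n+1) only at the indices
   [m < n], which [fill n] satisfies. *)
have tel_fill x c : telescope (fill n x c, e).
  move=> m /=; rewrite eE ltf_pV2 ?posrE ?ltr0n// ltr_nat ltnS => mn.
  exact/partial_threads_fill/ltnW.
have near_fill x c : [set w : telescope_space | level w < eps] (SigSub (mem_set (tel_fill x c))).
  by rewrite /= /level eE.
pose F x c : [set w : telescope_space | level w < eps] := SigSub (mem_set (near_fill x c)).
have F_cont (Y : topologicalType) (x : Y -> X) (c : Y -> DN) :
    continuous x -> continuous c -> continuous (fun y => F (x y) (c y)).
  move=> cx cc; apply: continuous_set_type => /=; apply: continuous_set_type => /=.
  by apply: pair_continuous; [exact: fill_continuous|exact: cst_continuous].
have F_eq a x c : set_val (F (gact a x) (DN_act a c)) = gact a (set_val (F x c)).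
  by apply: val_inj => /=; rewrite fill_act.
have near_tel (p : P) (s : I) : [set w : telescope_space | level w < eps]
    (in_telescope p (to_I (n.+1%:R^-1 * set_val s))).
  rewrite /= level_in_telescope set_val_to_I clip_id ?mulr_ge0 ?invr_ge0 ?I_ge0//.
    by apply: le_lt_trans n_eps; rewrite ler_piMr ?invr_ge0 ?I_le1.
  by rewrite mulr_ile1 ?invr_ge0 ?I_ge0 ?I_le1// invf_le1 ?ltr0n ?ler1n.
pose T p s : [set w : telescope_space | level w < eps] := SigSub (mem_set (near_tel p s)).
exists n, (fun x => r (F x (fun=> d0))); split.
- apply: (@comp_cont _ _ _ (fun x => F x (fun=> d0)) r) => //.
  apply: (F_cont X id (fun=> fun=> d0)); last exact: (@cst_continuous X DN).
  by move=> x; exact: cvg_id.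
- move=> a x; apply: r_eq; rewrite -F_eq; congr (set_val (F _ _)).
  by apply/funext => i; rewrite /DN_act lam_d0.
apply: (@phomotopic_trans _ _ _ _ _ _ _ (fun p : P => r (T p (to_I 1)))).
  exists (fun q => r (T q.1 q.2)); split.
  - apply: (@comp_cont _ _ _ (fun q : P * I => T q.1 q.2) r) => //.
    apply: continuous_set_type => /=; apply: continuous_set_type => /=.
    apply: pair_continuous.
      by apply: (@comp_cont _ _ _ fst jn); [exact: fst_cont|exact: jn_continuous].
    apply: (@comp_cont _ R _ (fun q : P * I => n.+1%:R^-1 * set_val q.2)); last exact: to_I_continuous.
    by apply: (@I_cont R P (fun t => n.+1%:R^-1 * t)) => t; apply: cvgM; [exact: cvg_cst|exact: cvg_id].
  - move=> a p t; apply: r_eq; apply: val_inj => /=; congr pair.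
    by apply/funext => i; rewrite /jn /DN_act /= gfun_equivariant.
  - move=> p t t0; apply: rh; apply: val_inj => /=; congr pair.
    by rewrite t0 mulr0.
  - by move=> p t t1; congr (r (T p _)); rewrite -(to_IK t) t1.
apply: phomotopic_sym.
exists (fun q => r (F (set_val q.1 n) (fun i => lam (jn q.1 i, q.2)))); split.
- apply: (@comp_cont _ _ _ (fun q : P * I => F (set_val q.1 n) (fun i => lam (jn q.1 i, q.2))) r) => //.
  apply: F_cont.
    by apply: (@comp_cont _ P _ fst (fun p : P => set_val p n)); [exact: fst_cont|exact: limit_proj_continuous].
  apply: prod_continuous => i; apply: (comp2_cont lam_cont); last exact: snd_cont.
  apply: (@comp_cont _ P _ fst (fun p => jn p i)); first exact: fst_cont.
  by apply: (@comp_cont _ DN _ jn (fun c => c i)); [exact: jn_continuous|exact: prod_proj_continuous].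
- move=> a p t; apply: r_eq; rewrite -F_eq; congr (set_val (F _ _)).
  by apply/funext => i; rewrite /DN_act /jn -lam_eq /= gfun_equivariant.
- move=> p t t0; congr (r (F _ _)); apply/funext => i; exact: lam0.
- move=> p t t1; congr r; apply: val_inj; apply: val_inj => /=; congr pair.
    rewrite -[RHS](fill_limit n); congr fill; apply/funext => i; exact: lam1.
  by rewrite /e; congr to_I; rewrite set_val_to_I clip_ge1// mulr1.
Qed.

End inverse_sequence.

(** * Topology of the bouquet of two circles *)

Section complex_plane.
Context {R : realType}.
Local Notation C := R[i].

Lemma cplx_cvg (T : Type) (F : set_system T) (f : T -> C) (l : C) : Filter F ->
  complex.Re (f x) @[x --> F] --> complex.Re l ->
  complex.Im (f x) @[x --> F] --> complex.Im l -> f x @[x --> F] --> l.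
Proof.
move=> FF cr ci; apply/(@cvgrPdist_lt _ _ _ F _) => e e0.
have [er ei] : 0 < complex.Re e /\ complex.Im e = 0.
  by move: e0; rewrite ltcE /= => /andP[/eqP <-].
have eE : e = (complex.Re e)%:C%C by case: (e) ei => a b /= ->.
have e2 : 0 < complex.Re e / 2 by rewrite divr_gt0.
have /cvgrPdist_lt/(_ _ e2) cr' := cr; have /cvgrPdist_lt/(_ _ e2) ci' := ci.
near=> x.
have hr : `|complex.Re l - complex.Re (f x)| < complex.Re e / 2 by near: x.
have hi : `|complex.Im l - complex.Im (f x)| < complex.Re e / 2 by near: x.
rewrite normc_def eE ltcR -(@ger0_norm _ (complex.Re e)); last exact: ltW.
rewrite -sqrtr_sqr ltr_sqrt ?exprn_gt0//.
move: hr hi; rewrite !ltr_norml => /andP[h1 h2] /andP[h3 h4].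
have -> : complex.Re (l - f x) = complex.Re l - complex.Re (f x) by case: (l) (f x) => ? ? [].
have -> : complex.Im (l - f x) = complex.Im l - complex.Im (f x) by case: (l) (f x) => ? ? [].
by nra.
Unshelve. all: by end_near. Qed.

Lemma cplx_cont (T : topologicalType) (f : T -> C) :
  continuous (fun x => complex.Re (f x)) -> continuous (fun x => complex.Im (f x)) ->
  continuous f.
Proof. by move=> cr ci x; apply: cplx_cvg; [exact: cr|exact: ci]. Qed.

Lemma conjc_cont : continuous (fun z : C => (z^*)%C).
Proof.
apply: cplx_cont => z.
  rewrite (_ : (fun _ => _) = @complex.Re R); first exact: Re_continuous.
  by apply/funext => -[].
rewrite (_ : (fun _ => _) = (fun z => - complex.Im z)); last by apply/funext => -[].
apply: (@comp_cont _ R R (@complex.Im R) (fun x => - x)); first exact: Im_continuous.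
by move=> x; apply: cvgN; exact: cvg_id.
Qed.

Definition cis (t : R) : C := (cos t +i* sin t)%C.

Lemma cis_continuous : continuous cis.
Proof. by apply: cplx_cont; [exact: continuous_cos|exact: continuous_sin]. Qed.

Lemma cis_circle t : circle (cis t).
Proof.
by rewrite /circle /= normc_def /= cos2Dsin2 sqrtr1.
Qed.

Lemma cisD s t : cis (s + t) = cis s * cis t.
Proof. by rewrite /cis cosD sinD; simpc; rewrite [sin s * _ + _]addrC. Qed.

Lemma cis0 : cis 0 = 1.
Proof. by rewrite /cis cos0 sin0. Qed.

Lemma cisMn t n : cis (t *+ n) = cis t ^+ n.
Proof. by elim: n => [|n IHn]; rewrite ?mulr0n ?cis0// mulrS exprS cisD IHn. Qed.

Lemma circle_cis z : circle z -> exists2 t, 0 <= t <= 2 * pi & z = cis t.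
Proof.
move=> /circle_arg[/andP[t0 t2] zt]; exists (arg z) => //.
by rewrite t0 ltW.
Qed.

Lemma cplx_hausdorff : hausdorff_space (C : topologicalType).
Proof. exact: (@norm_hausdorff _ C). Qed.

Lemma mulC_cont (T : topologicalType) (f g : T -> C) :
  continuous f -> continuous g -> continuous (fun x => f x * g x : C).
Proof. by move=> cf cg x; apply: (@continuousM C T f g x); [exact: cf|exact: cg]. Qed.

Lemma addC_cont (T : topologicalType) (f g : T -> C) :
  continuous f -> continuous g -> continuous (fun x => f x + g x : C).
Proof. by move=> cf cg x; apply: (@continuousD C C T f g x); [exact: cf|exact: cg]. Qed.

Lemma realC_cont : continuous (fun x : R => x%:C%C : C).
Proof. by apply: cplx_cont => x; [exact: cvg_id|exact: cvg_cst]. Qed.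

End complex_plane.

(** * The two loops, and the equivariant cone over the bouquet *)

Section bouquet_topology.
Context {R : realType}.
Local Notation C := R[i].
Local Notation B := (bouquet_space R).
Local Notation I := (unit_interval R).

Definition loop_a (t : R) : B := SigSub (mem_set (bouquet_l (cis_circle t))).
Definition loop_b (t : R) : B := SigSub (mem_set (bouquet_r (cis_circle t))).

Lemma loop_a_continuous : continuous loop_a.
Proof.
apply: continuous_set_type; apply: pair_continuous; first exact: cis_continuous.
exact: cst_continuous.
Qed.

Lemma loop_b_continuous : continuous loop_b.
Proof.
apply: continuous_set_type; apply: pair_continuous; last exact: cis_continuous.
exact: cst_continuous.
Qed.

Lemma bouquet_loops :
  [set: B] = (loop_a @` `[0, 2 * pi]) `|` (loop_b @` `[0, 2 * pi]).
Proof.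
apply/seteqP; split=> // w _.
have [[/= cz t1]|[/= z1 ct]] := set_valP w.
  left; have [s s01 zs] := circle_cis cz; exists s; first by rewrite /= in_itv.
  by apply: val_inj; rewrite [RHS]surjective_pairing /= -zs t1.
right; have [s s01 ts] := circle_cis ct; exists s; first by rewrite /= in_itv.
by apply: val_inj; rewrite [RHS]surjective_pairing /= -ts z1.
Qed.

Lemma bouquet_compact : compact [set: B].
Proof.
rewrite bouquet_loops; apply: compactU; apply: continuous_compact;
  by [exact: segment_compact|apply: continuous_subspaceT;
      exact: loop_a_continuous|apply: continuous_subspaceT; exact: loop_b_continuous].
Qed.

Lemma bouquet_connected : connected [set: B].
Proof.
rewrite bouquet_loops; apply: connectedU.
- have pi0 := @pi_ge0 R.
  have zero : `[0, 2 * pi]%classic (0 : R) by rewrite /= in_itv /= lexx mulr_ge0.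
  exists (loop_a 0); split; exists 0 => //; apply: val_inj => /=.
  by rewrite !cis0.
- apply: connected_continuous_connected; first exact: segment_connected.
  exact/continuous_subspaceT/loop_a_continuous.
- apply: connected_continuous_connected; first exact: segment_connected.
  exact/continuous_subspaceT/loop_b_continuous.
Qed.

Lemma bouquet_hausdorff : hausdorff_space B.
Proof. by apply: set_type_hausdorff; apply: pair_hausdorff; exact: cplx_hausdorff. Qed.

Lemma coord1_continuous : continuous (fun w : B => (set_val w).1 : C).
Proof.
by apply: (@comp_cont _ _ _ set_val fst); [exact: set_val_continuous|exact: fst_cont].
Qed.

Lemma coord2_continuous : continuous (fun w : B => (set_val w).2 : C).
Proof.
by apply: (@comp_cont _ _ _ set_val snd); [exact: set_val_continuous|exact: snd_cont].
Qed.

(** On the circle inversion is conjugation, so the generator of [Z2] extends to this real-linear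
    involution of C^2, which is compatible with real scaling and with averaging. *)
Definition conj_swap (w : C * C) : C * C := ((w.2^*)%C, (w.1^*)%C).

Lemma conj_swapK : involutive conj_swap.
Proof. by case=> z t; rewrite /conj_swap /= !conjcK. Qed.

Lemma conj_swap_continuous : continuous conj_swap.
Proof.
apply: pair_continuous.
  by apply: (@comp_cont _ _ _ snd (fun z : C => (z^*)%C)); [exact: snd_cont|exact: conjc_cont].
by apply: (@comp_cont _ _ _ fst (fun z : C => (z^*)%C)); [exact: fst_cont|exact: conjc_cont].
Qed.

Lemma bouquet_circles (w : C * C) : bouquet w -> circle w.1 /\ circle w.2.
Proof. by move: w => [z t] [[/= cz ->]|[/= -> ct]]; split=> //; exact: circle1. Qed.

Lemma bouquet_genE (w : B) : set_val (gact (true : Z2) w) = conj_swap (set_val w).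
Proof.
have [c1 c2] := bouquet_circles (set_valP w).
rewrite -[LHS]/(bouquet_swap (set_val w)) bouquet_swapE; last exact: (set_valP w).
by rewrite (circle_conj c1) (circle_conj c2).
Qed.

Definition cone_map (p : I * B) : C * C :=
  ((set_val p.1)%:C%C * (set_val p.2).1, (set_val p.1)%:C%C * (set_val p.2).2).

Lemma scale_continuous (T : topologicalType) (s : T -> R) (w : T -> (C * C)%type) :
  continuous s -> continuous w ->
  continuous (fun x => ((s x)%:C%C * (w x).1, (s x)%:C%C * (w x).2) : C * C).
Proof.
move=> cs cw; apply: pair_continuous; apply: mulC_cont.
- exact: (comp_cont cs realC_cont).
- exact: (comp_cont cw fst_cont).
- exact: (comp_cont cs realC_cont).
- exact: (comp_cont cw snd_cont).
Qed.

(** The straight cone from the origin: a compact space containing the bouquet and equivariantly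
    contractible by scaling, as required of [D]. *)
Definition cone : set (C * C) := range cone_map.

Lemma cone_compact : compact cone.
Proof.
apply: continuous_compact.
  apply: continuous_subspaceT; apply: scale_continuous.
    exact: (comp_cont fst_cont (@set_val_continuous _ _)).
  exact: (comp_cont snd_cont (@set_val_continuous _ _)).
by rewrite -setXTT; exact: compact_setX I_compact bouquet_compact.
Qed.

Lemma conj_swap_scale (s : R) (w : C * C) :
  conj_swap (s%:C%C * w.1, s%:C%C * w.2) =
  (s%:C%C * (conj_swap w).1, s%:C%C * (conj_swap w).2).
Proof.
case: w => z t; have cM (x : C) : ((s%:C * x)^*)%C = s%:C%C * (x^*)%C.
  case: x => a b; apply/eqP; rewrite eq_complex /=.
  by apply/andP; split; apply/eqP; ring.
exact: (congr2 pair (cM t) (cM z)).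
Qed.

Lemma cone_conj_swap w : cone w -> cone (conj_swap w).
Proof.
move=> [[s b] _ <-]; exists (s, gact (true : Z2) b) => //.
by rewrite /cone_map /= -[X in (_ * X.1, _ * X.2)]/(set_val (gact (true : Z2) b)) bouquet_genE -conj_swap_scale.
Qed.

Lemma cone_act_proof (a : Z2) (w : cone) :
  cone (if a then conj_swap (set_val w) else set_val w).
Proof. by case: a; [apply: cone_conj_swap|]; exact: set_valP. Qed.

Definition cone_act (a : Z2) (w : cone) : cone :=
  SigSub (mem_set (cone_act_proof a w)).

Lemma cone_act1 w : cone_act 1%g w = w.
Proof. exact: val_inj. Qed.

Lemma cone_actM a b w : cone_act (a * b)%g w = cone_act a (cone_act b w).
Proof. by apply: val_inj; case: a b => -[] //=; rewrite conj_swapK. Qed.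

Lemma cone_act_continuous : continuous (fun p : Z2 * cone => cone_act p.1 p.2).
Proof.
apply: discrete_fun_continuous => [g|[]]; first exact: (@discrete_set1 bool).
  apply: continuous_set_type => /=.
  exact: (comp_cont (@set_val_continuous _ _) conj_swap_continuous).
by apply: continuous_set_type => /=; exact: set_val_continuous.
Qed.

Definition cone_space : gSpace Z2 := GSpace cone_act1 cone_actM cone_act_continuous.

Lemma cone_scale_proof (p : cone * I) :
  cone ((set_val p.2)%:C%C * (set_val p.1).1, (set_val p.2)%:C%C * (set_val p.1).2).
Proof.
case: p => w t; have [[s b] _ bw] : cone (set_val w) := set_valP w.
rewrite -bw.
have ts : unit_interval R (set_val t * set_val s).
  by rewrite /unit_interval /= in_itv /= mulr_ge0 ?mulr_ile1 ?I_ge0 ?I_le1.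
by exists (SigSub (mem_set ts), b) => //; rewrite /cone_map /= rmorphM /= !mulrA.
Qed.

Definition cone_scale (p : cone * I) : cone_space := SigSub (mem_set (cone_scale_proof p)).

Lemma cone_scale_continuous : continuous (cone_scale : cone_space * I -> cone_space).
Proof.
apply: continuous_set_type; apply: scale_continuous.
  exact: (comp_cont snd_cont (@set_val_continuous _ _)).
exact: (comp_cont fst_cont (@set_val_continuous _ _)).
Qed.

Lemma cone_scale_equivariant (a : Z2) (d : cone_space) s :
  cone_scale (gact a d, s) = gact a (cone_scale (d, s)).
Proof. by apply: val_inj; case: a => //=; rewrite conj_swap_scale. Qed.

Lemma cone_scale1 (d : cone_space) s : set_val s = 1 -> cone_scale (d, s) = d.
Proof.
by move=> s1; apply: val_inj; rewrite /= s1 !mul1r -surjective_pairing.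
Qed.

Lemma cone_apex_proof : cone (0, 0).
Proof.
exists (to_I 0, bouquet_base R) => //.
by rewrite /cone_map set_val_to_I clip_le0// !mul0r.
Qed.

Definition cone_apex : cone_space := SigSub (mem_set cone_apex_proof).

Lemma cone_scale0 (d : cone_space) s : set_val s = 0 -> cone_scale (d, s) = cone_apex.
Proof. by move=> s0; apply: val_inj; rewrite /= s0 !mul0r. Qed.

Lemma in_cone_proof (w : B) : cone (set_val w).
Proof.
exists (to_I 1, w) => //.
by rewrite /cone_map set_val_to_I clip_ge1// !mul1r -surjective_pairing.
Qed.

Definition in_cone (w : B) : cone_space := SigSub (mem_set (in_cone_proof w)).

Lemma in_cone_continuous : continuous in_cone.
Proof. by apply: continuous_set_type; exact: set_val_continuous. Qed.

Lemma in_cone_equivariant (a : Z2) w : in_cone (gact a w) = gact a (in_cone w).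
Proof. by apply: val_inj; case: a => //=; exact: bouquet_genE. Qed.

Definition in_cone_gmap : gMap B cone_space :=
  GMap in_cone_continuous in_cone_equivariant.

Lemma in_cone_inj : injective in_cone_gmap.
Proof. by move=> w w' /(congr1 set_val)/= ww'; apply: val_inj. Qed.

Theorem bouquet_limit_factorization (G : compactGroupType) (phi : Z2 -> G)
    (K : gSpace G) (h : bouquet_limit R -> K) :
  (forall g : G, nbhs g [set g]) ->
  (forall a b, phi (a * b)%g = (phi a * phi b)%g) ->
  (forall g, exists a, phi a = g) ->
  is_gANR K -> continuous h ->
  (forall a p, h (gact a p) = gact (phi a) (h p)) ->
  exists n (psi : B -> K),
    [/\ continuous psi, forall a x, psi (gact a x) = gact (phi a) (psi x)
      & phomotopic R phi h (fun p => psi (set_val p n))].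
Proof.
apply: (@limit_factorization R B cone_space (bouquet_gmap R) in_cone_gmap cone_apex cone_scale).
- exact: bouquet_compact.
- exact: bouquet_hausdorff.
- exact/set_type_compact/cone_compact.
- by apply: set_type_hausdorff; apply: pair_hausdorff; exact: cplx_hausdorff.
- exact: in_cone_inj.
- exact: cone_scale_continuous.
- exact: cone_scale_equivariant.
- exact: cone_scale1.
- exact: cone_scale0.
Qed.

End bouquet_topology.

(** * The bouquet is an equivariant absolute neighborhood retract *)

Section bouquet_retraction.
Context {R : realType}.
Local Notation C := R[i].
Local Notation B := (bouquet_space R).

Definition md (z : C) : R := complex.Re `|z|.

Lemma mdE z : `|z| = (md z)%:C%C.
Proof. by rewrite /md normc_def. Qed.

Lemma md_ge0 z : 0 <= md z.
Proof. by rewrite -lecR -mdE normr_ge0. Qed.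

Lemma md_eq0 z : (md z == 0) = (z == 0).
Proof. by rewrite -(normr_eq0 z) mdE eq_complex /= eqxx andbT. Qed.

Lemma md_cont : continuous md.
Proof.
apply: (@comp_cont _ C _ (fun z : C => `|z| : C)); last exact: Re_continuous.
exact: (@norm_continuous C C).
Qed.

Lemma md_conj z : md (z^*)%C = md z.
Proof. by rewrite /md !normc_def; case: z => a b /=; rewrite sqrrN. Qed.

Definition push_ratio (w : C * C) : R :=
  Num.max 0 (md (w.1 - 1) - md (w.2 - 1)) / md (w.1 - 1).

Lemma push_ratio_itv w : 0 <= push_ratio w <= 1.
Proof.
have m1 := md_ge0 (w.1 - 1); have m2 := md_ge0 (w.2 - 1).
rewrite /push_ratio divr_ge0 ?le_max ?lexx//=.
have [->|n0] := eqVneq (md (w.1 - 1)) 0; first by rewrite invr0 mulr0.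
rewrite ler_pdivrMr; last by rewrite lt_neqAle eq_sym n0.
by rewrite mul1r ge_max m1 lerBlDr lerDl.
Qed.

(* Moves the first coordinate towards 1, all the way if the second coordinate is
   farther from 1. At [w.1 = 1] the ratio is [0 / 0 = 0]. *)
Definition push (w : C * C) : C := 1 + (w.1 - 1) * (push_ratio w)%:C%C.

Lemma sub1_cont (T : topologicalType) (f : T -> C) :
  continuous f -> continuous (fun x => f x - 1 : C).
Proof. by move=> cf; exact: (@addC_cont R T f (fun=> - 1) cf (@cst_continuous T C (- 1))). Qed.

(** Only the points with [w.1 = 1] need care: the ratio stays between 0 and 1, and the factor
    [w.1 - 1] tends to 0. *)
Lemma push_cont : continuous push.
Proof.
suff h : continuous (fun w : C * C => (w.1 - 1) * (push_ratio w)%:C%C : C).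
  exact: (@addC_cont R (C * C)%type (fun=> 1) _ (@cst_continuous (C * C)%type C 1) h).
have c1 : continuous (fun w : C * C => w.1 - 1 : C) by apply: sub1_cont; exact: fst_cont.
have c2 : continuous (fun w : C * C => w.2 - 1 : C) by apply: sub1_cont; exact: snd_cont.
move=> w; have [w1|w1] := eqVneq (w.1 - 1) 0.
  apply/(@cvgrPdist_lt _ _ _ (nbhs w) _) => e e0; rewrite w1 mul0r.
  have /(@cvgrPdist_lt _ _ _ (nbhs w) _)/(_ e e0) := c1 w.
  rewrite w1; apply: filterS => v /=; rewrite !sub0r !normrN normrM; apply: le_lt_trans.
  rewrite ler_piMr// (_ : 1 = (1 : R)%:C%C)//.
  have /andP[r0 r1] := push_ratio_itv v.
  by rewrite ger0_norm ?lecR// (_ : 0 = (0 : R)%:C%C)// lecR.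
apply: cvgM; first exact: c1.
apply: (@continuous_comp _ _ _ push_ratio (fun x : R => x%:C%C : C)); last exact: realC_cont.
have m1 : {for w, continuous (fun w : C * C => md (w.1 - 1))}.
  exact: (comp_cont c1 md_cont).
have m2 : {for w, continuous (fun w : C * C => md (w.2 - 1))}.
  exact: (comp_cont c2 md_cont).
apply: cvgM; last by apply: cvgV => //; rewrite md_eq0.
apply: (@continuous_max R _ (fun=> 0) (fun w : C * C => md (w.1 - 1) - md (w.2 - 1))).
  exact: cvg_cst.
by apply: cvgB; [exact: m1|exact: m2].
Qed.

Definition flip (w : C * C) : C * C := (w.2, w.1).

Definition pushable : set (C * C) := [set w | push w != 0 /\ push (flip w) != 0].

(** The coordinate closer to 1 is pushed to 1 itself, and normalizing puts the other one on the
    circle. *)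
Definition bouquet_retr (w : C * C) : C * C :=
  (push w / `|push w|, push (flip w) / `|push (flip w)|).

Lemma push_near w : md (w.1 - 1) <= md (w.2 - 1) -> push w = 1.
Proof.
move=> h; rewrite /push /push_ratio max_l; last by rewrite subr_le0.
by rewrite mul0r mulr0 addr0.
Qed.

Lemma circle_normalize (z : C) : z != 0 -> circle (z / `|z|).
Proof.
by move=> z0; rewrite /circle /= normrM normfV normr_id divff// normr_eq0.
Qed.

Lemma bouquet_retr_bouquet w : pushable w -> bouquet (bouquet_retr w).
Proof.
move=> [p1 p2]; rewrite /bouquet_retr; case: (leP (md (w.1 - 1)) (md (w.2 - 1))).
  move=> /push_near ->; rewrite normr1 divr1; exact/bouquet_r/circle_normalize.
move=> /ltW; rewrite -[w.2]/(flip w).1 -[w.1]/(flip w).2 => /push_near ->.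
by rewrite normr1 divr1; exact/bouquet_l/circle_normalize.
Qed.

Lemma push_circle z : push (z, 1) = z.
Proof.
rewrite /push /push_ratio /= subrr (_ : md 0 = 0); last by apply/eqP; rewrite md_eq0.
rewrite subr0 max_r ?md_ge0//; have [->|z1] := eqVneq z 1; first by rewrite subrr mul0r addr0.
by rewrite divff ?md_eq0 ?subr_eq0// mulr1 addrC subrK.
Qed.

Lemma push_one z : push (1, z) = 1.
Proof. by rewrite /push /= subrr mul0r addr0. Qed.

Lemma push_bouquet w : bouquet w -> push w = w.1 /\ push (flip w) = w.2.
Proof.
by case: w => z t [[/= cz ->]|[/= -> ct]]; rewrite /flip push_circle push_one.
Qed.

Lemma circle_neq0 (z : C) : circle z -> z != 0.
Proof. by move=> cz; rewrite -normr_eq0 cz oner_eq0. Qed.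

Lemma bouquet_pushable w : bouquet w -> pushable w.
Proof.
move=> bw; have [c1 c2] := bouquet_circles bw; have [p1 p2] := push_bouquet bw.
by rewrite /pushable /= p1 p2; split; exact: circle_neq0.
Qed.

Lemma bouquet_retr_id w : bouquet w -> bouquet_retr w = w.
Proof.
move=> bw; have [c1 c2] := bouquet_circles bw; have [p1 p2] := push_bouquet bw.
by rewrite /bouquet_retr p1 p2 c1 c2 !divr1 -surjective_pairing.
Qed.

Lemma push_conj_swap w : push (conj_swap w) = ((push (flip w))^*)%C.
Proof.
have c1 (z : C) : (z^*)%C - 1 = ((z - 1)^*)%C.
  by case: z => a b; apply/eqP; rewrite eq_complex /=; apply/andP; split; apply/eqP; ring.
rewrite /push /push_ratio /conj_swap /flip /= !c1 !md_conj.
move: (Num.max _ _ / _) => s; case: (w.2) => a b; apply/eqP; rewrite eq_complex /=.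
by apply/andP; split; apply/eqP; ring.
Qed.

Lemma flip_conj_swap w : flip (conj_swap w) = conj_swap (flip w).
Proof. by []. Qed.

Lemma pushable_conj_swap w : pushable w -> pushable (conj_swap w).
Proof.
move=> [p1 p2]; rewrite /pushable /= flip_conj_swap !push_conj_swap !conjc_eq0.
by split=> //; case: (w) p1.
Qed.

Lemma normalize_conj (z : C) : (z^*)%C / `|(z^*)%C| = ((z / `|z|)^*)%C.
Proof.
rewrite !mdE md_conj.
have -> : ((md z)%:C%C)^-1 = ((md z)^-1)%:C%C :> C by rewrite fmorphV.
move: (md z)^-1 => s.
case: z => a b; apply/eqP; rewrite eq_complex /=.
by apply/andP; split; apply/eqP; ring.
Qed.

Lemma bouquet_retr_conj_swap w :
  bouquet_retr (conj_swap w) = conj_swap (bouquet_retr w).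
Proof.
rewrite /bouquet_retr flip_conj_swap !push_conj_swap !normalize_conj /conj_swap /=.
by case: w.
Qed.

Lemma open_pushable : open pushable.
Proof.
have cf : continuous (fun w => push (flip w)).
  apply: (@comp_cont _ _ _ flip push); last exact: push_cont.
  by apply: pair_continuous; [exact: snd_cont|exact: fst_cont].
have on : open [set z : C | z != 0].
  rewrite (_ : [set _ | _] = ~` [set 0]); last first.
    by apply/seteqP; split=> z /= => [/eqP//|z0]; apply/eqP.
  apply: closed_openC; apply: accessible_closed_set1.
  exact/hausdorff_accessible/cplx_hausdorff.
apply: openI; first by apply: (open_comp _ on) => w _; exact: push_cont.
by apply: (open_comp _ on) => w _; exact: cf.
Qed.

Lemma bouquet_retr_cont w : pushable w -> {for w, continuous bouquet_retr}.
Proof.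
move=> [p1 p2].
have ndiv (f : C * C -> C) : continuous f -> f w != 0 ->
    f v / `|f v| @[v --> w] --> f w / `|f w|.
  move=> cf f0; apply: cvgM; first exact: cf.
  apply: cvgV; first by rewrite normr_eq0.
  by apply: (@cvg_norm C C _ (nbhs w)); exact: cf.
have n1 := ndiv _ push_cont p1.
suff cf : continuous (fun w => push (flip w)) by exact: (cvg_pair n1 (ndiv _ cf p2)).
apply: (@comp_cont _ _ _ flip push); last exact: push_cont.
by apply: pair_continuous; [exact: snd_cont|exact: fst_cont].
Qed.

Lemma circle_bounds (z : C) : circle z ->
  `|complex.Re z| <= 1 /\ `|complex.Im z| <= 1.
Proof.
move=> /circleE; move: (complex.Re z) (complex.Im z) => x y xy.
by split; rewrite ler_norml; apply/andP; split; nra.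
Qed.

(** Both coordinates are extended by Tietze's theorem, and the extension is averaged with its
    transform under the generator to make it equivariant. On the preimage of [pushable],
    [bouquet_retr] then brings it into the bouquet. *)
Lemma bouquet_gANR : is_gANR B.
Proof.
split=> [|Z i [pZ _] ei cli].
  by apply: compact_p_paracompact; [exact: bouquet_hausdorff|exact: bouquet_compact].
have nZ := paracompact_normal pZ.
have ext (v : B -> C) : continuous v -> (forall w, circle (v w)) ->
    exists F : Z -> C, continuous F /\ forall w, F (i w) = v w.
  move=> cv cirv.
  have [F [cF Fi]] := @tietze_embedding R B Z i (fun w => complex.Re (v w)) 1 nZ ei cli
    (comp_cont cv (@Re_continuous R)) (fun w => (circle_bounds (cirv w)).1).
  have [F' [cF' Fi']] := @tietze_embedding R B Z i (fun w => complex.Im (v w)) 1 nZ ei cli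
    (comp_cont cv (@Im_continuous R)) (fun w => (circle_bounds (cirv w)).2).
  exists (fun z => (F z +i* F' z)%C); split; first exact: cplx_cont.
  by move=> w; rewrite Fi Fi'; case: (v w).
have [F1 [cF1 F1i]] := ext _ coord1_continuous
  (fun w => (bouquet_circles (set_valP w)).1).
have [F2 [cF2 F2i]] := ext _ coord2_continuous
  (fun w => (bouquet_circles (set_valP w)).2).
pose g : Z2 := true.
pose half : C := (2^-1 : R)%:C%C.
pose A (z : Z) : C * C :=
  (half * (F1 z + ((F2 (gact g z))^*)%C), half * (F2 z + ((F1 (gact g z))^*)%C)).
have gK (z : Z) : gact g (gact g z) = z by rewrite -gactM gact1.
have halfK (x : C) : half * (x + x) = x.
  case: x => a b; apply/eqP; rewrite eq_complex /=.
  by apply/andP; split; apply/eqP; field.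
have cA : continuous A.
  have cs (F F' : Z -> C) : continuous F -> continuous F' ->
      continuous (fun z => half * (F z + ((F' (gact g z))^*)%C) : C).
    move=> cF cF'; apply: (@mulC_cont R Z (fun=> half)); first exact: cst_continuous.
    suff h : continuous (fun z => ((F' (gact g z))^*)%C : C) by exact: (addC_cont cF h).
    apply: (@comp_cont _ C _ (fun z => F' (gact g z)) (fun z : C => (z^*)%C)); last exact: conjc_cont.
    by apply: (@comp_cont _ Z _ (gact g) F') => //; exact: gact_cont.
  by apply: pair_continuous; exact: cs.
have A_eq z : A (gact g z) = conj_swap (A z).
  have hc (x y : C) : half * (x + (y^*)%C) = ((half * (y + (x^*)%C))^*)%C.
    case: x y => a b [c d]; apply/eqP; rewrite eq_complex /=.
    by apply/andP; split; apply/eqP; ring.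
  by rewrite /A gK; exact: (congr2 pair (hc _ _) (hc _ _)).
have Ai w : A (i w) = set_val w.
  rewrite /A -gfun_equivariant !F1i !F2i bouquet_genE /conj_swap /= !conjcK !halfK.
  by rewrite -surjective_pairing.
pose U := A @^-1` pushable.
pose r (z : U) : B := SigSub (mem_set (bouquet_retr_bouquet (set_valP z))).
have r_eq (z z' : U) : set_val z' = gact g (set_val z) -> r z' = gact g (r z).
  move=> zz'; apply: val_inj.
  rewrite -[LHS]/(bouquet_retr (A (set_val z'))) zz' A_eq bouquet_retr_conj_swap.
  by rewrite -[RHS]/(set_val (gact g (r z))) bouquet_genE.
exists U, r; split.
- move=> _ [w _ <-]; rewrite /interior.
  apply: open_nbhs_nbhs; split; first by apply: open_comp open_pushable => z _; exact: cA.
  by rewrite /U /= Ai; exact: bouquet_pushable (set_valP w).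
- case=> z; last by rewrite (gact1 z).
  by rewrite /U /= A_eq; exact: pushable_conj_swap.
- apply: continuous_set_type => z.
  apply: (@continuous_comp _ _ _ (fun z : U => A (set_val z)) bouquet_retr).
    exact: (comp_cont (@set_val_continuous _ _) cA).
  by apply: bouquet_retr_cont; exact: (set_valP z).
- case=> z z'; first exact: r_eq.
  by rewrite (gact1 (set_val z)) => /val_inj ->.
- move=> w z zw; apply: val_inj.
  by rewrite -[LHS]/(bouquet_retr (A (set_val z))) zw Ai bouquet_retr_id//; exact: (set_valP w).
Qed.

End bouquet_retraction.

(** * Fixed points of the action on the limit *)

Section free_action.
Context {R : realType}.
Local Notation C := R[i].
Local Notation P := (bouquet_limit R).

Let conj1 : (1 -i* 0)%C = 1 :> C.
Proof. by rewrite -[LHS]/((1 : C)^*)%C conjc1. Qed.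

Lemma bouquet_gen_fixed (w : bouquet_space R) :
  gact (true : Z2) w = w -> w = bouquet_base R.
Proof.
move=> /(congr1 set_val); rewrite bouquet_genE => h; apply: val_inj.
move: (set_valP w) h; rewrite set_valE.
case: (\val w) => z t [[/= cz ->]|[/= -> ct]]; rewrite /conj_swap /=.
  by rewrite conj1 => -[<- _].
by rewrite conj1 => -[_ <-].
Qed.

Lemma bouquet_base_fixed : gact (true : Z2) (bouquet_base R) = bouquet_base R.
Proof.
apply: val_inj; rewrite -[LHS]/(set_val (gact (true : Z2) (bouquet_base R))).
by rewrite bouquet_genE /conj_swap /= conj1.
Qed.

Lemma limit_gen_fixed (p : P) : gact (true : Z2) p = p <-> p = bouquet_limit_base R.
Proof.
split=> [gp|->]; apply: val_inj; apply/funext => n /=.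
  by apply: bouquet_gen_fixed; exact: (congr1 (fun p : P => set_val p n) gp).
exact: bouquet_base_fixed.
Qed.

Lemma limit_free_at (x : P) : free_at x <-> x <> bouquet_limit_base R.
Proof.
split=> [fx /limit_gen_fixed/fx//|nx [|]] // /limit_gen_fixed //.
Qed.

Lemma limit_fixed_point (x : P) : fixed_point x <-> x = bouquet_limit_base R.
Proof.
split=> [fx|/limit_gen_fixed gx [|]//]; last exact: gact1.
exact/limit_gen_fixed/fx.
Qed.

End free_action.

(** * Surjectivity of the projections and connectedness of the limit *)

Section surjectivity.
Context {R : realType}.
Local Notation C := R[i].
Local Notation B := (bouquet_space R).
Local Notation P := (bouquet_limit R).

(** The first quarter of the first loop winds once around the first circle and the second quarter
    once around the second; preimages are taken there. *)
Lemma bouquet_fun_surj (w : B) : exists v : B, bouquet_gmap R v = w.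
Proof.
have pi0 := @pi_gt0 R.
have quarter (z : C) : circle z -> exists2 s, 0 <= s <= pi / 2 & z = cis s ^+ 4.
  move=> /circle_cis[t /andP[t0 t2] ->]; exists (t / 4); first by apply/andP; lra.
  by rewrite -cisMn; congr cis; rewrite -[_ *+ 4]mulr_natr; field.
have qsign (s : R) : 0 <= s <= pi / 2 -> 0 <= cos s /\ 0 <= sin s.
  move=> /andP[s0 s1]; split; first by apply: cos_ge0_pihalf; apply/andP; lra.
  by apply: sin_ge0_pi; apply/andP; lra.
have [[/= cz t1]|[/= z1 ct]] := set_valP w.
  have [s /qsign[c0 s0] zs] := quarter _ cz; exists (loop_a s).
  apply: val_inj; rewrite [RHS]surjective_pairing [RHS]/= t1 zs -[LHS]/(bouquet_map (cis s, 1)).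
  by have [->] := bouquet_map_l (cis_circle s).
have [s /qsign[c0 s0] ts] := quarter _ ct; exists (loop_a (s + pi / 2)).
apply: val_inj; rewrite [RHS]surjective_pairing [RHS]/= z1 ts -[LHS]/(bouquet_map (cis (s + pi / 2), 1)).
have [_ -> //=] := bouquet_map_l (cis_circle (s + pi / 2)).
- rewrite cisD exprMn (_ : cis (pi / 2) ^+ 4 = 1) ?mulr1//.
  rewrite -cisMn.
  have -> : pi / 2 *+ 4 = 0 + pi *+ 2 :> R by rewrite -(mulr_natr pi 2) -(mulr_natr (pi / 2) 4); lra.
  by rewrite /cis cosD2pi sinD2pi -/(cis 0) cis0.
- by rewrite cosDpihalf; lra.
- by rewrite sinDpihalf.
Qed.

Lemma bouquet_limit_proj_surj n (w : B) : exists p : P, set_val p n = w.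
Proof.
have [s sP] := choice bouquet_fun_surj.
pose x k : B := if (k <= n)%N then iter (n - k) (bouquet_gmap R) w else iter (k - n) s w.
have xt k : bouquet_gmap R (x k.+1) = x k.
  rewrite /x; case: (ltngtP k n) => [kn|nk|->].
  - by rewrite -iterS subnSK.
  - by rewrite subSn ?(ltnW nk)// iterS sP.
  - by rewrite subSnn subnn; exact: sP.
exists (SigSub (mem_set (xt : threads (fun=> bouquet_gmap R) x))).
by rewrite set_valE /= /x leqnn subnn.
Qed.

Lemma bouquet_limit_compact : compact [set: P].
Proof. by apply: limit_compact; [exact: bouquet_compact|exact: bouquet_hausdorff]. Qed.

(** A clopen set and its complement are disjoint compact sets, so their projections to some level
    are already disjoint. These projections are closed and, the projection being onto, they cover
    the connected space [B]. *)
Lemma bouquet_limit_connected : connected [set: P].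
Proof.
move=> U [u Uu] [V oV UV] [W cW UW].
rewrite setTI in UV; rewrite setTI in UW.
have oU : open U by rewrite UV.
have cU : closed U by rewrite UW.
apply/seteqP; split=> // v _; apply: contrapT => nUv.
pose pr n := fun p : P => set_val p n : B.
have cpr n : continuous (pr n) by exact: limit_proj_continuous.
have cK (F : set P) : closed F -> compact F.
  by move=> cF; apply: subclosed_compact cF bouquet_limit_compact _.
have [n Un] : exists n, forall p q, U p -> ~ U q -> pr n p <> pr n q.
  have cN := compact_setX (cK _ cU) (cK _ (open_closedC oU)).
  move/compact_near_coveringP : cN.
  (* Two threads that differ at one level differ at all higher ones, which makes the property hold
     eventually. *)
  case/(_ nat \oo (fun n pq => forall m, (n <= m)%N -> pr m pq.1 <> pr m pq.2) _).
    move=> [p q] /= [Up nUq].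
    have [k pqk] : exists k, pr k p <> pr k q.
      apply: contrapT => /forallNP h; apply: nUq.
      rewrite (_ : q = p) //; apply: val_inj; apply/funext => k.
      by apply: esym; apply: contrapT; exact: h.
    have /eqP := pqk; have := @bouquet_hausdorff R; rewrite open_hausdorff => /[apply].
    move=> [[S T] /= [/set_mem Sp /set_mem Tq] [oS oT /eqP/seteqP[ST _]]].
    exists (pr k @^-1` S `*` pr k @^-1` T, [set m | (k <= m)%N]) => /=.
      split; last exact: nbhs_infty_ge.
      exists (pr k @^-1` S, pr k @^-1` T) => //=.
      by split; apply: cpr; exact: open_nbhs_nbhs.
    move=> [[p' q'] m] /= [[Sp' Tq'] km] l ml pq.
    apply: (ST (pr k p')); split=> //=.
    have kl : (k <= l)%N by exact: leq_trans ml.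
    suff -> : pr k p' = pr k q' by [].
    by rewrite /pr -(@iter_limit_proj _ (bouquet_gmap R) p' k l kl) -(@iter_limit_proj _ (bouquet_gmap R) q' k l kl) -[set_val p' l]/(pr l p') pq.
  move=> N _ hN; exists N => p q Up nUq; exact: (hN N (leqnn N) (p, q) (conj Up nUq) N (leqnn N)).
have cS (F : set P) : closed F -> closed (pr n @` F).
  move=> cF; apply: compact_closed; first exact: bouquet_hausdorff.
  by apply: continuous_compact; [exact/continuous_subspaceT/cpr|exact: cK].
have E : pr n @` U = ~` (pr n @` (~` U)).
  apply/seteqP; split=> [_ [p Up <-] [q nUq /esym pq]|w nw]; first exact: (Un p q).
  have [p pw] := bouquet_limit_proj_surj n w.
  by exists p => //; apply: contrapT => nUp; apply: nw; exists p.
have : pr n @` U = [set: B].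
  apply: bouquet_connected; first by exists (pr n u); exists u.
    exists (~` (pr n @` (~` U))); last by rewrite setTI.
    exact/closed_openC/cS/open_closedC.
  by exists (pr n @` U); [exact: cS|rewrite setTI].
move=> h; have : [set: B] (pr n v) by [].
by rewrite -h => -[p Up pv]; exact: (Un p v).
Qed.

End surjectivity.

(** * Metrizability from a separating sequence of functions *)

Section separating_sequence_metric.
Variables (R : realType) (X : topologicalType) (phi : nat -> X -> R).
Hypotheses (cphi : forall n, continuous (phi n))
  (sep : forall x y, (forall n, phi n x = phi n y) -> x = y).

(** The cut-off at 1/(n+1) leaves only finitely many functions relevant at a given scale, so the
    topology of [X] is at least as fine as that of the metric. *)
Definition sep_term (x y : X) (n : nat) : R :=
  Num.min `|phi n x - phi n y| n.+1%:R^-1.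

Definition sep_dist (x y : X) : R := sup (range (sep_term x y)).

Lemma sep_term_ge0 x y n : 0 <= sep_term x y n.
Proof. by rewrite /sep_term le_min normr_ge0 invr_ge0 ler0n. Qed.

Lemma sep_term_ub x y : ubound (range (sep_term x y)) 1.
Proof.
move=> _ [n _ <-]; rewrite /sep_term ge_min; apply/orP; right.
by rewrite invf_le1 ?ltr0n// ler1n.
Qed.

Lemma sep_term_le x y n : sep_term x y n <= sep_dist x y.
Proof. by apply: ub_le_sup; [exists 1; exact: sep_term_ub|exists n]. Qed.

Lemma sep_dist_le x y (e : R) :
  (forall n, sep_term x y n <= e) -> sep_dist x y <= e.
Proof.
move=> h; apply: ge_sup; first by exists (sep_term x y 0%N); exists 0%N.
by move=> _ [n _ <-]; exact: h.
Qed.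

Lemma sep_dist_ge0 x y : 0 <= sep_dist x y.
Proof. exact: le_trans (sep_term_ge0 x y 0) (sep_term_le x y 0). Qed.

Lemma sep_distxx x : sep_dist x x = 0.
Proof.
apply/eqP; rewrite eq_le sep_dist_ge0 andbT; apply: sep_dist_le => n.
by rewrite /sep_term subrr normr0 ge_min lexx.
Qed.

Lemma sep_dist_eq0 x y : sep_dist x y = 0 -> x = y.
Proof.
move=> xy0; apply: sep => n; apply/eqP; rewrite -subr_eq0 -normr_eq0.
have := sep_term_le x y n; rewrite xy0 /sep_term ge_min => /orP[|].
  by move=> h; rewrite eq_le h normr_ge0.
by rewrite leNgt invr_gt0 ltr0n.
Qed.

Lemma sep_dist_sym x y : sep_dist x y = sep_dist y x.
Proof.
have E : sep_term x y = sep_term y x by apply/funext => n; rewrite /sep_term distrC.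
by rewrite /sep_dist E.
Qed.

Lemma sep_dist_triangle y x z : sep_dist x z <= sep_dist x y + sep_dist y z.
Proof.
apply: sep_dist_le => n; apply: le_trans (lerD (sep_term_le x y n) (sep_term_le y z n)).
rewrite /sep_term; set c := n.+1%:R^-1; have c0 : 0 <= c by rewrite invr_ge0 ler0n.
have h := ler_distD (phi n y) (phi n x) (phi n z).
have h1 := normr_ge0 (phi n x - phi n y); have h2 := normr_ge0 (phi n y - phi n z).
case: (leP `|phi n x - phi n z| c) => ?; case: (leP `|phi n x - phi n y| c) => ?;
  case: (leP `|phi n y - phi n z| c) => ?; lra.
Qed.

Definition sep_space : Type := X.
HB.instance Definition _ := Choice.on sep_space.
HB.instance Definition _ := @isMetric.Build R sep_space sep_dist sep_distxx
  sep_dist_eq0 sep_dist_sym sep_dist_triangle.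

Lemma to_sep_continuous : continuous (id : X -> sep_space).
Proof.
move=> x; apply/cvg_ballP => e e0.
have e2 : 0 < e / 2 by rewrite divr_gt0.
pose N := Num.truncn (e / 2)^-1.
have near_lt n : \forall y \near x, forall k, (k < n)%N -> `|phi k x - phi k y| < e / 2.
  elim: n => [|n IHn]; first by near=> y.
  have hn : \forall y \near x, `|phi n x - phi n y| < e / 2.
    by have /cvgrPdist_lt/(_ _ e2) := @cphi n x.
  near=> y => k; rewrite ltnS leq_eqVlt => /orP[/eqP ->|]; first by near: y.
  by move: k; near: y.
near=> y; rewrite ballEmdist /= /mdist /=.
apply: (@le_lt_trans _ _ (e / 2)); last by rewrite gtr_pMr// invf_lt1// ltr1n.
apply: sep_dist_le => n; rewrite /sep_term ge_min.
have [nN|Nn] := ltnP n N.+1.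
  have h : forall k, (k < N.+1)%N -> `|phi k x - phi k y| < e / 2.
    by near: y; exact: near_lt.
  by rewrite (ltW (h _ nN)).
apply/orP; right; rewrite -[leRHS]invrK lef_pV2 ?posrE ?invr_gt0 ?ltr0n//.
by apply: (le_trans (ltW (truncnS_gt _))); rewrite ler_nat ltnW.
Unshelve. all: by end_near. Qed.

(** The identity to the metric space is a continuous bijection from a compact space to a Hausdorff
    one, hence a homeomorphism. *)
Lemma compact_metrizable : compact [set: X] -> metrizable R X.
Proof.
move=> cX; have hM := @metric_hausdorff R sep_space.
have [[_ eo] _] := compact_inj_embedding cX hM to_sep_continuous (fun x y e => e).
exists sep_space, id, id; split=> //; first exact: to_sep_continuous.
apply/continuousP => U oU; have [V oV UV] := (eo U).1 oU.
by rewrite (_ : id @^-1` U = V)//; move: oU; rewrite UV.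
Qed.

End separating_sequence_metric.

Section bouquet_coordinates.
Context {R : realType}.
Local Notation B := (bouquet_space R).
Local Notation P := (bouquet_limit R).

Definition bouquet_coord (k : nat) (w : B) : R :=
  match k with
  | 0%N => complex.Re (set_val w).1 | 1%N => complex.Im (set_val w).1
  | 2%N => complex.Re (set_val w).2 | _ => complex.Im (set_val w).2 end.

Lemma bouquet_coord_cont k : continuous (bouquet_coord k).
Proof.
case: k => [|[|[|k]]].
- exact: (comp_cont coord1_continuous (@Re_continuous R)).
- exact: (comp_cont coord1_continuous (@Im_continuous R)).
- exact: (comp_cont coord2_continuous (@Re_continuous R)).
- exact: (comp_cont coord2_continuous (@Im_continuous R)).
Qed.

Lemma bouquet_coord_inj (w w' : B) :
  (forall k, (k < 4)%N -> bouquet_coord k w = bouquet_coord k w') -> w = w'.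
Proof.
move=> E; apply: val_inj.
have := E 0%N isT; have := E 1%N isT; have := E 2%N isT; have := E 3%N isT.
rewrite /bouquet_coord -[\val w]/(set_val w) -[\val w']/(set_val w').
by case: (set_val w) (set_val w') => [[? ?] [? ?]] [[? ?] [? ?]] /= -> -> -> ->.
Qed.

Definition limit_coord (n : nat) (p : P) : R :=
  bouquet_coord (n %% 4) (set_val p (n %/ 4)%N).

Lemma limit_coord_cont n : continuous (limit_coord n).
Proof.
apply: (@comp_cont _ B _ (fun p : P => set_val p (n %/ 4)%N) (bouquet_coord (n %% 4))).
  exact: limit_proj_continuous.
exact: bouquet_coord_cont.
Qed.

Lemma limit_coord_inj (p q : P) :
  (forall n, limit_coord n p = limit_coord n q) -> p = q.
Proof.
move=> pq; apply: val_inj; apply/funext => n; apply: bouquet_coord_inj => k k4.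
have := pq (n * 4 + k)%N.
by rewrite /limit_coord modnMDl modn_small// divnMDl// divn_small// addn0.
Qed.

Lemma bouquet_limit_metrizable : metrizable R P.
Proof.
apply: (@compact_metrizable R P limit_coord).
- exact: limit_coord_cont.
- exact: limit_coord_inj.
- exact: bouquet_limit_compact.
Qed.

End bouquet_coordinates.

(** * The orbit space *)

Section orbit_quotient.
Context {R : realType} {G : compactGroupType} (X : gSpace G).
Local Notation Q := (orbit_space X).

Definition orbit_pi (x : X) : Q := \pi_Q%qT x.
Definition orbit_repr (q : Q) : X := repr q.

Lemma orbit_reprK q : orbit_pi (orbit_repr q) = q.
Proof. exact: reprK. Qed.

Lemma orbit_piP x y : orbit_pi x = orbit_pi y <-> exists g, gact g x = y.
Proof.
split=> [/(@eqmodP _ (orbit_equiv X))/asboolP//|xy].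
by apply/(@eqmodP _ (orbit_equiv X)); apply/asboolP.
Qed.

Lemma orbit_pi_continuous : continuous orbit_pi.
Proof. exact: pi_continuous. Qed.

Lemma orbit_pi_open U : open U -> open (orbit_pi @` U).
Proof.
move=> oU; rewrite /open /= /quotient_open.
rewrite (_ : _ @^-1` _ = \bigcup_(g in [set: G]) (gact g @^-1` U)).
  apply: bigcup_open => g _; apply: open_comp => // x _.
  apply: (@comp2_cont _ _ X X (fun p : G * X => gact p.1 p.2) (fun=> g) id).
  - exact: gact_continuous.
  - exact: cst_continuous.
  - by move=> y; exact: cvg_id.
apply/seteqP; split=> x.
  move=> [y Uy /orbit_piP[g gyx]]; exists (g^-1)%g => //=.
  by rewrite -gyx -gactM mulVg gact1.
by move=> [g _ Ugx]; exists (gact g x) => //; apply/esym/orbit_piP; exists g.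
Qed.

(* The projection to the orbit space is open, so it stays a quotient map after
   multiplication by the interval. *)
Lemma orbit_homotopy (Y : topologicalType)
    (H : X * unit_interval R -> Y) : continuous H ->
  (forall g x t, H (gact g x, t) = H (x, t)) ->
  continuous (fun p : Q * unit_interval R => H (orbit_repr p.1, p.2)).
Proof.
move=> cH eH [q t] W /cH[[U V] /= [+ Vt] UVW].
rewrite nbhsE => -[U' [oU' U'q U'U]].
exists (orbit_pi @` U', V) => /=.
  split=> //; apply: (@open_nbhs_nbhs Q q); split; first exact: orbit_pi_open.
  by exists (orbit_repr q) => //; exact: orbit_reprK.
move=> [q' t'] /= [[x U'x xq] Vt'].
have /orbit_piP[g gx] : orbit_pi x = orbit_pi (orbit_repr q') by rewrite orbit_reprK.
by rewrite -gx eH; apply: (UVW (x, t')); split=> //=; exact: U'U.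
Qed.

End orbit_quotient.

(** * A criterion for trivial shape *)

Section trivial_shape_criterion.
Context {R : realType}.

Definition pt : gSpace trivial_group := plain_space point_space.

Lemma point_compact : compact [set: point_space].
Proof.
rewrite (_ : setT = [set tt : point_space]); first exact: compact_set1.
by apply/seteqP; split => // -[].
Qed.

Lemma pt_gANR : is_gANR pt.
Proof.
split; first by apply: compact_p_paracompact; [move=> [] []|exact: point_compact].
move=> Z i pZ ei cli; exists setT, (fun=> tt); split=> //.
- by rewrite interiorT.
- exact: (@cst_continuous _ pt tt).
- by case.
Qed.

Definition pt_system : inverse_system R trivial_group.
Proof.
apply: (@InverseSystem R trivial_group unit (fun _ _ => True) (inhabits tt)
  (fun _ => Logic.I) (fun _ _ _ _ _ => Logic.I)
  (fun _ _ => ex_intro _ tt (conj Logic.I Logic.I))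
  (fun _ => pt) (fun _ _ _ => gid pt)).
- by move=> a h; exact: ghomotopic_refl.
- by move=> *; exact: ghomotopic_refl.
Defined.

Definition pt_morphism : system_morphism pt_system pt_system.
Proof.
apply: (@SystemMorphism R _ pt_system pt_system id (fun _ => gid pt)).
by move=> b b' h; exists tt, Logic.I, Logic.I; exact: ghomotopic_refl.
Defined.

Definition to_pt (X : gSpace trivial_group) : gMap X pt.
Proof. by exists (fun=> tt) => //; exact: (@cst_continuous _ pt tt). Defined.

(** The hypothesis is the existence condition for the one-point system. For uniqueness, a homotopy
    between maps that factor through the point is restricted to [x0], which makes it a homotopy of
    maps from the point. *)
Lemma pt_system_associated (X : topologicalType) (x0 : X) :
  (forall (K : gSpace trivial_group) (h : gMap (plain_space X) K), is_gANR K ->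
    exists f : gMap pt K, ghomotopic R h (f \og to_pt (plain_space X))) ->
  associated (plain_space X) pt_system.
Proof.
move=> nullX; exists (fun _ => to_pt _); split=> [a a' h|K aK].
  exact: ghomotopic_refl.
split=> [h|a f f' [H [cH eH H0 H1]]].
  by have [f hf] := nullX K h aK; exists tt, f.
exists tt, Logic.I; exists (fun p => H (x0, p.2)); split.
- apply: (comp2_cont cH); first exact: cst_continuous.
  exact: snd_cont.
- by move=> g x t; case: g; rewrite -[X in X = _]/(H (x0, t)) [RHS]gact1.
- by case=> t t0; exact: H0.
- by case=> t t1; exact: H1.
Qed.

Lemma trivial_shapeP (X : topologicalType) (x0 : X) :
  (forall (K : gSpace trivial_group) (h : gMap (plain_space X) K), is_gANR K ->
    exists f : gMap pt K, ghomotopic R h (f \og to_pt (plain_space X))) ->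
  trivial_shape R X.
Proof.
move=> nullX; exists pt_system, pt_system; split.
- by move=> a; exact: pt_gANR.
- exact: pt_system_associated x0 nullX.
- by move=> a; exact: pt_gANR.
- apply: (@pt_system_associated point_space tt) => K h aK; exists h.
  by apply: ghomotopic_refl; case.
by exists pt_morphism, pt_morphism; split=> a; exists tt, Logic.I, Logic.I; exact: ghomotopic_refl.
Qed.

End trivial_shape_criterion.

(** * The orbit circle and the contraction of its self-map *)

Section orbit_space_of_the_limit.
Context {R : realType}.
Local Notation C := R[i].
Local Notation B := (bouquet_space R).
Local Notation P := (bouquet_limit R).
Local Notation I := (unit_interval R).

(* Identifies the orbit space of the bouquet with the circle. *)
Definition fold_pair (w : C * C) : C := w.1 * (w.2^*)%C.

Lemma fold_pair_l z : fold_pair (z, 1) = z.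
Proof. by rewrite /fold_pair [(_, _).2]/= conjc1 mulr1. Qed.

Lemma fold_pair_r z : fold_pair (1, z) = (z^*)%C.
Proof. by rewrite /fold_pair mul1r. Qed.

Definition fold (w : B) : C := fold_pair (set_val w).

Lemma fold_cont : continuous fold.
Proof.
apply: mulC_cont; first exact: coord1_continuous.
exact: (comp_cont coord2_continuous conjc_cont).
Qed.

Lemma fold_circle w : circle (fold w).
Proof.
have [c1 c2] := bouquet_circles (set_valP w).
rewrite /fold /fold_pair -circle_conj// /circle /= normrM c1 mul1r; exact: circleV c2.
Qed.

Lemma fold_gact (a : Z2) w : fold (gact a w) = fold w.
Proof.
case: a => //; rewrite /fold bouquet_genE /conj_swap.
by case: (set_val w) => z t; rewrite /fold_pair [LHS]/= conjcK mulrC.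
Qed.

Definition rot (z : C) (cz : circle z) : B := SigSub (mem_set (bouquet_l cz)).

(** The first loop meets each orbit exactly once, so it is a copy of the orbit space with [fold] as
    coordinate. *)
Lemma fold_orbit w : exists a : Z2, gact a w = rot (fold_circle w).
Proof.
case: (set_valP w) => -[/= h1 h2].
  exists (false : Z2); apply: val_inj; rewrite -[LHS]/(set_val w) /=.
  by rewrite /fold [set_val w]surjective_pairing [(set_val w).2]h2 fold_pair_l.
exists (true : Z2); apply: val_inj.
rewrite -[LHS]/(set_val (gact (true : Z2) w)) bouquet_genE.
rewrite -[RHS]/(fold w, 1) /fold [set_val w]surjective_pairing [(set_val w).1]h1.
by rewrite fold_pair_r /conj_swap [(1, _).1]/= conjc1.
Qed.

(* On the four quarters of a loop, [fold] of the image runs through [w ^ 4], back and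
   forth, where [w] is the reflection of the point into the right half of the circle. *)
Definition half_fold (w : B) : C :=
  (`|complex.Re (fold w)| +i* complex.Im (fold w))%C.

Lemma half_fold_pow (w : B) : fold (bouquet_gmap R w) = half_fold w ^+ 4.
Proof.
have conj4 (z : C) : ((z ^+ 4)^*)%C = ((z^*)%C) ^+ 4 by rewrite rmorphXn.
have neg4 (z : C) : (- z) ^+ 4 = z ^+ 4 by rewrite exprNn -signr_odd /= expr0 mul1r.
have [[/= cz t1]|[/= z1 ct]] := set_valP w.
  have [l1 l2 l3 l4] := bouquet_map_l cz.
  have fw : fold w = (set_val w).1.
    by rewrite /fold [set_val w]surjective_pairing [(set_val w).2]t1 fold_pair_l.
  rewrite /half_fold fw.
  have -> : fold (bouquet_gmap R w) = fold_pair (bouquet_map ((set_val w).1, 1)).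
    by rewrite -t1 -surjective_pairing.
  move: (set_val w).1 cz l1 l2 l3 l4 => z cz l1 l2 l3 l4.
  have zV : z ^- 4 = ((z^*)%C) ^+ 4 by rewrite -circle_conj// exprVn.
  have [x0|/ltW x0] := leP 0 (complex.Re z); have [y0|/ltW y0] := leP 0 (complex.Im z).
  - by rewrite l1// fold_pair_l ger0_norm//; case: (z).
  - by rewrite l4// fold_pair_r ger0_norm// zV conj4 conjcK; case: (z).
  - rewrite l2// fold_pair_r ler0_norm// conj4 -[in RHS]neg4; congr (_ ^+ 4).
    by case: (z) => a b; apply/eqP; rewrite eq_complex /= opprK !eqxx.
  - rewrite l3// fold_pair_l ler0_norm// zV -[in RHS]neg4; congr (_ ^+ 4).
    by case: (z) => a b; apply/eqP; rewrite eq_complex /= opprK !eqxx.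
have [l1 l2 l3 l4] := bouquet_map_r ct.
have fw : fold w = ((set_val w).2^*)%C.
  by rewrite /fold [set_val w]surjective_pairing [(set_val w).1]z1 fold_pair_r.
rewrite /half_fold fw.
have -> : fold (bouquet_gmap R w) = fold_pair (bouquet_map (1, (set_val w).2)).
  by rewrite -z1 -surjective_pairing.
move: (set_val w).2 ct l1 l2 l3 l4 => z cz l1 l2 l3 l4.
have zV : z ^- 4 = ((z^*)%C) ^+ 4 by rewrite -circle_conj// exprVn.
have [x0|/ltW x0] := leP 0 (complex.Re z); have [y0|/ltW y0] := leP 0 (complex.Im z).
- by rewrite l1// fold_pair_l zV; case: (z) x0 => a b /= x0; rewrite ger0_norm.
- by rewrite l4// fold_pair_r conj4; case: (z) x0 => a b /= x0; rewrite ger0_norm.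
- rewrite l2// fold_pair_r zV conj4 conjcK -[in RHS]neg4; congr (_ ^+ 4).
  by case: (z) x0 => a b /= x0; rewrite ler0_norm//; apply/eqP; rewrite eq_complex /= !opprK !eqxx.
- rewrite l3// fold_pair_l -[in RHS]neg4; congr (_ ^+ 4).
  by case: (z) x0 => a b /= x0; rewrite ler0_norm//; apply/eqP; rewrite eq_complex /= !opprK !eqxx.
Qed.

(** The segment from [half_fold w] to 1. It stays in the closed right half-plane and avoids 0, so it
    can be normalized and raised to the fourth power; this contracts the map that [bouquet_gmap]
    induces on the orbit circle. *)
Definition contract_path (p : B * I) : C :=
  (((1 - set_val p.2) * `|complex.Re (fold p.1)| + set_val p.2) +i*
   ((1 - set_val p.2) * complex.Im (fold p.1)))%C.

Lemma contract_path_neq0 p : contract_path p != 0.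
Proof.
case: p => w s; rewrite /contract_path /= eq_complex /=; apply/negP => /andP[/eqP h1 /eqP h2].
have := circleE (fold_circle w).
have := normr_ge0 (complex.Re (fold w)); have := I_ge0 s; have := I_le1 s.
rewrite -(real_normK (num_real (complex.Re _))); move: `|_| (complex.Im _) (set_val s) h1 h2.
by move=> a b c *; nra.
Qed.

Lemma contract_path_cont : continuous contract_path.
Proof.
have cs : continuous (fun p : B * I => 1 - set_val p.2 : R).
  by apply: (@I_cont R B (fun t => 1 - t)) => t; apply: cvgB; [exact: cvg_cst|exact: cvg_id].
have c2 : continuous (fun p : B * I => set_val p.2 : R).
  by apply: (@I_cont R B id) => t; exact: cvg_id.
have cf : continuous (fun p : B * I => fold p.1 : C) := comp_cont fst_cont fold_cont.
have cr := comp_cont cf (@Re_continuous R); have ci := comp_cont cf (@Im_continuous R).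
apply: cplx_cont => p.
  apply: cvgD; last exact: c2.
  by apply: cvgM; [exact: cs|apply: cvg_norm; exact: cr].
by apply: cvgM; [exact: cs|exact: ci].
Qed.

Definition contract_circle (p : B * I) : C :=
  (contract_path p / `|contract_path p|) ^+ 4.

Lemma contract_circle_circle p : circle (contract_circle p).
Proof. by apply: circleX; apply: circle_normalize; exact: contract_path_neq0. Qed.

Definition contract (p : B * I) : B := rot (contract_circle_circle p).

Lemma contract_cont : continuous contract.
Proof.
apply: continuous_set_type; apply: pair_continuous; last exact: cst_continuous.
suff h : continuous (fun p => contract_path p / `|contract_path p| : C).
  have h2 := mulC_cont h h; have h4 := mulC_cont h2 h2.
  apply: (eq_rect _ (fun f : B * I -> C => continuous f) h4) => //.
  by apply/funext => p; rewrite /contract /contract_circle /= -!expr2 -exprM.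
move=> p; apply: cvgM; first exact: contract_path_cont.
apply: cvgV; first by rewrite normr_eq0 contract_path_neq0.
by apply: (@cvg_norm C C _ (nbhs p)); exact: contract_path_cont.
Qed.

Lemma contract_gact (a : Z2) w s : contract (gact a w, s) = contract (w, s).
Proof.
apply: val_inj => /=; congr pair.
by rewrite /contract_circle /contract_path /= fold_gact.
Qed.

Lemma contract0 w s : set_val s = 0 ->
  exists a : Z2, gact a (bouquet_gmap R w) = contract (w, s).
Proof.
move=> s0; have [a aw] := fold_orbit (bouquet_gmap R w); exists a; rewrite aw.
apply: val_inj => /=; congr pair; rewrite half_fold_pow /contract_circle.
have -> : contract_path (w, s) = half_fold w.
  by rewrite /contract_path /= s0 subr0 !mul1r addr0.
rewrite (_ : `|half_fold w| = 1) ?divr1// normc_def /=.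
by rewrite real_normK ?num_real// (circleE (fold_circle w)) sqrtr1.
Qed.

Lemma contract1 w s : set_val s = 1 -> contract (w, s) = bouquet_base R.
Proof.
move=> s1; apply: val_inj => /=; congr pair; rewrite /contract_circle.
have -> : contract_path (w, s) = 1.
  by rewrite /contract_path /= s1 subrr !mul0r add0r.
by rewrite normr1 divr1 expr1n.
Qed.

(** A map from the orbit space is an invariant map from the limit, and the factorization with the
    trivial homomorphism sends it through an invariant map on some level. One more bonding map makes
    it null-homotopic through invariant maps, so the homotopy descends to the orbit space. *)
Lemma orbit_space_trivial_shape : trivial_shape R (orbit_space P).
Proof.
apply: (trivial_shapeP (orbit_pi (bouquet_limit_base R))) => K h aK.
pose phi (_ : Z2) : trivial_group := 1%g.
pose h' (p : P) : K := h (orbit_pi p).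
have ch' : continuous h' := comp_cont (@orbit_pi_continuous _ P) (@gfun_continuous _ _ _ h).
have inv_h' (a : Z2) p : h' (gact a p) = gact (phi a) (h' p).
  rewrite gact1 /h'; congr (h _); apply/esym/orbit_piP; by exists a.
have dG (g : trivial_group) : nbhs g [set g].
  exact: (@discrete_set1 (discrete_topology unit)).
have phiM a b : phi (a * b)%g = (phi a * phi b)%g by rewrite /phi mulg1.
have phi_surj (g : trivial_group) : exists a, phi a = g by case: g; exists (false : Z2).
have [n [psi [cpsi psi_eq hpsi]]] := bouquet_limit_factorization dG phiM phi_surj aK ch' inv_h'.
have psi_inv (a : Z2) w : psi (gact a w) = psi w by rewrite psi_eq gact1.
have [H [cH eH H0 H1]] : phomotopic R phi h' (fun=> psi (bouquet_base R)).
  apply: (phomotopic_trans hpsi).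
  (* The index is [n.+1] because the [n]-th coordinate is the image of the next one under the
     bonding map, and it is this map that [contract] deforms. *)
  exists (fun q => psi (contract (set_val q.1 n.+1, q.2))); split.
  - apply: (@comp_cont _ B _ (fun q : P * I => contract (set_val q.1 n.+1, q.2))) => //.
    apply: (comp2_cont contract_cont); last exact: snd_cont.
    by apply: (@comp_cont _ P _ fst (fun p : P => set_val p n.+1)); [exact: fst_cont|exact: limit_proj_continuous].
  - by move=> a p t; rewrite gact1 -[set_val (gact a p) n.+1]/(gact a (set_val p n.+1)) contract_gact.
  - move=> p t t0; have [a <-] := contract0 (set_val p n.+1) t0.
    by rewrite psi_inv limit_projP.
  - by move=> p t t1; rewrite contract1.
have f_eq (g : trivial_group) (x : pt) :
    psi (bouquet_base R) = gact g (psi (bouquet_base R)).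
  by case: g; rewrite [RHS]gact1.
exists (GMap (@cst_continuous pt K (psi (bouquet_base R))) f_eq); exists (fun q => H (orbit_repr q.1, q.2)); split.
- by apply: orbit_homotopy => // g x t; rewrite eH gact1.
- by move=> g x t; case: g; rewrite [RHS]gact1.
- by move=> x t t0; rewrite H0// /h' orbit_reprK.
- by move=> x t t1; rewrite H1.
Qed.

End orbit_space_of_the_limit.

(** * Iterated commutators *)

Section commutator_pairs.
Context {G : groupType}.
Local Open Scope group_scope.

Definition comm2 (a b : G) : G := a * b * a^-1 * b^-1.

Definition comm_step (p : G * G) : G * G :=
  (comm2 p.1 p.2, comm2 p.1^-1 p.2^-1).

Definition comm_pair (p : G * G) (k : nat) : G * G := iter k comm_step p.

End commutator_pairs.

(** * Congruence subgroups and iterated commutators in SL_2(Z) *)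

Section SL2Z.

(** Plain quadruples, so that matrix identities reduce to [ring] on the entries and the computations
    over ['F_5] to [vm_compute]. *)
Definition mat2 (A : Type) : Type := (A * A * A * A)%type.

Definition mat2_mul (A : pzRingType) (x y : mat2 A) : mat2 A :=
  let: (a, b, c, d) := x in let: (a', b', c', d') := y in
  (a * a' + b * c', a * b' + b * d', c * a' + d * c', c * b' + d * d').

Definition mat2_adj (A : pzRingType) (x : mat2 A) : mat2 A :=
  let: (a, b, c, d) := x in (d, - b, - c, a).

Definition mat2_det (x : mat2 int) : int :=
  let: (a, b, c, d) := x in a * d - b * c.

Record SL2Z := MkSL2Z { sl2_val :> mat2 int; _ : mat2_det sl2_val == 1 }.
HB.instance Definition _ := [isSub for sl2_val].
HB.instance Definition _ := [Choice of SL2Z by <:].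

Lemma sl2_det (x : SL2Z) : mat2_det x = 1.
Proof. exact: (eqP (valP x)). Qed.

Lemma sl2_one_proof : mat2_det (1, 0, 0, 1) == 1. Proof. by []. Qed.

Lemma sl2_mul_proof (x y : SL2Z) : mat2_det (mat2_mul x y) == 1.
Proof.
have := sl2_det x; have := sl2_det y.
case: (sl2_val x) (sl2_val y) => [[[a b] c] d] [[[a' b'] c'] d'] /= h' h.
apply/eqP; rewrite -[RHS](mulr1 1) -{1}h -h'; ring.
Qed.

Lemma sl2_inv_proof (x : SL2Z) : mat2_det (mat2_adj x) == 1.
Proof.
have := sl2_det x; case: (sl2_val x) => [[[a b] c] d] /= h.
by apply/eqP; rewrite -h; ring.
Qed.

Definition sl2_one := MkSL2Z sl2_one_proof.
Definition sl2_mul x y := MkSL2Z (sl2_mul_proof x y).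
Definition sl2_inv x := MkSL2Z (sl2_inv_proof x).

Lemma sl2_mulA : associative sl2_mul.
Proof.
move=> x y z; apply: val_inj => /=.
case: (sl2_val x) (sl2_val y) (sl2_val z) => [[[a b] c] d] [[[a' b'] c'] d'] [[[a2 b2] c2] d2] /=.
by congr (_, _, _, _); ring.
Qed.

Lemma sl2_mul1 : left_id sl2_one sl2_mul.
Proof.
move=> x; apply: val_inj => /=; case: (sl2_val x) => [[[a b] c] d] /=.
by congr (_, _, _, _); ring.
Qed.

Lemma sl2_mulr1 : right_id sl2_one sl2_mul.
Proof.
move=> x; apply: val_inj => /=; case: (sl2_val x) => [[[a b] c] d] /=.
by congr (_, _, _, _); ring.
Qed.

Lemma sl2_mulV : left_inverse sl2_one sl2_inv sl2_mul.
Proof.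
move=> x; apply: val_inj => /=; have := sl2_det x.
case: (sl2_val x) => [[[a b] c] d] /= h.
by congr (_, _, _, _); rewrite -?h; ring.
Qed.

Lemma sl2_mulrV : right_inverse sl2_one sl2_inv sl2_mul.
Proof.
move=> x; apply: val_inj => /=; have := sl2_det x.
case: (sl2_val x) => [[[a b] c] d] /= h.
by congr (_, _, _, _); rewrite -?h; ring.
Qed.

HB.instance Definition _ := @isGroup.Build SL2Z sl2_one sl2_inv sl2_mul
  sl2_mulA sl2_mul1 sl2_mulr1 sl2_mulV sl2_mulrV.

Lemma sl2_valM (x y : SL2Z) : (x * y)%g = mat2_mul x y :> mat2 int.
Proof. by []. Qed.

Lemma sl2_valV (x : SL2Z) : (x^-1)%g = mat2_adj x :> mat2 int.
Proof. by []. Qed.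

(** The principal congruence subgroup of level [s]. *)
Definition cong1 (s : int) (x : SL2Z) : Prop :=
  exists e : mat2 int, let: (a, b, c, d) := e in
    x = (1 + s * a, s * b, s * c, 1 + s * d) :> mat2 int.

Lemma cong1_1 s : cong1 s 1%g.
Proof. by exists (0, 0, 0, 0); rewrite !mulr0 !addr0. Qed.

Lemma cong1_M s x y : cong1 s x -> cong1 s y -> cong1 s (x * y)%g.
Proof.
move=> [[[[a b] c] d] xE] [[[[a' b'] c'] d'] yE].
exists (a + a' + s * (a * a' + b * c'), b + b' + s * (a * b' + b * d'),
  c + c' + s * (c * a' + d * c'), d + d' + s * (c * b' + d * d')).
by rewrite sl2_valM xE yE /=; congr (_, _, _, _); ring.
Qed.

Lemma cong1_V s x : cong1 s x -> cong1 s (x^-1)%g.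
Proof.
move=> [[[[a b] c] d] xE]; exists (d, - b, - c, a).
by rewrite sl2_valV xE /=; congr (_, _, _, _); ring.
Qed.

Lemma cong1_J s x u : cong1 s x -> cong1 s (u * x * u^-1)%g.
Proof.
move=> [[[[a b] c] d] xE]; have := sl2_det u; case uE : (sl2_val u) => [[[p q] r] t] /= h.
exists (mat2_mul (mat2_mul (p, q, r, t) (a, b, c, d)) (t, - q, - r, p)) => /=.
rewrite xE uE /=.
by congr (_, _, _, _); [rewrite -[X in _ = X + _]h|..|rewrite -[X in _ = X + _]h]; ring.
Qed.

(** With x = 1 + sX and y = 1 + tY, the commutator is 1 + (xy - yx)(yx)^-1, and xy - yx = st(XY -
    YX): levels multiply. *)
Lemma cong1_comm s t x y : cong1 s x -> cong1 t y -> cong1 (s * t) (comm2 x y).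
Proof.
move=> [[[[a b] c] d] xE] [[[[a' b'] c'] d'] yE].
pose m := mat2_mul (a, b, c, d) (a', b', c', d').
pose n := mat2_mul (a', b', c', d') (a, b, c, d).
have -> : comm2 x y = (x * y * (y * x)^-1)%g by rewrite /comm2 invgM !mulgA.
have := sl2_det (y * x)%g; rewrite sl2_valM xE yE /= => h.
exists (mat2_mul (m.1.1.1 - n.1.1.1, m.1.1.2 - n.1.1.2, m.1.2 - n.1.2, m.2 - n.2)
  (mat2_adj (mat2_mul (1 + t * a', t * b', t * c', 1 + t * d') (1 + s * a, s * b, s * c, 1 + s * d)))) => /=.
rewrite xE yE /=.
by congr (_, _, _, _); [rewrite -[X in _ = X + _]h|..|rewrite -[X in _ = X + _]h]; ring.
Qed.

Lemma cong1_all (x : SL2Z) : (forall k, cong1 (2 ^+ k) x) -> x = 1%g.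
Proof.
move=> h; apply: val_inj => /=.
have small (z : int) : (forall k, exists y, z = 2 ^+ k * y) -> z = 0.
  move=> hz; apply/eqP; apply: contrapT => /negP z0.
  (* The absolute value of [z] serves as its own exponent, because n < 2^n. *)
  have [y zy] := hz `|z|%N.
  have E : `|z|%N = (2 ^ `|z| * `|y|)%N by rewrite {1}zy abszM abszX.
  have : (`|z|%N < 2 ^ `|z|)%N by exact: ltn_expl.
  rewrite {1}E; have y0 : (0 < `|y|)%N.
    by rewrite absz_gt0; apply: contra z0 => /eqP y0; rewrite zy y0 mulr0.
  by rewrite ltnNge leq_pmulr.
case xE : (sl2_val x) => [[[a b] c] d].
have E k : exists e : mat2 int, let: (a', b', c', d') := e in
    [/\ a - 1 = 2 ^+ k * a', b = 2 ^+ k * b', c = 2 ^+ k * c' & d - 1 = 2 ^+ k * d'].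
  have [[[[a' b'] c'] d']] := h k; rewrite xE => -[-> -> -> ->].
  by exists (a', b', c', d'); split=> //; ring.
have -> : a = 1.
  by apply/eqP; rewrite -subr_eq0; apply/eqP/small => k; have [[[[a' ?] ?] ?] []] := E k; exists a'.
have -> : d = 1.
  by apply/eqP; rewrite -subr_eq0; apply/eqP/small => k; have [[[[? ?] ?] d'] []] := E k; exists d'.
have -> : b = 0 by apply: small => k; have [[[[? b'] ?] ?] []] := E k; exists b'.
by have -> : c = 0 by apply: small => k; have [[[[? ?] c'] ?] []] := E k; exists c'.
Qed.

Definition gen_a : SL2Z := @MkSL2Z (1, 2, 0, 1) isT.
Definition gen_b : SL2Z := @MkSL2Z (1, 0, 2, 1) isT.
Definition gens : SL2Z * SL2Z := (gen_a, gen_b).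

(** The generators have level 2 and a commutator step squares the level; of this gain only one
    factor 2 per step is kept. *)
Lemma cong1_comm_pair k :
  cong1 (2 ^+ k.+1) (comm_pair gens k).1 /\ cong1 (2 ^+ k.+1) (comm_pair gens k).2.
Proof.
elim: k => [|k [IH1 IH2]].
  by split; [exists (0, 1, 0, 0)|exists (0, 0, 1, 0)].
have weak x : cong1 (2 ^+ k.+1 * 2 ^+ k.+1) x -> cong1 (2 ^+ k.+2) x.
  move=> [[[[a b] c] d] xE]; exists (2 ^+ k * a, 2 ^+ k * b, 2 ^+ k * c, 2 ^+ k * d).
  rewrite xE; by congr (_, _, _, _); rewrite !exprS; ring.
split; apply: weak; apply: cong1_comm => //; exact: cong1_V.
Qed.

Definition mod5 (x : mat2 int) : mat2 'F_5 :=
  let: (a, b, c, d) := x in (a%:~R, b%:~R, c%:~R, d%:~R).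

Lemma mod5M x y : mod5 (mat2_mul x y) = mat2_mul (mod5 x) (mod5 y).
Proof.
case: x y => [[[a b] c] d] [[[a' b'] c'] d'] /=.
by rewrite !rmorphD !rmorphM.
Qed.

Lemma mod5V x : mod5 (mat2_adj x) = mat2_adj (mod5 x).
Proof. by case: x => [[[a b] c] d] /=; rewrite !rmorphN. Qed.

Definition mod5_comm (x y : mat2 'F_5) : mat2 'F_5 :=
  mat2_mul (mat2_mul (mat2_mul x y) (mat2_adj x)) (mat2_adj y).

Definition mod5_step (p : mat2 'F_5 * mat2 'F_5) : mat2 'F_5 * mat2 'F_5 :=
  (mod5_comm p.1 p.2, mod5_comm (mat2_adj p.1) (mat2_adj p.2)).

Definition mod5_gens : mat2 'F_5 * mat2 'F_5 := ((1, 2, 0, 1), (1, 0, 2, 1)).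

(** From its first step on the sequence repeats with period 4, so five terms decide. Modulo 2 the
    generators are trivial, and SL_2(F_3) is solvable, so iterated commutators die modulo 3; 5 is
    the first prime where they can survive. *)
Lemma mod5_periodic : [/\ iter 5 mod5_step mod5_gens = mod5_step mod5_gens,
  (iter 4 mod5_step mod5_gens).1 != (1, 0, 0, 1),
  (iter 3 mod5_step mod5_gens).1 != (1, 0, 0, 1),
  (iter 2 mod5_step mod5_gens).1 != (1, 0, 0, 1)
  & (mod5_step mod5_gens).1 != (1, 0, 0, 1) /\ mod5_gens.1 != (1, 0, 0, 1)].
Proof. by split; [apply/eqP; vm_compute|vm_compute..|split; vm_compute]. Qed.

Lemma iter_periodic (T : Type) (f : T -> T) (x : T) (p : nat) :
  iter p.+1 f x = f x ->
  forall q r, iter (q * p + r).+1 f x = iter r.+1 f x.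
Proof.
move=> fx; elim=> [|q IH] r; first by rewrite mul0n add0n.
have -> : (q.+1 * p + r).+1 = ((q * p + r) + p.+1)%N.
  by rewrite mulSn addnS -addnA addnC.
by rewrite iterD fx -iterSr IH.
Qed.

Lemma comm_pair_neq1 k : (comm_pair gens k).1 != 1%g.
Proof.
have E : (mod5 (comm_pair gens k).1, mod5 (comm_pair gens k).2) = iter k mod5_step mod5_gens.
  elim: k => [|k IH]; first by congr pair; congr (_, _, _, _); apply/eqP; vm_compute.
  have cE (x y : SL2Z) : mod5 (comm2 x y) = mod5_comm (mod5 x) (mod5 y).
    by rewrite /mod5_comm -!mod5V -!mod5M.
  by rewrite iterS -IH /mod5_step -!mod5V /comm_pair iterS /comm_step !cE.
apply/eqP => k1; have : (iter k mod5_step mod5_gens).1 = (1, 0, 0, 1).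
  have -> : (iter k mod5_step mod5_gens).1 = mod5 (comm_pair gens k).1 by rewrite -E.
  by rewrite k1; apply/eqP; vm_compute.
have [p5 h4 h3 h2 [h1 h0]] := mod5_periodic.
move: mod5_step mod5_gens {E k1} p5 h4 h3 h2 h1 h0 => f x p5 h4 h3 h2 h1 h0.
apply/eqP; case: k => [|k]; first exact: h0.
rewrite (divn_eq k 4) (iter_periodic p5).
by have := ltn_pmod k (isT : 0 < 4)%N; case: (k %% 4)%N => [|[|[|[|r]]]].
Qed.

End SL2Z.

(** * Holonomy on the bouquet *)

Section cells.
Context {R : realType}.
Local Notation C := R[i].
Local Notation B := (bouquet_space R).

Definition zr (w : B) : R := complex.Re (set_val w).1.
Definition zi (w : B) : R := complex.Im (set_val w).1.
Definition tr (w : B) : R := complex.Re (set_val w).2.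
Definition ti (w : B) : R := complex.Im (set_val w).2.

Definition near_pt (d : R) (x y : B) : Prop :=
  [/\ `|zr x - zr y| < d, `|zi x - zi y| < d, `|tr x - tr y| < d & `|ti x - ti y| < d].

Definition cellR (m n : nat) (a b : R) : nat :=
  if a < 0 then if 0 <= b then m else n else 0%N.

(* The far halves of the two loops are cut into an upper and a lower cell; the rest of
   the bouquet, a contractible neighborhood of the base point, is the cell 0. *)
Definition cell_pair (w : C * C) : nat :=
  if complex.Re w.1 < 0 then cellR 1 2 (complex.Re w.1) (complex.Im w.1)
  else cellR 3 4 (complex.Re w.2) (complex.Im w.2).

Definition cell (w : B) : nat := cell_pair (set_val w).

Lemma bouquet_coords (w : B) :
  (zr w ^+ 2 + zi w ^+ 2 = 1 /\ tr w = 1 /\ ti w = 0) \/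
  (tr w ^+ 2 + ti w ^+ 2 = 1 /\ zr w = 1 /\ zi w = 0).
Proof.
rewrite /zr /zi /tr /ti; case: (set_valP w) => -[h1 h2]; [left|right].
  by split; [exact: circleE|rewrite (_ : (set_val w).2 = 1)].
by split; [exact: circleE|rewrite (_ : (set_val w).1 = 1)].
Qed.

Lemma cell_cases (w : B) :
  cell w = 0%N /\ (0 <= zr w /\ 0 <= tr w) \/
  (cell w = 1%N /\ [/\ zr w < 0, 0 <= zi w & zr w ^+ 2 + zi w ^+ 2 = 1 /\ tr w = 1] \/
   cell w = 2%N /\ [/\ zr w < 0, zi w < 0 & zr w ^+ 2 + zi w ^+ 2 = 1 /\ tr w = 1]) \/
  (cell w = 3%N /\ [/\ tr w < 0, 0 <= ti w & tr w ^+ 2 + ti w ^+ 2 = 1 /\ zr w = 1] \/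
   cell w = 4%N /\ [/\ tr w < 0, ti w < 0 & tr w ^+ 2 + ti w ^+ 2 = 1 /\ zr w = 1]).
Proof.
rewrite /cell /cell_pair -/(zr w) -/(zi w) -/(tr w) -/(ti w).
have hw := bouquet_coords w.
case: (ltP (zr w) 0) => h0.
  have h' : zr w ^+ 2 + zi w ^+ 2 = 1 /\ tr w = 1.
    by case: hw => -[e1 [e2 e3]]; [split|lra].
  right; left; rewrite /cellR h0; case: (leP 0 (zi w)) => hi; first by left.
  by right.
rewrite /cellR; case: (leP 0 (tr w)) => ht; first by left.
have h' : tr w ^+ 2 + ti w ^+ 2 = 1 /\ zr w = 1.
  by case: hw => -[e1 [e2 e3]]; [lra|split].
by right; right; case: (leP 0 (ti w)) => hi; [left|right].
Qed.

Lemma cell_lt5 w : (cell w < 5)%N.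
Proof. by case: (cell_cases w) => [[-> _]|[[[-> _]|[-> _]]|[[-> _]|[-> _]]]]. Qed.

Lemma near_refl d x : 0 < d -> near_pt d x x.
Proof. by move=> d0; split; rewrite subrr normr0. Qed.

Lemma near_sym d x y : near_pt d x y -> near_pt d y x.
Proof. by case=> *; split; rewrite distrC. Qed.

Lemma near_cells x y : near_pt (1/2) x y ->
  ~~ ((cell x \in [:: 1; 2]%N) && (cell y \in [:: 3; 4]%N)).
Proof.
move=> [_ _ ht _]; move: ht; rewrite ltr_norml => /andP[h1 h2].
apply/negP => /andP[]; rewrite !inE.
case: (cell_cases x) => [[-> _]//|[hx|[[-> _]//|[-> _]//]]].
case: (cell_cases y) => [[-> _]//|[[[-> _]//|[-> _]//]|hy]].
move=> _ _; have tx : tr x = 1 by case: hx => [[_ [_ _ [_ ?]]]|[_ [_ _ [_ ?]]]].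
by have ty : tr y < 0 by [case: hy => [[_ [? _ _]]|[_ [? _ _]]]]; lra.
Qed.

(** With [near_cells], this says that at scale 1/2 the nerve of the cells consists of two hollow
    triangles, 0 1 2 and 0 3 4, one for each loop; not filling them leaves room for monodromy. The
    reason: a point of an upper cell close to cell 0 has imaginary part above 1/2, too far from the
    lower cell. *)
Lemma near3_cells x y w : near_pt (1/2) x y -> near_pt (1/2) x w -> near_pt (1/2) y w ->
  let s := [:: cell x; cell y; cell w] in is_true (
  ~~ ((0%N \in s) && (((1%N \in s) && (2%N \in s)) || ((3%N \in s) && (4%N \in s))))).
Proof.
move=> xy xw yw s; have half : 0 < 1/2 :> R by lra.
have nn u v : u \in [:: x; y; w] -> v \in [:: x; y; w] -> near_pt (1/2) u v.
  rewrite !inE => /or3P[]/eqP-> /or3P[]/eqP->;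
  by [exact: near_refl|exact: near_sym|].
have sE : s = map cell [:: x; y; w] by [].
apply/negP; rewrite sE => /andP[/mapP[u us u0] /orP[]/andP[/mapP[v vs v0] /mapP[z zs z0]]].
all: have [a1 a2 a3 a4] := nn _ _ us vs; have [b1 b2 b3 b4] := nn _ _ us zs; have [c1 c2 c3 c4] := nn _ _ vs zs.
all: move: a1 a2 a3 a4 b1 b2 b3 b4 c1 c2 c3 c4; rewrite !ltr_norml.
all: move=> /andP[a1 a1'] /andP[a2 a2'] /andP[a3 a3'] /andP[a4 a4'].
all: move=> /andP[b1 b1'] /andP[b2 b2'] /andP[b3 b3'] /andP[b4 b4'].
all: move=> /andP[c1 c1'] /andP[c2 c2'] /andP[c3 c3'] /andP[c4 c4'].
all: case: (cell_cases u) => [[_ [hu hu']]|[[[e _]|[e _]]|[[e _]|[e _]]]]; try by rewrite e in u0.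
  case: (cell_cases v) => [[e _]|[[[_ [h1 h2 [h3 _]]]|[e _]]|[[e _]|[e _]]]]; try by rewrite e in v0.
  case: (cell_cases z) => [[e _]|[[[e _]|[_ [g1 g2 [g3 _]]]]|[[e _]|[e _]]]]; try by rewrite e in z0.
  have v2 : zr v ^+ 2 < 1/4 by move: h1 hu a1 a1' hu'; clear; nra.
  have {}v2 : 1/2 < zi v by move: v2 h2 h3; clear; nra.
  by move: v2 g2 c2'; clear; lra.
case: (cell_cases v) => [[e _]|[[[e _]|[e _]]|[[_ [h1 h2 [h3 _]]]|[e _]]]]; try by rewrite e in v0.
case: (cell_cases z) => [[e _]|[[[e _]|[e _]]|[[e _]|[_ [g1 g2 [g3 _]]]]]]; try by rewrite e in z0.
have v2 : tr v ^+ 2 < 1/4 by move: h1 hu a3 a3' hu'; clear; nra.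
  have {}v2 : 1/2 < ti v by move: v2 h2 h3; clear; nra.
  by move: v2 g2 c4'; clear; lra.
Qed.

Section cocycle.
Context {G : groupType}.
Local Open Scope group_scope.
Implicit Types a b : G.

(* The transition from cell to cell of the locally constant sheaf whose monodromy along
   the two loops is [a] and [b]. *)
Definition trans a b (m n : nat) : G :=
  match m, n with
  | 1, 2 => a | 2, 1 => a^-1 | 3, 4 => b | 4, 3 => b^-1 | _, _ => 1
  end.

Definition coc a b (x y : B) : G := trans a b (cell x) (cell y).

Lemma trans_refl a b m : trans a b m m = 1.
Proof. by case: m => [|[|[|[|[|m]]]]]. Qed.

Lemma coc_trans a b x y w :
  near_pt (1/2)%R x y -> near_pt (1/2)%R x w -> near_pt (1/2)%R y w ->
  coc a b x y * coc a b y w = coc a b x w.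
Proof.
move=> xy xw yw; have := near3_cells xy xw yw; rewrite /coc.
have := near_cells xy; have := near_cells (near_sym xy).
have := near_cells xw; have := near_cells (near_sym xw).
have := near_cells yw; have := near_cells (near_sym yw).
move: (cell x) (cell y) (cell w) (cell_lt5 x) (cell_lt5 y) (cell_lt5 w).
by case=> [|[|[|[|[|?]]]]] [|[|[|[|[|?]]]]] [|[|[|[|[|?]]]]] //= *; rewrite /trans ?mulg1 ?mul1g ?mulgV ?mulVg.
Qed.

End cocycle.

(** Closed octants, counted counterclockwise. On the circle they are separated alternately by the
    points with z^4 = 1, on the axes, and those with z^4 = -1, on the diagonals. *)
Definition in_oct (k : nat) (p q : R) : Prop :=
  match k with
  | 0 => 0 <= q /\ q <= p | 1 => 0 <= p /\ p <= q
  | 2 => p <= 0 /\ - p <= q | 3 => 0 <= q /\ q <= - p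
  | 4 => q <= 0 /\ p <= q | 5 => p <= 0 /\ q <= p
  | 6 => 0 <= p /\ p <= - q | 7 => q <= 0 /\ - q <= p
  | _ => False
  end.

(* The octants are closed on the sides which are mapped by [bouquet_map] to the side
   [0 <= Im] of the far point of a loop, so that the cell of the image is constant. *)
Definition octa (p q : R) : nat :=
  if 0 <= p then
    if 0 <= q then if q <= p then 0 else 1 else if - q <= p then 7 else 6
  else
    if 0 <= q then if - p <= q then 2 else 3 else if p < q then 4 else 5.

Definition octb (r s : R) : nat :=
  if 0 <= r then
    if 0 <= s then if s < r then 0 else 1 else if s <= - r then 6 else 7
  else
    if 0 <= s then if - r < s then 2 else 3 else if r <= s then 4 else 5.

Lemma in_octa p q : in_oct (octa p q) p q.
Proof.
rewrite /octa; case: (leP 0 p) => p0; case: (leP 0 q) => q0;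
  case: ifPn; rewrite -?leNgt -?ltNge => h /=; lra.
Qed.

Lemma in_octb p q : in_oct (octb p q) p q.
Proof.
rewrite /octb; case: (leP 0 p) => p0; case: (leP 0 q) => q0;
  case: ifPn; rewrite -?leNgt -?ltNge => h /=; lra.
Qed.

(** On the circle Re(z^4) = 1 - 8 p^2 q^2, so this says that the fourth power lies in the far half
    of its loop. *)
Definition far (p q : R) : bool := 1 < 8 * (p ^+ 2 * q ^+ 2).

(** The constant 1/50 is twice the 1/100 allowed in [near_oct]: if two such points lie on opposite
    sides of a diagonal, then [p - q] or [p + q] is bounded by 1/50 at both of them. *)
Lemma far_diag (p q : R) : p ^+ 2 + q ^+ 2 = 1 ->
  `|p - q| <= 1/50 \/ `|p + q| <= 1/50 -> far p q.
Proof.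
move=> c h; rewrite /far.
have E : 8 * (p ^+ 2 * q ^+ 2) = 2 * (p * q *+ 2) ^+ 2 by ring.
rewrite E; case: h; rewrite ler_norml => /andP[h1 h2].
  have s : (p - q) ^+ 2 <= 1/100 by move: h1 h2; move: (p - q) => d; clear; nra.
  have {}s : 99/100 <= p * q *+ 2.
    by rewrite (_ : p * q *+ 2 = (p ^+ 2 + q ^+ 2) - (p - q) ^+ 2); [lra|ring].
  by move: s; move: (p * q *+ 2) => d; clear; nra.
have s : (p + q) ^+ 2 <= 1/100 by move: h1 h2; move: (p + q) => d; clear; nra.
have {}s : p * q *+ 2 <= - (99/100).
  by rewrite (_ : p * q *+ 2 = (p + q) ^+ 2 - (p ^+ 2 + q ^+ 2)); [lra|ring].
by move: s; move: (p * q *+ 2) => d; clear; nra.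
Qed.

Lemma far_axis (p q : R) : p ^+ 2 + q ^+ 2 = 1 ->
  `|p| <= 1/50 \/ `|q| <= 1/50 -> far p q = false.
Proof.
move=> c h; rewrite /far; apply/negbTE; rewrite -leNgt.
have [p0 q0] : 0 <= p ^+ 2 /\ 0 <= q ^+ 2 by rewrite !sqr_ge0.
case: h; rewrite ler_norml => /andP[h1 h2].
  have s : p ^+ 2 <= 1/100 by move: h1 h2; clear; nra.
  by move: s p0 q0 c; move: (p ^+ 2) (q ^+ 2) => a b; clear; nra.
have s : q ^+ 2 <= 1/100 by move: h1 h2; clear; nra.
by move: s p0 q0 c; move: (p ^+ 2) (q ^+ 2) => a b; clear; nra.
Qed.

Lemma in_oct_large k (p q : R) : p ^+ 2 + q ^+ 2 = 1 -> in_oct k p q ->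
  match k with
  | 0 | 7 => 7/10 <= p | 1 | 2 => 7/10 <= q | 3 | 4 => p <= - (7/10)
  | _ => q <= - (7/10)
  end.
Proof. by move=> c; case: k => [|[|[|[|[|[|[|[|k]]]]]]]] //= [h1 h2]; nra. Qed.

(** Groups the octants as 7 0, 1 2, 3 4, 5 6, which meet on an axis, where z^4 = 1; equality of
    [k./2] is the grouping along the diagonals. *)
Definition oct_adj (k k' : nat) : bool := (k.+1 %% 8)./2 == (k'.+1 %% 8)./2.

Lemma near_oct k k' (p q p' q' : R) :
  p ^+ 2 + q ^+ 2 = 1 -> p' ^+ 2 + q' ^+ 2 = 1 ->
  in_oct k p q -> in_oct k' p' q' -> `|p - p'| < 1/100 -> `|q - q'| < 1/100 ->
  k = k' \/ (k./2 = k'./2 /\ far p q && far p' q') \/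
  (oct_adj k k' /\ ~~ (far p q || far p' q')).
Proof.
move=> c c' h h'; rewrite !ltr_norml => /andP[p1 p2] /andP[q1 q2].
have D : `|p - q| <= 1/50 \/ `|p + q| <= 1/50 -> `|p' - q'| <= 1/50 \/ `|p' + q'| <= 1/50 ->
    far p q && far p' q'.
  by move=> d d'; rewrite !far_diag.
have A : `|p| <= 1/50 \/ `|q| <= 1/50 -> `|p'| <= 1/50 \/ `|q'| <= 1/50 ->
    ~~ (far p q || far p' q').
  by move=> d d'; rewrite !far_axis.
have l := in_oct_large c h; have l' := in_oct_large c' h'.
move: l l' h h'; clear c c'.
case: k => [|[|[|[|[|[|[|[|k]]]]]]]] l; case: k' => [|[|[|[|[|[|[|[|k']]]]]]]] l' /= h h'; try (by []);
  try (by left); move: h h' => [h1 h2] [h1' h2'].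
all: try (by exfalso; clear D A; lra).
all: try (by right; left; split=> //; apply: D; [left|left]; clear A; rewrite ler_norml; lra).
all: try (by right; left; split=> //; apply: D; [right|right]; clear A; rewrite ler_norml; lra).
all: try (by right; right; split=> //; apply: A; [left|left]; clear D; rewrite ler_norml; lra).
all: try (by right; right; split=> //; apply: A; [right|right]; clear D; rewrite ler_norml; lra).
Qed.

End cells.

(** * Octants, their images, and the pullback of the cocycle *)

Section image_octants.
Context {R : realType}.
Local Notation C := R[i].
Local Notation B := (bouquet_space R).

Lemma cell_pair_l (z : C) : cell_pair (z, 1) = cellR 1 2 (complex.Re z) (complex.Im z).
Proof. by rewrite /cell_pair /cellR /= ltr10; case: (complex.Re z < 0). Qed.

Lemma cell_pair_r (t : C) : cell_pair (1, t) = cellR 3 4 (complex.Re t) (complex.Im t).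
Proof. by rewrite /cell_pair /= ltr10. Qed.

Lemma pow4E (z : C) : circle z -> let p := complex.Re z in let q := complex.Im z in
  [/\ complex.Re (z ^+ 4) = 1 - 8 * (p ^+ 2 * q ^+ 2),
      complex.Im (z ^+ 4) = 4 * (p * q) * ((p - q) * (p + q)),
      complex.Re (z ^- 4) = 1 - 8 * (p ^+ 2 * q ^+ 2)
    & complex.Im (z ^- 4) = - (4 * (p * q) * ((p - q) * (p + q)))].
Proof.
move=> cz; rewrite (circle_conj (circleX 4 cz)); have /= := circleE cz.
case: z {cz} => p q h.
have E : (p +i* q)%C ^+ 4 =
  (((p ^+ 2 - q ^+ 2) ^+ 2 - 4 * (p * q) ^+ 2) +i* (4 * (p * q) * ((p - q) * (p + q))))%C.
  by apply/eqP; rewrite eq_complex !exprS expr0; simpc; apply/andP; split; apply/eqP => /=; ring.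
have F : (p ^+ 2 - q ^+ 2) ^+ 2 - 4 * (p * q) ^+ 2 = 1 - 8 * (p ^+ 2 * q ^+ 2).
  by transitivity ((p ^+ 2 + q ^+ 2) ^+ 2 - 8 * (p ^+ 2 * q ^+ 2)); [ring|rewrite h expr1n].
by rewrite E F.
Qed.

Lemma cellR_far m n (p q s : R) :
  cellR m n (1 - 8 * (p ^+ 2 * q ^+ 2)) s =
  if far p q then if 0 <= s then m else n else 0%N.
Proof. by rewrite /cellR /far subr_lt0. Qed.

Lemma far_neq0 (p q : R) : far p q -> p != 0 /\ q != 0.
Proof.
rewrite /far => h; split; apply/eqP => z; move: h.
  by rewrite z expr0n /= mul0r mulr0 ltr10.
by rewrite z expr0n /= mulr0 mulr0 ltr10.
Qed.

(** The expression is Im(z^4), by [pow4E]; its sign chooses between the upper and the lower cell of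
    the image. *)
Lemma quartic_sign (p q : R) : let s := 4 * (p * q) * ((p - q) * (p + q)) in
  [/\ 0 < p -> 0 < q -> (0 <= s) = (q <= p) /\ (0 <= - s) = (p <= q),
      0 < p -> q < 0 -> (0 <= s) = (p <= - q) /\ (0 <= - s) = (- q <= p),
      p < 0 -> 0 < q -> (0 <= s) = (- p <= q) /\ (0 <= - s) = (q <= - p)
    & p < 0 -> q < 0 -> (0 <= s) = (p <= q) /\ (0 <= - s) = (q <= p)].
Proof.
have P (u v : R) : 0 < u -> (0 <= 4 * u * v) = (0 <= v) /\ (0 <= - (4 * u * v)) = (v <= 0).
  by move=> u0; rewrite oppr_ge0 pmulr_rge0 ?pmulr_rle0 ?mulr_gt0.
have N (u v : R) : u < 0 -> (0 <= 4 * u * v) = (v <= 0) /\ (0 <= - (4 * u * v)) = (0 <= v).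
  by move=> u0; have := P (- u) v; rewrite oppr_gt0 mulrN mulNr opprK => /(_ u0)[].
move=> s; split=> p0 q0.
- have [|-> ->] := P (p * q) ((p - q) * (p + q)); first by rewrite mulr_gt0.
  by split; apply/idP/idP; nra.
- have [|-> ->] := N (p * q) ((p - q) * (p + q)); first by rewrite pmulr_rlt0.
  by split; apply/idP/idP; nra.
- have [|-> ->] := N (p * q) ((p - q) * (p + q)); first by rewrite nmulr_rlt0.
  by split; apply/idP/idP; nra.
- have [|-> ->] := P (p * q) ((p - q) * (p + q)); first by rewrite nmulr_rgt0.
  by split; apply/idP/idP; nra.
Qed.

Definition oct (w : B) : nat :=
  if (set_val w).2 == 1 then octa (zr w) (zi w) else (8 + octb (tr w) (ti w))%N.

Definition wfar (w : B) : bool :=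
  if (set_val w).2 == 1 then far (zr w) (zi w) else far (tr w) (ti w).

(** Tables over the sixteen octants, eight on each loop: the cell containing the octant and, in
    [image_cells], the cell of the image of those of its points whose image is in a far half. *)
Definition oct_cells : seq nat := [:: 0; 0; 1; 1; 2; 2; 0; 0; 0; 0; 3; 3; 4; 4; 0; 0]%N.
Definition image_cells : seq nat := [:: 1; 2; 3; 4; 2; 1; 4; 3; 2; 1; 4; 3; 1; 2; 3; 4]%N.

Lemma cell_oct w : cell w = nth 0%N oct_cells (oct w).
Proof.
rewrite /cell /oct; case: eqP => [w2|/eqP w2].
  rewrite [set_val w]surjective_pairing w2 cell_pair_l -/(zr w) -/(zi w) /cellR /octa.
  by case: (ltP (zr w) 0) => h; case: (leP 0 (zi w)) => h'; case: ifP.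
have w1 : (set_val w).1 = 1.
  by case: (set_valP w) => -[] // _ e; rewrite e eqxx in w2.
rewrite [set_val w]surjective_pairing w1 cell_pair_r -/(tr w) -/(ti w) /cellR /octb.
by case: (ltP (tr w) 0) => h; case: (leP 0 (ti w)) => h'; case: ifP.
Qed.

Lemma cell_image_l (z : C) : circle z ->
  let p := complex.Re z in let q := complex.Im z in
  cell_pair (bouquet_map (z, 1)) = if far p q then nth 0%N image_cells (octa p q) else 0%N.
Proof.
move=> cz; have [l1 l2 l3 l4] := bouquet_map_l cz; have [r i r' i'] := pow4E cz.
move: l1 l2 l3 l4 r i r' i'; set p := complex.Re z; set q := complex.Im z.
move=> l1 l2 l3 l4 r i r' i'; rewrite /octa.
case: (leP 0 p) => p0; case: (leP 0 q) => q0;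
  [rewrite l1// | rewrite l4 ?(ltW q0)// | rewrite l2 ?(ltW p0)// | rewrite l3 ?(ltW p0) ?(ltW q0)//];
  rewrite ?cell_pair_l ?cell_pair_r ?r ?r' ?i ?i' cellR_far; case: ifP => // /far_neq0[pn qn].
all: have [s1 s2 s3 s4] := quartic_sign p q.
- by have [] := s1; rewrite ?[0 < p]lt_def ?[0 < q]lt_def ?pn ?qn// => E1 E2; rewrite ?E1 ?E2; case: leP.
- by have [] := s2; rewrite ?[0 < p]lt_def ?pn// => E1 E2; rewrite ?E1 ?E2; case: leP.
- by have [] := s3; rewrite ?[0 < q]lt_def ?qn// => E1 E2; rewrite ?E1 ?E2; case: leP.
- by have [] := s4 => // E1 E2; rewrite ?E1 ?E2; case: leP.
Qed.
Lemma cell_image_r (z : C) : circle z ->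
  let p := complex.Re z in let q := complex.Im z in
  cell_pair (bouquet_map (1, z)) = if far p q then nth 0%N image_cells (8 + octb p q) else 0%N.
Proof.
move=> cz; have [l1 l2 l3 l4] := bouquet_map_r cz; have [r i r' i'] := pow4E cz.
move: l1 l2 l3 l4 r i r' i'; set p := complex.Re z; set q := complex.Im z.
move=> l1 l2 l3 l4 r i r' i'; rewrite /octb.
case: (leP 0 p) => p0; case: (leP 0 q) => q0;
  [rewrite l1// | rewrite l4 ?(ltW q0)// | rewrite l2 ?(ltW p0)// | rewrite l3 ?(ltW p0) ?(ltW q0)//];
  rewrite ?cell_pair_l ?cell_pair_r ?r ?r' ?i ?i' cellR_far; case: ifP => // /far_neq0[pn qn].
all: have [s1 s2 s3 s4] := quartic_sign p q.
- by have [] := s1; rewrite ?[0 < p]lt_def ?[0 < q]lt_def ?pn ?qn// => E1 E2; rewrite ?E1 ?E2; case: ltP.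
- by have [] := s2; rewrite ?[0 < p]lt_def ?pn// => E1 E2; rewrite ?E1 ?E2 lerNr; case: leP.
- by have [] := s3; rewrite ?[0 < q]lt_def ?qn// => E1 E2; rewrite ?E1 ?E2; case: ltP.
- by have [] := s4 => // E1 E2; rewrite ?E1 ?E2; case: leP.
Qed.

Lemma cell_image w :
  cell (bouquet_gmap R w) = if wfar w then nth 0%N image_cells (oct w) else 0%N.
Proof.
rewrite /wfar /oct; case: (set_valP w) => -[] h1 h2.
  have e : (set_val w).2 = 1 := h2.
  rewrite e eqxx -(cell_image_l h1) /cell -[in RHS]e -surjective_pairing.
  by [].
have e : (set_val w).1 = 1 := h1; case: eqP => [e2|e2].
  rewrite -cell_image_l ?e; last exact: circle1.
  by rewrite -[LHS]/(cell_pair (bouquet_map (set_val w))) [set_val w]surjective_pairing e e2.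
by rewrite -(cell_image_r h2) /cell -[in RHS]e -surjective_pairing.
Qed.

(* The union of octants around a preimage of the base point. *)
Definition region (k : nat) : nat :=
  let r := ((k %% 8).+1 %% 8)./2 in if r == 0%N then 0%N else (r + k %/ 8 * 4)%N.

Lemma octa_lt8 (p q : R) : (octa p q < 8)%N.
Proof. by rewrite /octa; do 3 case: ifP => _. Qed.

Lemma octb_lt8 (p q : R) : (octb p q < 8)%N.
Proof. by rewrite /octb; do 3 case: ifP => _. Qed.

Lemma oct_lt16 w : (oct w < 16)%N.
Proof.
by rewrite /oct; case: ifP => _; [apply: ltn_trans (octa_lt8 _ _) _|exact: octb_lt8].
Qed.

(** On a single loop this is [near_oct]. Nearby points on different loops are both close to the base
    point, in octant 0 or 7 of their loop, and these four octants form the region 0. *)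
Lemma near_bouquet x y : near_pt (1/100) x y ->
  oct x = oct y \/ ((oct x)./2 = (oct y)./2 /\ wfar x && wfar y) \/
  (region (oct x) = region (oct y) /\ ~~ (wfar x || wfar y)).
Proof.
have coords (w : B) : if (set_val w).2 == 1 then
    [/\ zr w ^+ 2 + zi w ^+ 2 = 1, tr w = 1 & ti w = 0]
  else [/\ tr w ^+ 2 + ti w ^+ 2 = 1, zr w = 1 & zi w = 0].
  rewrite /zr /zi /tr /ti; case: (set_valP w) => -[h1 h2].
    by rewrite (h2 : (set_val w).2 = 1) eqxx; split=> //; exact: circleE.
  case: eqP => e; first by rewrite e (h1 : (set_val w).1 = 1) /= expr1n expr0n addr0.
  by rewrite (h1 : (set_val w).1 = 1); split=> //; exact: circleE.
have base k (p q : R) : p ^+ 2 + q ^+ 2 = 1 -> in_oct k p q -> (k < 8)%N ->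
    `|p - 1| < 1/100 -> `|q| < 1/100 -> (k = 0 \/ k = 7)%N /\ far p q = false.
  move=> c h k8 hp hq.
  split; last by apply: far_axis => //; right; apply: ltW (lt_trans hq _); lra.
  have c1 : (1 : R) ^+ 2 + 0 ^+ 2 = 1 by rewrite expr1n expr0n addr0.
  have h0 : in_oct 0 (1 : R) 0 by split.
  have := near_oct c c1 h h0; rewrite subr0 => /(_ hp hq).
  have -> : far (1 : R) 0 = false by rewrite /far expr0n /= !mulr0 ltr10.
  rewrite andbF; move: k8; clear; rewrite /oct_adj.
  by case: k => [|[|[|[|[|[|[|[|k]]]]]]]] // _ [//|[[]//|[]//]]; auto.
have same m k k' (f f' : bool) : (k < 8)%N -> (k' < 8)%N -> m = 0%N \/ m = 8%N ->
    k = k' \/ (k./2 = k'./2 /\ f && f') \/ (oct_adj k k' /\ ~~ (f || f')) ->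
    (m + k = m + k')%N \/ ((m + k)./2 = (m + k')./2 /\ f && f') \/
    (region (m + k) = region (m + k') /\ ~~ (f || f')).
  move=> k8 k8' m8 [->|[[h ff]|[h ff]]]; [by left|right; left|right; right]; split=> //.
    by case: m8 => ->; rewrite ?halfD /= h.
  move: k8 k8' h; rewrite /oct_adj; case: m8 => ->; clear.
    by case: k => [|[|[|[|[|[|[|[|k]]]]]]]] //; case: k' => [|[|[|[|[|[|[|[|k']]]]]]]].
  by case: k => [|[|[|[|[|[|[|[|k]]]]]]]] //; case: k' => [|[|[|[|[|[|[|[|k']]]]]]]].
move=> [n1 n2 n3 n4]; have := coords x; have := coords y; rewrite /oct /wfar.
case: ifPn => y2; case: ifPn => x2 [cy e1 e2] [cx e3 e4].
- by apply: (@same 0%N); [exact: octa_lt8|exact: octa_lt8|left|apply: near_oct => //; exact: in_octa].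
- rewrite e3 distrC e4 sub0r normrN in n1 n2; rewrite e1 e2 subr0 in n3 n4.
  have [k1 ->] := base _ _ _ cx (in_octb _ _) (octb_lt8 _ _) n3 n4.
  have [k2 ->] := base _ _ _ cy (in_octa _ _) (octa_lt8 _ _) n1 n2.
  right; right; split=> //.
  by case: k1 => ->; case: k2 => ->.
- rewrite e4 e3 distrC sub0r normrN in n3 n4; rewrite e1 e2 subr0 in n1 n2.
  have [k1 ->] := base _ _ _ cx (in_octa _ _) (octa_lt8 _ _) n1 n2.
  have [k2 ->] := base _ _ _ cy (in_octb _ _) (octb_lt8 _ _) n3 n4.
  right; right; split=> //.
  by case: k1 => ->; case: k2 => ->.
- by apply: (@same 8%N); [exact: octb_lt8|exact: octb_lt8|right|apply: near_oct => //; exact: in_octb].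
Qed.

Section pullback.
Context {G : groupType}.
Local Open Scope group_scope.
Implicit Types a b : G.

(* Trivializes the pullback: the holonomy of [bouquet_map] along the arc of the loop from
   the base point to the given octant. *)
Definition gauge a b : seq G :=
  [:: 1; a; a; a * b; b * a; b; b; 1;
      1; a^-1; a^-1; a^-1 * b^-1; b^-1 * a^-1; b^-1; b^-1; 1].

(** After [near_bouquet] the identity is a finite table. Across a diagonal the image passes from one
    far cell to the other, and the gauge jumps by [a], [b] or an inverse. Across an axis the image
    stays in cell 0 and the gauge is constant, except opposite the base point: on the first loop it
    passes there from [a * b] to [b * a], which accounts for the commutator. *)
Theorem coc_pullback a b (x y : B) : near_pt (1/100)%R x y ->
  coc a b (bouquet_gmap R x) (bouquet_gmap R y) =
  (nth 1 (gauge a b) (oct x))^-1 * coc (comm2 a b) (comm2 a^-1 b^-1) x y *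
  nth 1 (gauge a b) (oct y).
Proof.
move=> /near_bouquet; rewrite /coc !cell_image !cell_oct.
move: (oct x) (oct y) (oct_lt16 x) (oct_lt16 y) (wfar x) (wfar y) => k k' k16 k16' f f'.
case=> [<-|[[h /andP[-> ->]]|[h]]].
- rewrite trans_refl mulg1 mulVg.
  by case: f; case: f'; rewrite ?trans_refl //=; case: (nth _ _ _) => [|[|[|[|[|]]]]].
- move: k16 k16' h.
  do 16 (case: k => [|k]; first by do 16 (case: k' => [|k']; first by
    rewrite //= ?(invgM, invgK, invg1, mulgA, mulg1, mul1g, mulgK, mulgVK, mulgV, mulVg))).
  by [].
rewrite negb_or => /andP[/negbTE-> /negbTE->]; move: k16 k16' h.
rewrite /trans.
do 16 (case: k => [|k]; first by do 16 (case: k' => [|k']; first by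
    rewrite //= /comm2 ?(invgM, invgK, invg1, mulgA, mulg1, mul1g, mulgK, mulgVK, mulgV, mulVg))).
by [].
Qed.

End pullback.
End image_octants.

(** * Holonomy along chains and its invariance under small moves *)

Section holonomy.
Context {G : groupType}.
Local Open Scope group_scope.

Fixpoint gprod (c : nat -> G) (n : nat) : G :=
  if n is m.+1 then gprod c m * c m else 1.

Lemma gprod_gauge (c c' t : nat -> G) n :
  (forall i, (i < n)%N -> c i = (t i)^-1 * c' i * t i.+1) ->
  gprod c n = (t 0%N)^-1 * gprod c' n * t n.
Proof.
elim: n => [|n IHn] h /=; first by rewrite mulg1 mulVg.
by rewrite IHn => [|i /ltnW]; [rewrite h// !mulgA mulgK|exact: h].
Qed.

Definition conjugate (x y : G) : Prop := exists u, x = u^-1 * y * u.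

Lemma conjugate_refl x : conjugate x x.
Proof. by exists 1; rewrite invg1 mul1g mulg1. Qed.

Lemma conjugate_trans x y z : conjugate x y -> conjugate y z -> conjugate x z.
Proof. by move=> [u ->] [v ->]; exists (v * u); rewrite invgM !mulgA. Qed.

Lemma conjugate_sym x y : conjugate x y -> conjugate y x.
Proof. by move=> [u ->]; exists u^-1; rewrite invgK !mulgA mulgV mul1g mulgK. Qed.

Context {R : realType}.
Local Notation B := (bouquet_space R).

Definition hol (p : G * G) (x : nat -> B) (N : nat) : G :=
  gprod (fun i => coc p.1 p.2 (x i) (x i.+1)) N.

Definition chain (d : R) (N : nat) (x : nat -> B) : Prop :=
  forall i, (i < N)%N -> near_pt d (x i) (x i.+1).

Lemma hol_image p x N : chain (1/100)%R N x -> x N = x 0%N ->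
  conjugate (hol p (fun i => bouquet_gmap R (x i)) N) (hol (comm_step p) x N).
Proof.
move=> cx xN; exists (nth 1 (gauge p.1 p.2) (oct (x 0%N))); rewrite -{2}xN.
by apply: (@gprod_gauge _ _ (fun i => nth 1 (gauge p.1 p.2) (oct (x i)))) => i /cx; exact: coc_pullback.
Qed.

Lemma hol_iter k p x N :
  (forall j, (j < k)%N -> chain (1/100)%R N (fun i => iter j (bouquet_gmap R) (x i))) ->
  x N = x 0%N ->
  conjugate (hol p (fun i => iter k (bouquet_gmap R) (x i)) N) (hol (comm_pair p k) x N).
Proof.
move=> + xN; elim: k p => [|k IHk] p cx; first exact: conjugate_refl.
rewrite /comm_pair iterSr.
apply: (conjugate_trans (hol_image p (cx k (ltnSn k)) _)); first by rewrite xN.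
by apply: IHk => j jk; apply: cx; exact: ltnW.
Qed.

Lemma near_trans d e (x y z : B) : near_pt d x y -> near_pt e y z -> near_pt (d + e)%R x z.
Proof.
move=> [a1 a2 a3 a4] [b1 b2 b3 b4].
by split; [apply: le_lt_trans (ltrD a1 b1)|apply: le_lt_trans (ltrD a2 b2)
  |apply: le_lt_trans (ltrD a3 b3)|apply: le_lt_trans (ltrD a4 b4)]; exact: ler_distD.
Qed.

Lemma near_weak d e (x y : B) : (d <= e)%R -> near_pt d x y -> near_pt e x y.
Proof. by move=> de [? ? ? ?]; split; exact: lt_le_trans de. Qed.

(** The gauge is the cocycle between corresponding points of the two chains. The diagonals of the
    small squares stay below 1/4 + 1/4 = 1/2, the range of the cocycle relation. *)
Lemma hol_close p N (x y : nat -> B) :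
  chain (1/4)%R N x -> chain (1/4)%R N y ->
  (forall i, (i <= N)%N -> near_pt (1/4)%R (x i) (y i)) ->
  x N = x 0%N -> y N = y 0%N -> conjugate (hol p x N) (hol p y N).
Proof.
move=> cx cy xy xN yN.
have w14 : (1/4 <= 1/2 :> R)%R by lra.
have D (u v w : B) : near_pt (1/4)%R u v -> near_pt (1/4)%R v w -> near_pt (1/2)%R u w.
  by move=> uv vw; have := near_trans uv vw; apply: near_weak; lra.
exists (coc p.1 p.2 (y 0%N) (x 0%N)).
have tN : coc p.1 p.2 (y N) (x N) = coc p.1 p.2 (y 0%N) (x 0%N) by rewrite xN yN.
rewrite -{2}tN; apply: (@gprod_gauge _ _ (fun i => coc p.1 p.2 (y i) (x i))) => i iN.
have xy0 := near_sym (xy i (ltnW iN)); have xy1 := near_sym (xy i.+1 iN).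
have W (u v : B) : near_pt (1/4)%R u v -> near_pt (1/2)%R u v by apply: near_weak; lra.
have yx := D _ _ _ xy0 (cx i iN).
apply: (mulgI (coc p.1 p.2 (y i) (x i))); rewrite !mulgA mulgV mul1g.
rewrite coc_trans ?coc_trans//; try exact: W.
- exact: W (cy i iN).
- exact: W (cx i iN).
Qed.

Lemma hol_homotopy p N S (Y : nat -> nat -> B) :
  (forall s, (s <= S)%N -> chain (1/4)%R N (Y s)) ->
  (forall s i, (s < S)%N -> (i <= N)%N -> near_pt (1/4)%R (Y s i) (Y s.+1 i)) ->
  (forall s, Y s N = Y s 0%N) ->
  conjugate (hol p (Y 0%N) N) (hol p (Y S) N).
Proof.
move=> cY nY YN; elim: S cY nY => [|S IHS] cY nY; first exact: conjugate_refl.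
apply: (@conjugate_trans _ (hol p (Y S) N)).
  by apply: IHS => [s sS|s i sS iN]; [apply: cY; exact: leqW|apply: nY => //; exact: leqW].
apply: hol_close => // [||i iN]; [exact: cY|exact: cY|exact: nY].
Qed.

Definition normal_pred (Q : G -> Prop) : Prop :=
  [/\ Q 1, forall x y, Q x -> Q y -> Q (x * y), forall x, Q x -> Q x^-1
    & forall u x, Q x -> Q (u * x * u^-1)].

Lemma conjugate_normal Q x y : normal_pred Q -> conjugate x y -> Q y -> Q x.
Proof. by move=> [_ _ _ QJ] [u ->] /(QJ u^-1); rewrite invgK. Qed.

Lemma hol_normal Q p x N : normal_pred Q -> Q p.1 -> Q p.2 -> Q (hol p x N).
Proof.
move=> [Q1 QM QV _] q1 q2; elim: N => [|N IHN] //=; apply: QM => //.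
rewrite /coc; move: (cell _) (cell _) => m n.
by case: m => [|[|[|[|[|m]]]]] //; case: n => [|[|[|[|[|n]]]]] //=; exact: QV.
Qed.

Definition standard_loop (N i : nat) : B := loop_a (2 * pi * (i%:R / N%:R))%R.

Lemma standard_loop_closed N : (0 < N)%N -> standard_loop N N = standard_loop N 0.
Proof.
move=> N0; rewrite /standard_loop mul0r mulr0 divff ?pnatr_eq0 -?lt0n// mulr1.
by apply: val_inj; rewrite /= /cis (_ : 2 * pi = pi *+ 2)%R ?cos2pi ?sin2pi ?cos0 ?sin0// mulr_natl.
Qed.

(** The only crossing that counts is the one from cell 1 to cell 2 at half a turn, and a gauge that
    switches there from 1 to [p.1] absorbs it. With at least eight steps both ends of this crossing
    lie in the far half. *)
Lemma hol_standard_loop p N : (8 <= N)%N -> hol p (standard_loop N) N = p.1.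
Proof.
move=> N8; have pi0 := @pi_gt0 R.
have N0 : (0 < N%:R :> R)%R by rewrite ltr0n; exact: leq_trans N8.
pose th i : R := (2 * pi * (i%:R / N%:R))%R.
have q0 i : (0 <= i%:R / N%:R :> R)%R by rewrite divr_ge0.
have cosE i : cos (th i) = (- cos (th i - pi))%R by rewrite -{1}[th i](subrK pi) cosDpi.
have sinE i : sin (th i) = (- sin (th i - pi))%R by rewrite -{1}[th i](subrK pi) sinDpi.
have cE i : cell (standard_loop N i) = cellR 1 2 (cos (th i)) (sin (th i)).
  exact: (@cell_pair_l R (cis (th i))).
have [lo hi lohi] : [/\ forall i, (i.*2 <= N)%N -> (0 <= sin (th i))%R,
    forall i, (N < i.*2)%N -> (i < N)%N -> (sin (th i) < 0)%R
  & forall i, (N < i.*2.+2)%N -> (i.*2 <= N.+2)%N -> (cos (th i) < 0)%R].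
  split=> i.
  - rewrite -(ler_nat R) -muln2 natrM => h; apply: sin_ge0_pi.
    have : (i%:R / N%:R <= 1/2 :> R)%R by rewrite ler_pdivrMr//; lra.
    by have := q0 i; rewrite /th => h1 h2; apply/andP; split; nra.
  - rewrite -(ltr_nat R) -[in X in _ -> X -> _](ltr_nat R) -muln2 natrM => h h'.
    rewrite sinE oppr_lt0; apply: sin_gt0_pi.
    have : (i%:R / N%:R < 1 :> R)%R by rewrite ltr_pdivrMr//; lra.
    have : (1/2 < i%:R / N%:R :> R)%R by rewrite ltr_pdivlMr//; lra.
    by rewrite /th => h1 h2; apply/andP; split; nra.
  - rewrite -(ltr_nat R) -[in X in _ -> X -> _](ler_nat R).
    have : (8 <= N%:R :> R)%R by rewrite ler_nat.
    rewrite -!natr1 -muln2 natrM => h8 h h'.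
    rewrite cosE oppr_lt0; apply: cos_gt0_pihalf.
    have : (i%:R / N%:R < 3/4 :> R)%R by rewrite ltr_pdivrMr//; lra.
    have : (1/4 < i%:R / N%:R :> R)%R by rewrite ltr_pdivlMr//; lra.
    by rewrite /th => h1 h2; apply/andP; split; nra.
rewrite /hol (@gprod_gauge _ (fun=> 1) (fun i => if (i.*2 <= N)%N then 1 else p.1)).
  have -> : (N.*2 <= N)%N = false by apply/negbTE; rewrite -ltnNge -addnn -[X in (X < _)%N]addn0 ltn_add2l; exact: leq_trans N8.
  by rewrite double0 leq0n invg1 mul1g; elim: (N) => [|n IHn] /=; rewrite ?mul1g// mulg1.
move=> i iN; rewrite /coc !cE mulg1 doubleS.
(* [hi] does not reach the closing index; there the chain is back at the base point, in cell 0. *)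
have thN : (cos (th N) < 0)%R = false.
  by rewrite /th divff ?gt_eqF// mulr1 mulr_natl cos2pi ltr10.
case: (leqP i.*2 N) => h; last first.
  have -> : (i.*2.+2 <= N)%N = false by apply/negbTE; rewrite -ltnNge; exact: leqW (leqW h).
  rewrite mulVg /cellR (leNgt 0%R (sin (th i))) (hi _ h iN) /=.
  have [i1N|Ni1] := ltnP i.+1 N.
    rewrite (leNgt 0%R (sin (th i.+1))) hi//; last by rewrite doubleS; exact: leqW (leqW h).
    by case: ifP; case: ifP.
  have -> : i.+1 = N by apply/eqP; rewrite eqn_leq iN Ni1.
  by rewrite thN; case: ifP.
rewrite /cellR (lo _ h); case: (leqP i.*2.+2 N) => h'.
  by rewrite lo// invg1 mulg1; case: ifP; case: ifP.
rewrite lohi//; last exact: leqW (leqW h).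
rewrite lohi ?doubleS//; last exact: leqW (leqW h').
rewrite (leNgt 0%R (sin (th i.+1))) hi ?doubleS//= ?invg1 ?mul1g//.
rewrite ltnNge; apply/negP; rewrite -leq_double doubleS => h2.
have : (N + N <= N + 2)%N by rewrite addnn addn2; apply: leq_trans h2 _.
by rewrite leq_add2l leqNgt (leq_trans _ N8).
Qed.

End holonomy.

(** * Uniform continuity in terms of separating functions *)

Section uniform_continuity.
Context {R : realType}.
Local Notation B := (bouquet_space R).
Local Notation P := (bouquet_limit R).
Local Notation I := (unit_interval R).

(** The sets where some [phi m] with [m <= n] separates by more than 1/(n+1) increase with [n] and
    cover the compact complement of [E], so one of them suffices. This replaces the choice of a
    metric on each space. *)
Lemma separated_entourage (X : topologicalType) (phi : nat -> X -> R) (E : set (X * X)) :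
  compact [set: X] -> (forall n, continuous (phi n)) ->
  (forall x y, (forall n, phi n x = phi n y) -> x = y) ->
  open E -> (forall x, E (x, x)) ->
  exists n, forall x y,
    (forall m, (m <= n)%N -> `|phi m x - phi m y| < n.+1%:R^-1) -> E (x, y).
Proof.
move=> cX cphi sep oE Ex.
pose U m n : set (X * X) := [set p | n.+1%:R^-1 < `|phi m p.1 - phi m p.2|].
have oU m n : open (U m n).
  have c : continuous (fun p : X * X => `|phi m p.1 - phi m p.2|).
    move=> p; apply: (@cvg_norm _ R^o); apply: (@cvgB _ R^o).
      exact: (comp_cont fst_cont (cphi m)).
    exact: (comp_cont snd_cont (cphi m)).
  by apply: (@open_comp (X * X)%type R (fun p => `|phi m p.1 - phi m p.2|) [set x | n.+1%:R^-1 < x]) => [p _|]; [exact: c|exact: open_gt].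
have cE : compact (~` E).
  apply: (@subclosed_compact _ _ [set: X * X]) => //; first exact: open_closedC.
  by rewrite -setXTT; exact: compact_setX.
pose V n : set (X * X) := \bigcup_(m in [set m | (m <= n)%N]) U m n.
have [||D [fD DV ED]] := compact_finite_subcover cE (F := range V).
- by move=> _ [n _ <-]; apply: bigcup_open.
- move=> [x y] nE.
  have [m xy] : exists m, phi m x != phi m y.
    apply: contrapT => h; apply: nE; suff -> : x = y by [].
    by apply: sep => m; apply/eqP; apply: contrapT => /negP xy; apply: h; exists m.
  have d0 : 0 < `|phi m x - phi m y| by rewrite normr_gt0 subr_eq0.
  pose n := maxn m (Num.truncn `|phi m x - phi m y|^-1).
  exists (V n); first by exists n.
  exists m; rewrite /= ?leq_maxl// /U /=.
  rewrite -[ltRHS]invrK ltf_pV2 ?posrE ?invr_gt0 ?ltr0n//.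
  by apply: lt_le_trans (truncnS_gt _) _; rewrite ler_nat ltnS leq_maxr.
have V_incr n n' : (n <= n')%N -> V n `<=` V n'.
  move=> nn' p [m /= mn mp]; exists m; first exact: leq_trans nn'.
  by apply: le_lt_trans mp; rewrite lef_pV2 ?posrE ?ltr0n// ler_nat ltnS.
have [n nP] : exists n, \bigcup_(A in D) A `<=` V n.
  move/finite_seqP: fD DV => -[s ->] {D ED}; elim: s => [|A s IHs] sV.
    by exists 0%N => p [].
  have [n nP] : exists n, \bigcup_(A in [set` s]) A `<=` V n.
    by apply: IHs => C Cs; apply: sV; rewrite /= inE Cs orbT.
  have [n' _ AV] : range V A by apply: sV; rewrite /= inE eqxx.
  exists (maxn n n') => p [C /=]; rewrite inE => /orP[/eqP->|Cs] Cp.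
    by apply: (V_incr n'); [exact: leq_maxr|rewrite AV].
  by apply: (V_incr n); [exact: leq_maxl|apply: nP; exists C].
exists n => x y h; apply: contrapT => nE.
have [m /= mn] := nP _ (ED _ nE).
by rewrite /U /= ltNge => /negP; apply; exact/ltW/h.
Qed.

Lemma near_ptP d (x y : B) :
  near_pt d x y <-> forall k, (k < 4)%N -> `|bouquet_coord k x - bouquet_coord k y| < d.
Proof.
split=> [[h0 h1 h2 h3] [|[|[|[|k]]]]//|h].
by split; [exact: (h 0%N)|exact: (h 1%N)|exact: (h 2%N)|exact: (h 3%N)].
Qed.

Lemma near_entourage (X : topologicalType) (g : X -> B) (d : R) : continuous g -> 0 < d ->
  open [set p : X * X | near_pt d (g p.1) (g p.2)] /\ forall x, near_pt d (g x) (g x).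
Proof.
move=> cg d0; split=> [|x]; last exact: near_refl.
have cU k : open [set p : X * X | `|bouquet_coord k (g p.1) - bouquet_coord k (g p.2)| < d].
  have c : continuous (fun p : X * X => `|bouquet_coord k (g p.1) - bouquet_coord k (g p.2)|).
    move=> p; apply: (@cvg_norm _ R^o); apply: (@cvgB _ R^o).
      exact: (comp_cont (comp_cont fst_cont cg) (@bouquet_coord_cont R k)).
    exact: (comp_cont (comp_cont snd_cont cg) (@bouquet_coord_cont R k)).
  apply: (@open_comp (X * X)%type R
    (fun p => `|bouquet_coord k (g p.1) - bouquet_coord k (g p.2)|) [set x | x < d]) => [p _|].
    exact: c.
  exact: open_lt.
have := openI (openI (cU 0%N) (cU 1%N)) (openI (cU 2%N) (cU 3%N)).
congr open; apply/seteqP; split=> p; first by move=> [[h0 h1] [h2 h3]].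
by move=> [h0 h1 h2 h3].
Qed.

Lemma interval_uniform (g : I -> B) (d : R) : continuous g -> 0 < d ->
  exists2 e, 0 < e & forall t s, `|set_val t - set_val s| < e -> near_pt d (g t) (g s).
Proof.
move=> cg d0; have [oE Ex] := near_entourage cg d0.
have [n nP] := @separated_entourage I (fun _ t => set_val t) _ I_compact
  (fun _ => @set_val_continuous _ _) (fun x y h => val_inj (h 0%N)) oE Ex.
by exists n.+1%:R^-1 => [|t s ts]; [rewrite invr_gt0|exact: nP].
Qed.

Lemma bouquet_uniform (g : B -> B) (d : R) : continuous g -> 0 < d ->
  exists2 e, 0 < e & forall x y, near_pt e x y -> near_pt d (g x) (g y).
Proof.
move=> cg d0; have [oE Ex] := near_entourage cg d0.
have [n nP] := @separated_entourage B (fun m => bouquet_coord (m %% 4)) _ bouquet_compact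
  (fun m => @bouquet_coord_cont R _)
  (fun x y h => bouquet_coord_inj (fun k k4 =>
     etrans (congr1 (fun m => bouquet_coord m x) (esym (modn_small k4)))
       (etrans (h k) (congr1 (fun m => bouquet_coord m y) (modn_small k4))))) oE Ex.
exists n.+1%:R^-1 => [|x y /near_ptP xy]; first by rewrite invr_gt0.
by apply: nP => m _; apply: xy; rewrite ltn_mod.
Qed.

Lemma iter_uniform (m : nat) (d : R) : 0 < d ->
  exists2 e, 0 < e & forall x y, near_pt e x y -> forall j, (j <= m)%N ->
    near_pt d (iter j (bouquet_gmap R) x) (iter j (bouquet_gmap R) y).
Proof.
move=> d0; elim: m => [|m [e e0 IH]].
  by exists d => // x y xy j; rewrite leqn0 => /eqP ->.
have [e' e'0 h] := bouquet_uniform (@iter_continuous (bouquet_space R) (bouquet_gmap R) m.+1) d0.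
exists (Num.min e e') => [|x y xy j]; first by rewrite lt_min e0.
rewrite leq_eqVlt => /orP[/eqP ->|]; last rewrite ltnS.
  by apply: h; apply: near_weak xy; rewrite ge_min lexx orbT.
by apply: IH; apply: near_weak xy; rewrite ge_min lexx.
Qed.

Lemma bouquet_homotopy_uniform (H : B * I -> B) (d : R) : continuous H -> 0 < d ->
  exists2 e, 0 < e & forall x y t s, near_pt e x y -> `|set_val t - set_val s| < e ->
    near_pt d (H (x, t)) (H (y, s)).
Proof.
move=> cH d0; have [oE Ex] := near_entourage cH d0.
have c : compact [set: B * I] by rewrite -setXTT; exact: compact_setX bouquet_compact I_compact.
pose phi m (p : B * I) := if m is k.+1 then bouquet_coord (k %% 4) p.1 else set_val p.2.
have [||n nP] := @separated_entourage _ phi _ c _ _ oE Ex.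
- case=> [|m]; first exact: (comp_cont snd_cont (@set_val_continuous _ _)).
  exact: (comp_cont fst_cont (@bouquet_coord_cont R _)).
- move=> [x t] [y s] h; congr pair; last exact: val_inj (h 0%N).
  by apply: bouquet_coord_inj => k k4; have := h k.+1; rewrite /phi /= modn_small.
exists n.+1%:R^-1 => [|x y t s /near_ptP xy ts]; first by rewrite invr_gt0.
apply: (nP (x, t) (y, s)) => -[|m] _ //=.
by apply: xy; rewrite ltn_mod.
Qed.

(** Closeness in the limit involves finitely many coordinates, on finitely many levels, and any
    level above all of these controls them uniformly through the iterates of the bonding map. *)
Lemma limit_homotopy_uniform (H : P * I -> B) (d : R) (n : nat) : continuous H -> 0 < d ->
  exists2 m, (n <= m)%N & exists2 e, 0 < e & forall p q t s,
    near_pt e (set_val p m) (set_val q m) -> `|set_val t - set_val s| < e ->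
    near_pt d (H (p, t)) (H (q, s)).
Proof.
move=> cH d0; have [oE Ex] := near_entourage cH d0.
have c : compact [set: P * I] by rewrite -setXTT; exact: compact_setX bouquet_limit_compact I_compact.
pose phi m (p : P * I) := if m is k.+1 then limit_coord k p.1 else set_val p.2.
have [||n' nP] := @separated_entourage _ phi _ c _ _ oE Ex.
- case=> [|m]; first exact: (comp_cont snd_cont (@set_val_continuous _ _)).
  exact: (comp_cont fst_cont (@limit_coord_cont R _)).
- move=> [x t] [y s] h; congr pair; last exact: val_inj (h 0%N).
  by apply: limit_coord_inj => k; exact: (h k.+1).
exists (maxn n n'); first exact: leq_maxl.
have n'0 : 0 < n'.+1%:R^-1 :> R by rewrite invr_gt0.
have [e e0 eP] := iter_uniform (maxn n n') n'0.
exists (Num.min e n'.+1%:R^-1) => [|p q t s]; first by rewrite lt_min e0.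
rewrite lt_min => pq /andP[_ ts].
apply: (nP (p, t) (q, s)) => -[|m] mn //=.
have mM : (m %/ 4 <= maxn n n')%N.
  by apply: leq_trans (leq_div _ _) (leq_trans (ltnW mn) (leq_maxr _ _)).
have /eP/(_ _ (leq_subr (m %/ 4) _)) : near_pt e (set_val p (maxn n n')) (set_val q (maxn n n')).
  by apply: near_weak pq; rewrite ge_min lexx.
rewrite !(@iter_limit_proj (bouquet_space R))// => /near_ptP; apply.
by rewrite ltn_mod.
Qed.

End uniform_continuity.

(** * The obstruction read off at a finite level *)

Section monodromy_obstruction.
Context {R : realType}.
Local Notation B := (bouquet_space R).
Local Notation P := (bouquet_limit R).
Local Notation I := (unit_interval R).
Local Notation f := (bouquet_gmap R).

Lemma fine_mesh (e : R) : 0 < e -> exists2 N, (8 <= N)%N & N%:R^-1 < e.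
Proof.
move=> e0; exists (maxn 8 (Num.truncn e^-1).+1); first exact: leq_maxl.
rewrite -[ltRHS]invrK ltf_pV2 ?posrE ?invr_gt0 ?ltr0n ?leq_max//.
by apply: lt_le_trans (truncnS_gt _) _; rewrite ler_nat leq_maxr.
Qed.

Definition mesh (N i : nat) : I := to_I (i%:R / N%:R).

Lemma set_val_mesh N i : (0 < N)%N -> (i <= N)%N -> set_val (mesh N i) = i%:R / N%:R.
Proof.
move=> N0 iN; rewrite set_val_to_I clip_id// ?divr_ge0//.
by rewrite ler_pdivrMr ?ltr0n// mul1r ler_nat.
Qed.

Lemma mesh_step N i : (i < N)%N ->
  `|set_val (mesh N i) - set_val (mesh N i.+1)| = N%:R^-1.
Proof.
move=> iN; have N0 : (0 < N)%N by exact: leq_trans iN.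
rewrite !set_val_mesh// ?(ltnW iN)// -mulrBl -natr1 opprD addNKr mulN1r normrN.
by rewrite ger0_norm// invr_ge0.
Qed.

Lemma standard_loop_chain (d : R) : 0 < d ->
  exists2 e : R, 0 < e & forall N, (8 <= N)%N -> N%:R^-1 < e -> chain d N (standard_loop N).
Proof.
move=> d0; have c : continuous (fun t : I => loop_a (2 * pi * set_val t)).
  apply: (@comp_cont _ R _ (fun t : I => 2 * pi * set_val t)); last exact: loop_a_continuous.
  apply: (@comp_cont _ R R set_val (fun t => 2 * pi * t)); first exact: set_val_continuous.
  by move=> t; apply: cvgM; [exact: cvg_cst|exact: cvg_id].
have [e e0 eP] := interval_uniform c d0.
exists e => // N N8 Ne i iN; have N0 : (0 < N)%N by exact: leq_trans iN.
have := eP (mesh N i) (mesh N i.+1); rewrite mesh_step// => /(_ Ne).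
by rewrite !set_val_mesh// ltnW.
Qed.

(** Only closeness along the chain [x] matters, so the domain is a bare type and [x] may come from a
    discontinuous choice of points. The time interval is cut into steps finer than [e]. *)
Lemma hol_loop_homotopy (G : groupType) (p : G * G) (T : Type) (H : T * I -> B) (e : R)
    (x : nat -> T) (N : nat) : 0 < e ->
  (forall i, (i < N)%N -> forall t, near_pt (1/4) (H (x i, t)) (H (x i.+1, t))) ->
  (forall i t s, `|set_val t - set_val s| < e -> near_pt (1/4) (H (x i, t)) (H (x i, s))) ->
  x N = x 0%N ->
  conjugate (hol p (fun i => H (x i, to_I 0)) N) (hol p (fun i => H (x i, to_I 1)) N).
Proof.
move=> e0 hx ht xN; have [S S8 Se] := fine_mesh e0.
have S0 : (0 < S)%N by exact: leq_trans S8.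
have := @hol_homotopy G R p N S (fun s i => H (x i, mesh S s)).
rewrite /mesh mul0r divff ?pnatr_eq0 -?lt0n//; apply=> [s _ i iN|s i sS _|s].
- exact: hx.
- by apply: ht; rewrite -/(mesh S s) -/(mesh S s.+1) mesh_step.
- by rewrite xN.
Qed.

(* By compactness the homotopy [H] can be read off, up to a small error, at a finite
   level [M]. Lifting a fine subdivision of the first loop from the level [M] to the
   limit, [H] makes its images under [v] (from the level [n]) and under the [M]-th
   iterate of the bonding map conjugate in holonomy. *)
Lemma monodromy_obstruction (v : B -> B) (n : nat) (H : P * I -> B) :
  continuous H -> (forall p t, set_val t = 0 -> H (p, t) = v (set_val p n)) ->
  (forall p t, set_val t = 1 -> H (p, t) = set_val p 0%N) ->
  exists M, forall (G : groupType) (g : G * G) (Q : G -> Prop) (k : nat)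
    (s : B -> B) (L : B * I -> B), normal_pred Q ->
    Q (comm_pair g k).1 -> Q (comm_pair g k).2 -> continuous s -> continuous L ->
    (forall x t, set_val t = 0 -> L (x, t) = v x) ->
    (forall x t, set_val t = 1 -> L (x, t) = iter k f (s x)) ->
    Q (comm_pair g M).1.
Proof.
move=> cH H0 H1; have d4 : 0 < 1/4 :> R by lra.
have d100 : 0 < 1/100 :> R by lra.
have [M nM [e e0 eP]] := limit_homotopy_uniform n cH d4.
(* [lift] is a mere choice without continuity: by [eP], closeness at the level [M] is enough to
   control [H] on the lifted points. *)
have [lift liftP] := choice (bouquet_limit_proj_surj (R := R) M).
exists M => G g Q k s L nQ Q1 Q2 cs cL L0 L1.
have [eL eL0 eLP] := bouquet_homotopy_uniform cL d4.
have [e1 e10 e1P] := iter_uniform k d100.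
have [e2 e20 e2P] := bouquet_uniform cs e10.
have e30 : 0 < Num.min eL (Num.min e2 (1/100)) by rewrite !lt_min eL0 e20.
have [e3 e3p e3P] := iter_uniform M e30.
have d0 : 0 < Num.min e e3 by rewrite lt_min e0.
have [eN eN0 eNP] := standard_loop_chain d0.
have [N N8 Ne] := fine_mesh eN0; have N0 : (0 < N)%N by exact: leq_trans N8.
pose a : nat -> B := standard_loop N.
have ca : chain (Num.min e e3) N a by exact: eNP.
have aN : a N = a 0%N by exact: standard_loop_closed.
have c1 i : (i < N)%N -> near_pt e (a i) (a i.+1).
  by move=> /ca; apply: near_weak; rewrite ge_min lexx.
have c3 i j : (i < N)%N -> (j <= M)%N ->
    [/\ near_pt eL (iter j f (a i)) (iter j f (a i.+1)),
        near_pt e2 (iter j f (a i)) (iter j f (a i.+1))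
      & near_pt (1/100) (iter j f (a i)) (iter j f (a i.+1))].
  move=> iN jM; have ai3 : near_pt e3 (a i) (a i.+1).
    by apply: near_weak (ca i iN); rewrite ge_min lexx orbT.
  have h := e3P _ _ ai3 j jM.
  by split; apply: near_weak h; rewrite !ge_min lexx ?orbT.
pose b i := iter (M - n) f (a i).
have I0 : set_val (to_I 0 : I) = 0 by rewrite set_val_to_I clip_le0.
have I1 : set_val (to_I 1 : I) = 1 by rewrite set_val_to_I clip_ge1.
have near_t (t : I) (d : R) : 0 < d -> `|set_val t - set_val t| < d by rewrite subrr normr0.
have conjM : conjugate (hol g (fun i => v (b i)) N) (hol g (fun i => iter M f (a i)) N).
  have := @hol_loop_homotopy G g _ H e (fun i => lift (a i)) N e0.
  rewrite (_ : (fun i => H (lift (a i), to_I 0)) = (fun i => v (b i))); last first.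
    by apply/funext => i; rewrite H0// -(iter_limit_proj _ nM) liftP.
  rewrite (_ : (fun i => H (lift (a i), to_I 1)) = (fun i => iter M f (a i))); last first.
    by apply/funext => i; rewrite H1// -(iter_limit_proj _ (leq0n M)) liftP subn0.
  apply=> [i iN t|i t t' tt'|]; last by rewrite aN.
    by apply: eP; [rewrite !liftP; exact: c1|exact: near_t].
  by apply: eP => //; exact: near_refl.
have conjk : conjugate (hol g (fun i => v (b i)) N) (hol g (fun i => iter k f (s (b i))) N).
  have := @hol_loop_homotopy G g _ L eL b N eL0.
  rewrite (_ : (fun i => L (b i, to_I 0)) = (fun i => v (b i))); last first.
    by apply/funext => i; rewrite L0.
  rewrite (_ : (fun i => L (b i, to_I 1)) = (fun i => iter k f (s (b i)))); last first.
    by apply/funext => i; rewrite L1.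
  apply=> [i iN t|i t t' tt'|]; last by rewrite /b aN.
    by apply: eLP; [have [] := c3 i (M - n)%N iN (leq_subr _ _)|exact: near_t].
  by apply: eLP => //; exact: near_refl.
have aM : conjugate (hol g (fun i => iter M f (a i)) N) (comm_pair g M).1.
  rewrite -(@hol_standard_loop _ R (comm_pair g M) N N8); apply: hol_iter => // j jM i iN.
  by have [] := c3 i j iN (ltnW jM).
apply: (conjugate_normal nQ (conjugate_sym aM)).
apply: (conjugate_normal nQ (conjugate_trans (conjugate_sym conjM) conjk)).
(* Pulling back along the [k]-th iterate replaces [g] by [comm_pair g k], whose entries satisfy [Q];
   whatever loop [s] produces, its holonomy is a product of these and their inverses. *)
apply: (@conjugate_normal _ Q _ (hol (comm_pair g k) (fun i => s (b i)) N)) => //; last exact: hol_normal.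
apply: hol_iter => [j jk i iN|]; last by rewrite /b aN.
by apply: e1P (ltnW jk); apply: e2P; have [] := c3 i (M - n)%N iN (leq_subr _ _).
Qed.

Lemma cong1_normal (q : int) : normal_pred (cong1 q).
Proof.
split; [exact: cong1_1|exact: cong1_M|exact: cong1_V|].
by move=> u x; exact: cong1_J.
Qed.

(** The level [M] depends on [H] only, and not on [k], so [k] can grow while [M] is fixed: the image
    of the first generator under the [M]-th iterate lies in all the congruence subgroups at once. *)
Lemma no_deep_factorization (v : B -> B) (n : nat) (H : P * I -> B) :
  continuous H -> (forall p t, set_val t = 0 -> H (p, t) = v (set_val p n)) ->
  (forall p t, set_val t = 1 -> H (p, t) = set_val p 0%N) ->
  ~ forall k, exists (s : B -> B) (L : B * I -> B), [/\ continuous s, continuous L,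
    forall x t, set_val t = 0 -> L (x, t) = v x
    & forall x t, set_val t = 1 -> L (x, t) = iter k f (s x)].
Proof.
move=> cH H0 H1 h; have [M MP] := monodromy_obstruction cH H0 H1.
have /eqP := comm_pair_neq1 M; apply; apply: cong1_all => k.
have [s [L [cs cL L0 L1]]] := h k; have [Q1 Q2] := cong1_comm_pair k.
have := MP _ gens _ k s L (cong1_normal (2 ^+ k.+1)) Q1 Q2 cs cL L0 L1.
case=> [[[[a b] c] d] E]; exists (2 * a, 2 * b, 2 * c, 2 * d).
by rewrite E exprSr !mulrA.
Qed.

End monodromy_obstruction.

(** * Non-movability *)

Section non_movability.
Context {R : realType}.
Local Notation B := (bouquet_space R).
Local Notation P := (bouquet_limit R).
Local Notation f := (bouquet_gmap R).

Definition limit_proj (n : nat) : gMap P B :=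
  @GMap _ P B (fun p => set_val p n) (@limit_proj_continuous B f n) (fun _ _ => erefl).

Definition iter_gmap (k : nat) : gMap B B :=
  @GMap _ B B (iter k f) (@iter_continuous B f k) (@iter_equivariant B f k).

(** Movability is used at an index [a] through which the projection to level 0 factors. The index
    [a'] it returns does not depend on how far the system is then followed, so the single map [v],
    obtained by factoring [p a'] through a finite level, factors up to homotopy through every
    iterate of the bonding map. *)
Lemma bouquet_limit_not_movable : ~ gmovable R P.
Proof.
move=> [S [aS [p [pP univ]] movS]].
have [univ1 univ2] := univ B bouquet_gANR.
have [a [phi phiE]] := univ1 (limit_proj 0).
have [a' [h movr]] := movS a.
have [n [psi0 [cpsi epsi psiE]]] := @bouquet_limit_factorization R Z2 id (S a') (p a')
  (fun g => @discrete_set1 bool g) (fun _ _ => erefl) (fun g => ex_intro _ g erefl)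
  (aS a') (@gfun_continuous _ _ _ (p a')) (@gfun_equivariant _ _ _ (p a')).
pose psi : gMap B (S a') := GMap cpsi epsi.
pose v : gMap B B := phi \og sys_map h \og psi.
have [H [cH _ H0 H1]] : ghomotopic R (v \og limit_proj n) (limit_proj 0).
  apply: ghomotopic_sym; apply: ghomotopic_trans phiE _.
  apply: (ghomotopic_trans (ghomotopic_compl phi (pP a a' h))).
  exact: (ghomotopic_compl (phi \og sys_map h) (psiE : ghomotopic R (p a') (psi \og limit_proj n))).
apply: (no_deep_factorization cH H0 H1) => k.
have [a1 [phi1 phi1E]] := univ1 (limit_proj k).
have [a2 [h12 h02]] := sys_directed a1 a.
(* Composed with the projection from the limit, both maps represent the projection to level 0, so
   the uniqueness condition makes them homotopic from some later index [a3] on. *)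
have [|a3 [h23 E3]] := univ2 a2 (iter_gmap k \og phi1 \og sys_map h12) (phi \og sys_map h02).
  apply: (@ghomotopic_trans _ _ _ _ _ (limit_proj 0)).
    apply: ghomotopic_sym.
    apply: (@ghomotopic_trans _ _ _ _ _ (iter_gmap k \og limit_proj k)).
      by apply: ghomotopic_refl => x /=; rewrite -(iter_limit_proj x (leq0n k)) subn0.
    apply: (ghomotopic_trans (ghomotopic_compl (iter_gmap k) phi1E)).
    exact: (ghomotopic_compl (iter_gmap k \og phi1) (pP a1 a2 h12)).
  exact: (ghomotopic_trans phiE (ghomotopic_compl phi (pP a a2 h02))).
(* The map given by movability goes from [S a'] out to [S a3], where the comparison [E3] with the
   [k]-th iterate is available. *)
have [r rE] := movr a3 (sys_trans h02 h23).
pose s : gMap B B := phi1 \og sys_map h12 \og sys_map h23 \og r \og psi.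
have [L [cL _ L0 L1]] : ghomotopic R v (iter_gmap k \og s).
  apply: (ghomotopic_trans (ghomotopic_compl phi (ghomotopic_compr psi (ghomotopic_sym rE)))).
  apply: (ghomotopic_trans (ghomotopic_compl phi (ghomotopic_compr (r \og psi)
    (ghomotopic_sym (sys_map_comp h02 h23 (sys_trans h02 h23)))))).
  exact: (ghomotopic_compr (r \og psi) (ghomotopic_sym E3)).
by exists s, L; split=> //; exact: gfun_continuous.
Qed.

End non_movability.

Theorem proposition4 (R : realType) :
  let P := bouquet_limit R in
  let p0 := bouquet_limit_base R in
  [/\ connected [set: P], compact [set: P] & metrizable R P] /\
  ~ gmovable R P /\
  (forall x : P, free_at x <-> x <> p0) /\
  (forall x : P, fixed_point x <-> x = p0) /\
  trivial_shape R (orbit_space P).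
Proof.
split.
  split; [exact: bouquet_limit_connected|exact: bouquet_limit_compact|].
  exact: bouquet_limit_metrizable.
split; first exact: bouquet_limit_not_movable.
split; first exact: limit_free_at.
by split; [exact: limit_fixed_point|exact: orbit_space_trivial_shape].
Qed.
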